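(* Let $p_1,p_2,q$ be distinct primes with $p_1\equiv p_2\equiv -q\equiv1\pmod 4$, $k=\mathbb{Q}(\sqrt{p_1p_2q},i)$, $\mathbb{K}_1=k(\sqrt{p_1})$, $\epsilon_{p_2q}=a+b\sqrt{p_2q}$ and $\epsilon_{p_1p_2q}=x+y\sqrt{p_1p_2q}$ with $a,b,x,y\in\mathbb{Z}$. 1. If $x\pm1$ is a square in $\mathbb{N}$ and neither $a+1$ nor $a-1$ is, then $\kappa_{\mathbb{K}_1}=\langle[\mathcal H_1],[\mathcal H_2],[\mathcal H_3\mathcal H_4]\rangle$. 2. If $a\pm1$ and ($p_1(x\pm1)$ or $2p_1(x\pm1)$) are squares in $\mathbb{N}$, then $\kappa_{\mathbb{K}_1}=\langle[\mathcal H_1]\rangle$. 3. If neither $a+1$ nor $a-1$ is a square in $\mathbb{N}$ and $p_1(x\pm1)$ or $2p_1(x\pm1)$ is, then $\kappa_{\mathbb{K}_1}=\langle[\mathcal H_1],[\mathcal H_3\mathcal H_4]\rangle$. 4. In all other cases, $\kappa_{\mathbb{K}_1}=\langle[\mathcal H_1],[\mathcal H_2]\rangle$.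
   Context: $i=\sqrt{-1}$; $\epsilon_m>1$ is the fundamental unit of $\mathbb{Q}(\sqrt m)$. For integers $c,u$, ''$c(u\pm1)$ is a square in $\mathbb{N}$'' means at least one of $c(u+1)$, $c(u-1)$ is the square of a natural number. Write $p_1=e^2+4f^2$, $p_2=g^2+4h^2$ ($e,f,g,h\in\mathbb{N}$), $\pi_1=e+2if$, $\pi_2=e-2if$, $\pi_3=g+2ih$, $\pi_4=g-2ih$; $\mathcal H_j$ is the prime ideal of $k$ above $\pi_j$ and $[\cdot]$ denotes ideal class in $k$. $\kappa_{\mathbb{K}_1}$ is the kernel of the map $\mathrm{Cl}(k)\to\mathrm{Cl}(\mathbb{K}_1)$ induced by extension of ideals. *)

(* Defs.v *)
From mathcomp Require Import all_boot all_order all_algebra all_field.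
From mathcomp Require Import boolp classical_sets.

Set Implicit Arguments.
Unset Strict Implicit.
Unset Printing Implicit Defensive.

Import Order.TTheory GRing.Theory Num.Theory.
Local Open Scope classical_set_scope.
Local Open Scope ring_scope.

(** Number fields are subfields of [algC], given as classical sets; ideals of
    their rings of integers are therefore sets of algebraic numbers too. *)

(* The field Q(S). *)
Definition Qadjoin (S : set algC) : set algC :=
  smallest (fun F : set algC => divring_closed (mem F)) S.

Definition ring_of_integers (K : set algC) : set algC :=
  [set x | K x /\ x \in Aint].

Definition integral_unit (K : set algC) (u : algC) : Prop :=
  [/\ u != 0, ring_of_integers K u & ring_of_integers K u^-1].

(* In [algC], [1 < eps] entails that [eps] is real. *)
Definition fundamental_unit (K : set algC) (eps : algC) : Prop :=
  [/\ integral_unit K eps, 1 < eps &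
      forall u, integral_unit K u -> exists n : int, u = eps ^ n \/ u = - eps ^ n].

Definition scale_set (a : algC) (I : set algC) : set algC :=
  [set a * x | x in I].

Definition principal_ideal (K : set algC) (a : algC) : set algC :=
  scale_set a (ring_of_integers K).

Definition submodule (K I : set algC) : Prop :=
  [/\ I 0, forall x y, I x -> I y -> I (x + y) &
      forall a x, ring_of_integers K a -> I x -> I (a * x)].

Definition fractional_ideal (K I : set algC) : Prop :=
  [/\ I `<=` K, submodule K I, exists2 x, I x & x != 0 &
      exists d, [/\ ring_of_integers K d, d != 0 &
                    scale_set d I `<=` ring_of_integers K]].

Definition prime_ideal (K P : set algC) : Prop :=
  [/\ P `<=` ring_of_integers K, submodule K P, ~ P 1 &
      forall x y, ring_of_integers K x -> ring_of_integers K y ->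
        P (x * y) -> P x \/ P y].

Definition prime_ideal_above (F K : set algC) (pi : algC) (P : set algC) : Prop :=
  prime_ideal K P /\ P `&` ring_of_integers F = principal_ideal F pi.

Definition ideal_mul (I J : set algC) : set algC :=
  [set x | exists (n : nat) (a b : 'I_n -> algC),
     [/\ forall i, I (a i), forall i, J (b i) & x = \sum_(i < n) a i * b i]].

Definition ideal_inv (K I : set algC) : set algC :=
  [set x | K x /\ forall y, I y -> ring_of_integers K (x * y)].

(* The extended ideal I O_L. *)
Definition ideal_ext (L I : set algC) : set algC :=
  ideal_mul I (ring_of_integers L).

(* An ideal class is the set of all fractional ideals a I with a in K^*. *)
Definition ideal_class (K I : set algC) : set (set algC) :=
  [set scale_set a I | a in [set a | K a /\ a != 0]].

Definition Cl (K : set algC) : set (set (set algC)) :=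
  [set ideal_class K I | I in fractional_ideal K].

Definition Cl_one (K : set algC) : set (set algC) :=
  ideal_class K (ring_of_integers K).

(* Since (a I)(b J) = (a b) I J and (a I)^-1 = a^-1 I^-1, elementwise products
   and inverses of classes are again classes. *)
Definition Cl_mul (c d : set (set algC)) : set (set algC) :=
  [set ideal_mul I J | I in c & J in d].

Definition Cl_inv (K : set algC) (c : set (set algC)) : set (set algC) :=
  [set ideal_inv K I | I in c].

Definition Cl_subgroup (K : set algC) (G : set (set (set algC))) : Prop :=
  [/\ G `<=` Cl K, G (Cl_one K),
      forall c d, G c -> G d -> G (Cl_mul c d) &
      forall c, G c -> G (Cl_inv K c)].

Definition Cl_gen (K : set algC) (S : set (set (set algC))) :
    set (set (set algC)) :=
  smallest (Cl_subgroup K) S.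

(* The map Cl(K) -> Cl(L): for K included in L all the I in c have the same
   extended class, so the union is that class. *)
Definition Cl_ext (L : set algC) (c : set (set algC)) : set (set algC) :=
  \bigcup_(I in c) ideal_class L (ideal_ext L I).

Definition capitulation_kernel (K L : set algC) : set (set (set algC)) :=
  [set c | Cl K c /\ Cl_ext L c = Cl_one L].

Definition nat_square (z : int) : Prop := exists n : nat, z = (n ^ 2)%N%:Z.

Definition pm1_square (c u : int) : Prop :=
  nat_square (c * (u + 1)) \/ nat_square (c * (u - 1)).

(* Main.v *)
(** Write L = K1, r1 = sqrt p1 and let sigma generate Gal(L/k). If I O_L is
    generated by alpha, then I^2 is generated by the norm of alpha, and
    u = alpha / sigma(alpha) is a unit of relative norm 1 in the square class of
    that norm. Conversely an ideal I with I^2 = (beta) capitulates as soon as beta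
    is a unit times a square of L, because O_L is integrally closed. Hence the
    kernel is read off from the square classes of the units u of L with
    u sigma(u) = 1.

    Taking norms to Q(i, r1) and Q(i, sqrt(p2 q)) shows that such a u is a power
    of i times a unit w of Q(r1) times a power of epsilon_{p2 q}. A totally
    positive unit of Q(r1) is a square, and a unit of norm -1 lies in the square
    class of pi_1 up to a power of i, so w contributes [H_1]. The square class of
    epsilon_{p2 q} is that of i when a + 1 or a - 1 is a square and that of p2 up
    to a power of i otherwise, which contributes [H_3 H_4]. Passing from square
    classes of L back to k adds p1, that is [H_1 H_2]. Finally the relation
    2 (x +- 1) epsilon = (x +- 1 + y sqrt d)^2 decides which of the classes
    [H_1 H_2], [H_3 H_4], [H_1 H_2 H_3 H_4] are trivial in k. *)
Require Import Defs.
From HB Require Import structures.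
From mathcomp Require Import all_boot all_order all_algebra all_field.
From mathcomp Require Import boolp classical_sets.
From mathcomp Require Import ring zify.

Set Implicit Arguments.
Unset Strict Implicit.
Unset Printing Implicit Defensive.

Import Order.TTheory GRing.Theory Num.Theory.
Local Open Scope classical_set_scope.
Local Open Scope ring_scope.

(** * Subfields of [algC] and automorphisms *)

(** The obstacle on the unit side is that norms to the two subfields only control [u ^+ 4]: [u ^+ 2]
    is a quotient of norms, and the square of each norm is a power of i times a totally positive
    real unit. Two square roots must then be taken in [L], and each could bring in a square root of
    [eps / 'i] when [eps] is i times a square. Norms exclude it: the norm of that root has square
    -1, which fits neither [u * sigma u = 1] nor the fact that odd powers of i are not squares in
    [L]. So the full unit group of [L] is never computed. On the ideal side only ideals with
    principal square occur, and equality of their classes reduces to square classes in [k]. The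
    factor 2 is harmless because 2i is the square of 1 + i; hence p1 (x +- 1) and 2 p1 (x +- 1)
    enter together. The case 2 (x +- 1) never occurs, since it would make the fundamental unit a
    square in its own real field. The unit of norm -1 of Q(sqrt p1) comes from a nontrivial Pell
    solution by repeated square roots, which lower the trace. *)

Definition subfield (F : set algC) : Prop :=
  [/\ F 1, forall x y, F x -> F y -> F (x - y) &
      forall x y, F x -> F y -> F (x / y)].

Lemma subfieldP (F : set algC) : divring_closed (mem F) <-> subfield F.
Proof.
split=> [[F1 FB FV]|[F1 FB FV]]; split.
- by have := F1; rewrite inE.
- by move=> x y Fx Fy; have := FB x y; rewrite !inE; apply.
- by move=> x y Fx Fy; have := FV x y; rewrite !inE; apply.
- by rewrite inE.
- by move=> x y; rewrite !inE; apply: FB.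
- by move=> x y; rewrite !inE; apply: FV.
Qed.

Section Subfield.
Variables (F : set algC) (hF : subfield F).

Lemma sf1 : F 1. Proof. by case: hF. Qed.
Lemma sfB x y : F x -> F y -> F (x - y). Proof. by case: hF => _ h _; apply: h. Qed.
Lemma sfV' x y : F x -> F y -> F (x / y). Proof. by case: hF => _ _ h; apply: h. Qed.
Lemma sf0 : F 0. Proof. by rewrite -(subrr 1); apply: sfB; apply: sf1. Qed.
Lemma sfN x : F x -> F (- x). Proof. by move=> Fx; rewrite -sub0r; apply: sfB => //; apply: sf0. Qed.
Lemma sfD x y : F x -> F y -> F (x + y).
Proof. by move=> Fx Fy; rewrite -(opprK y); apply: sfB => //; apply: sfN. Qed.
Lemma sfV x : F x -> F x^-1. Proof. by move=> Fx; rewrite -div1r; apply: sfV' => //; apply: sf1. Qed.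
Lemma sfM x y : F x -> F y -> F (x * y).
Proof. by move=> Fx Fy; rewrite -(invrK y); apply: sfV' => //; apply: sfV. Qed.
Lemma sfX n x : F x -> F (x ^+ n).
Proof. by move=> Fx; elim: n => [|n IHn]; rewrite ?expr0 ?exprS; [apply: sf1|apply: sfM]. Qed.
Lemma sf_nat n : F n%:R.
Proof. by elim: n => [|n IHn]; rewrite ?mulrS; [apply: sf0|apply: sfD => //; apply: sf1]. Qed.
Lemma sf_int (n : int) : F n%:~R.
Proof. by case: n => n; rewrite ?NegzE ?mulrNz; [|apply: sfN]; apply: sf_nat. Qed.
Lemma sfXz (n : int) x : F x -> F (x ^ n).
Proof. by case: n => n Fx; rewrite ?NegzE -?exprnN; [|apply: sfV]; apply: sfX. Qed.
Lemma sf_sum (I : Type) (r : seq I) (P : pred I) (f : I -> algC) :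
  (forall i, P i -> F (f i)) -> F (\sum_(i <- r | P i) f i).
Proof. by move=> h; elim/big_ind: _ => //; [apply: sf0 | move=> *; apply: sfD]. Qed.
Lemma sf_rat x : x \in Crat -> F x.
Proof.
by case/CratP => r ->; apply: sfV'; apply: sf_int.
Qed.
End Subfield.

Ltac fld := repeat first [ assumption
  | match goal with hF : subfield ?F |- ?F _ => first
    [ apply: (sfB hF) | apply: (sfD hF) | apply: (sfN hF) | apply: (sfM hF) | apply: (sfV hF)
    | apply: (sfX hF) | apply: (sfXz hF) | apply: (sf_nat hF) | apply: (sf_int hF)
    | apply: (sf1 hF) | apply: (sf0 hF) | by apply: (sf_nat hF 2) | by apply: (sf_rat hF) ] end ].

Lemma Qadjoin_subfield (S : set algC) : subfield (Qadjoin S).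
Proof.
split; rewrite /Qadjoin /smallest /=.
- by move=> A [/subfieldP hA _]; apply: sf1.
- by move=> x y hx hy A hAS; have [/subfieldP hA _] := hAS; apply: sfB (hx A hAS) (hy A hAS).
- by move=> x y hx hy A hAS; have [/subfieldP hA _] := hAS; apply: sfV' (hx A hAS) (hy A hAS).
Qed.

Lemma Qadjoin_gen (S : set algC) : S `<=` Qadjoin S.
Proof. by move=> x Sx A [_ sA]; apply: sA. Qed.

Lemma Qadjoin_min (S F : set algC) : subfield F -> S `<=` F -> Qadjoin S `<=` F.
Proof. by move=> hF SF x; apply; split => //; apply/subfieldP. Qed.

Definition QQ : set algC := [set x | x \in Crat].

Lemma QQ_subfield : subfield QQ.
Proof.
split; rewrite /QQ /=; first exact: rpred1.
- by move=> x y; apply: rpredB.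
- by move=> x y; apply: rpred_div.
Qed.

Lemma QQ_sub F : subfield F -> QQ `<=` F.
Proof. by move=> hF x; apply: sf_rat. Qed.

Definition quad (F : set algC) (s : algC) : set algC :=
  [set z | exists a b, [/\ F a, F b & z = a + b * s]].

Lemma quad_base F s : subfield F -> F `<=` quad F s.
Proof. by move=> hF x Fx; exists x, 0; split; fld; rewrite mul0r addr0. Qed.

Lemma quad_gen F s : subfield F -> quad F s s.
Proof. by move=> hF; exists 0, 1; split; fld; rewrite mul1r add0r. Qed.

Lemma quad_sub F G s : subfield G -> F `<=` G -> G s -> quad F s `<=` G.
Proof. by move=> hG FG Gs z [a [b [/FG Fa /FG Fb ->]]]; fld. Qed.

Lemma quad_subfield F s : subfield F -> F (s ^+ 2) -> subfield (quad F s).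
Proof.
(* When [s] lies in [F] the conjugate [c - e * s] of a nonzero element can vanish, so this case is
   settled first. *)
move=> hF Fs2; have [Fs|nFs] := pselect (F s).
  suff -> : quad F s = F by [].
  by apply/seteqP; split; [apply: quad_sub | apply: quad_base].
split; first by apply: quad_base => //; fld.
  move=> _ _ [a [b [Fa Fb ->]]] [c [e [Fc Fe ->]]].
  by exists (a - c), (b - e); split; fld; ring.
move=> _ _ [a [b [Fa Fb ->]]] [c [e [Fc Fe ->]]].
have [->|ne0] := eqVneq (c + e * s) 0.
  by exists 0, 0; split; fld; rewrite invr0 mulr0 mul0r addr0.
have nz : c - e * s != 0.
  apply/eqP => h; have [e0|e0] := eqVneq e 0.
    by move: h ne0; rewrite e0 mul0r subr0 addr0 => ->; rewrite eqxx.
  apply: nFs; have -> : s = c / e by move/eqP: h; rewrite subr_eq0 => /eqP ->; field.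
  by fld.
exists ((a * c - b * e * s ^+ 2) / (c ^+ 2 - e ^+ 2 * s ^+ 2)),
  ((b * c - a * e) / (c ^+ 2 - e ^+ 2 * s ^+ 2)); split; fld.
have -> : c ^+ 2 - e ^+ 2 * s ^+ 2 = (c + e * s) * (c - e * s) by ring.
by field; rewrite ne0 nz.
Qed.

Lemma Qadjoin1 s : s ^+ 2 \in Crat -> Qadjoin [set s] = quad QQ s.
Proof.
move=> hs; have hQ := QQ_subfield; apply/seteqP; split.
  by apply: Qadjoin_min => [|_ ->]; [apply: quad_subfield | apply: quad_gen].
have hA := Qadjoin_subfield [set s].
by apply: quad_sub => //; [apply: QQ_sub | apply: Qadjoin_gen].
Qed.

Lemma Qadjoin_id F : subfield F -> Qadjoin F = F.
Proof. by move=> hF; apply/seteqP; split; [apply: Qadjoin_min | apply: Qadjoin_gen]. Qed.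

Lemma Qadjoin_setU (S : set algC) s : Qadjoin S (s ^+ 2) ->
  Qadjoin (S `|` [set s]) = quad (Qadjoin S) s.
Proof.
move=> hs; have hS := Qadjoin_subfield S; have hA := Qadjoin_subfield (S `|` [set s]).
apply/seteqP; split.
  apply: Qadjoin_min; first exact: quad_subfield.
  move=> z [/Qadjoin_gen Sz|->]; [exact: quad_base | exact: quad_gen].
apply: quad_sub => //; last by apply: Qadjoin_gen; right.
by apply: Qadjoin_min => // z Sz; apply: Qadjoin_gen; left.
Qed.

(** Used contrapositively: it carries the fact that [z] is not in [F] over to the abstract number
    field in which the automorphism is first built. *)
Lemma adjoin_seq_image (Qs : fieldExtType rat) (QsC : {rmorphism Qs -> algC})
    (F : set algC) (s : seq Qs) : subfield F ->
  (forall t, t \in s -> F (QsC t)) ->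
  forall x, x \in <<1 & s>>%VS -> F (QsC x).
Proof.
move=> hF; elim/last_ind: s => [|s t IHs] hs x.
  rewrite Fadjoin_nil => /vlineP[c ->].
  by rewrite alg_num_field fmorph_rat; fld; apply/CratP; exists c.
rewrite adjoin_rcons => /Fadjoin_poly_eq <-.
rewrite -horner_map /= horner_coef; apply: sf_sum => // i _.
have Ft : F (QsC t) by apply: hs; rewrite mem_rcons mem_head.
apply: sfM => //; last by fld.
rewrite coef_map /=; apply: IHs => [y ys|]; first by apply: hs; rewrite mem_rcons in_cons ys orbT.
by have /polyOverP := Fadjoin_polyOver <<1 & s>> t x; apply.
Qed.

(** Only a finite list is fixed, because the map is first defined on the number field generated by
    [z] and [s], by sending [z] to the other root of its quadratic minimal polynomial, and is then
    extended to [algC]. *)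
Lemma aut_exists (F : set algC) (s : seq algC) (z : algC) : subfield F ->
  (forall t, t \in s -> F t) -> ~ F z -> z ^+ 2 \in Crat ->
  exists nu : {rmorphism algC -> algC},
    (forall t, t \in s -> nu t = t) /\ nu z = - z.
Proof.
move=> hF sF nFz z2.
have [Qs [QsC [[|z1 s1] //= [Dz Ds] gen]]] := num_field_exists (z :: s).
pose K := <<1 & s1>>%AS.
have nKz : z1 \notin K.
  apply/negP => Kz; apply: nFz; rewrite -Dz; apply: (adjoin_seq_image hF _ Kz) => t ts.
  by apply: sF; rewrite -Ds map_f.
have full : <<K; z1>>%VS = fullv.
  apply/eqP; rewrite eqEsubv subvf -gen; apply/Fadjoin_seqP.
  split=> [|t]; first exact: subv_trans (subv_adjoin_seq _ _) (subv_adjoin _ _).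
  rewrite inE => /predU1P[->|ts]; first exact: memv_adjoin.
  by apply: subvP_adjoin; apply: seqv_sub_adjoin.
have z12 : z1 ^+ 2 \in K.
  case/CratP: z2 => r; rewrite -Dz -rmorphXn /= => /esym; rewrite -(fmorph_rat QsC) => /fmorph_inj <-.
  by rewrite -alg_num_field rpredZ // mem1v.
have homK : kHom 1 K (\1%VF : 'End(Qs)) by rewrite kHom1.
have sK z' : map_poly (\1%VF : 'End(Qs)) z' = z'.
  by rewrite map_poly_id // => ?; rewrite id_lfunE.
(* The minimal polynomial [m] divides (X - z1)(X + z1). If -z1 were not a root, X + z1 would divide
   the cofactor, [m] would divide X - z1, and [z1] would lie in [K]. *)
have rt : root (map_poly (\1%VF : 'End(Qs)) (minPoly K z1)) (- z1).
  rewrite sK; set m := minPoly K z1.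
  have /dvdpP[q' Dq] : m %| ('X - z1%:P) * ('X - (- z1)%:P).
    apply: minPoly_dvdp; last by rewrite rootM root_XsubC eqxx.
    rewrite (_ : _ * _ = 'X^2 - (z1 ^+ 2)%:P); last by rewrite rmorphN rmorphXn; ring.
    by rewrite rpredB ?polyOverXn ?polyOverC.
  apply/negPn/negP => nr.
  have /factor_theorem[q2 Dq2] : root q' (- z1).
    have : root (q' * m) (- z1) by rewrite -Dq rootM !root_XsubC eqxx orbT.
    by rewrite rootM (negPf nr) orbF.
  have Dm : 'X - z1%:P = q2 * m.
    have nz : 'X - (- z1)%:P != 0 by rewrite polyXsubC_eq0.
    by apply: (mulIf nz); rewrite Dq Dq2; ring.
  have : (size m <= 2)%N.
    have := @dvdp_leq _ m ('X - z1%:P); rewrite polyXsubC_eq0 size_XsubC; apply=> //.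
    by rewrite Dm dvdp_mull.
  rewrite size_minPoly ltnS => deg; case/negP: nKz; rewrite -adjoin_deg_eq1 eqn_leq deg; exact: isT.
pose phi := kHomExtend K \1 z1 (- z1).
have phim : monoid_morphism phi.
  by apply/kHom_monoid_morphism; rewrite -full; rewrite kHomExtendP ?sub1v.
pose phimM := GRing.isMonoidMorphism.Build _ _ phi phim.
pose phiRM : {rmorphism _ -> _} := HB.pack (fun_of_lfun phi) phimM.
have [nu Dnu] := extend_algC_subfield_aut QsC phiRM.
exists nu; split => [t|]; last first.
  rewrite -Dz -Dnu /= -rmorphN; congr (QsC _).
  by rewrite -{1}[z1]hornerX /phi (kHomExtend_poly homK rt) ?polyOverX // sK hornerX.
rewrite -Ds => /mapP[t1 ts ->]; rewrite -Dnu /=; congr (QsC _).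
have Kt : t1 \in K by apply: seqv_sub_adjoin.
by rewrite /phi -{1}[t1](hornerC t1 z1) (kHomExtend_poly homK rt) ?polyOverC // sK hornerC.
Qed.

(** * Ideals and ideal classes *)

Lemma Aint_sqr x : x ^+ 2 \in Aint -> x \in Aint.
Proof.
move=> hx; apply: (@root_monic_Aint (minCpoly (x ^+ 2) \Po 'X^2)).
- by rewrite /root horner_comp hornerXn; apply: root_minCpoly.
- rewrite monicE lead_coef_comp ?size_polyXn // lead_coefXn expr1n mulr1.
  by have := minCpoly_monic (x ^+ 2).
- by apply: polyOver_comp; rewrite ?polyOverXn.
Qed.

Lemma Aint_i : 'i \in Aint.
Proof. by apply: Aint_sqr; rewrite sqrCi rpredN Aint1. Qed.

Lemma sqrtC_Aint (n : nat) : sqrtC n%:R \in Aint.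
Proof. by apply: Aint_sqr; rewrite sqrtCK rpred_nat. Qed.

Local Notation OO := ring_of_integers.

Section IntegersOf.
Variables (K : set algC) (hK : subfield K).

Lemma OO0 : OO K 0. Proof. by split; [fld | apply: Aint0]. Qed.
Lemma OO1 : OO K 1. Proof. by split; [fld | apply: Aint1]. Qed.
Lemma OO_nat n : OO K n%:R. Proof. by split; [fld | apply: rpred_nat]. Qed.
Lemma OO_int (n : int) : OO K n%:~R. Proof. by split; [fld | apply: Aint_int]. Qed.
Lemma OON x : OO K x -> OO K (- x).
Proof. by move=> [Kx Ax]; split; [fld | rewrite rpredN]. Qed.
Lemma OOD x y : OO K x -> OO K y -> OO K (x + y).
Proof. by move=> [Kx Ax] [Ky Ay]; split; [fld | apply: rpredD]. Qed.
Lemma OOB x y : OO K x -> OO K y -> OO K (x - y).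
Proof. by move=> Ox Oy; apply: OOD => //; apply: OON. Qed.
Lemma OOM x y : OO K x -> OO K y -> OO K (x * y).
Proof. by move=> [Kx Ax] [Ky Ay]; split; [fld | apply: rpredM]. Qed.
Lemma OOX n x : OO K x -> OO K (x ^+ n).
Proof. by move=> [Kx Ax]; split; [fld | apply: rpredX]. Qed.
Lemma OO_sqr x : K x -> OO K (x ^+ 2) -> OO K x.
Proof. by move=> Kx [_ Ax]; split=> //; apply: Aint_sqr. Qed.

Lemma iu1 : integral_unit K 1.
Proof. by split; rewrite ?invr1 ?oner_eq0 //; apply: OO1. Qed.
Lemma iuM u v : integral_unit K u -> integral_unit K v -> integral_unit K (u * v).
Proof.
by case=> u0 Ou OuV [v0 Ov OvV]; split; rewrite ?mulf_neq0 ?invfM //; apply: OOM.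
Qed.
Lemma iuV u : integral_unit K u -> integral_unit K u^-1.
Proof. by case=> u0 Ou OuV; split; rewrite ?invr_eq0 ?invrK. Qed.
Lemma iuN u : integral_unit K u -> integral_unit K (- u).
Proof. by case=> u0 Ou OuV; split; rewrite ?oppr_eq0 ?invrN //; apply: OON. Qed.
Lemma iuX n u : integral_unit K u -> integral_unit K (u ^+ n).
Proof. by move=> hu; elim: n => [|n IHn]; rewrite ?expr0 ?exprS; [apply: iu1 | apply: iuM]. Qed.
Lemma iu_sqr u : K u -> integral_unit K (u ^+ 2) -> integral_unit K u.
Proof.
move=> Ku [u0 Ou OuV]; split; first by move: u0; rewrite expf_eq0.
  exact: OO_sqr.
by apply: OO_sqr; [fld | rewrite exprVn].
Qed.
Lemma iu_i : K 'i -> integral_unit K 'i.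
Proof.
move=> Ki; apply: iu_sqr => //; rewrite sqrCi; apply: iuN; apply: iu1.
Qed.
End IntegersOf.

Lemma OOS F K : F `<=` K -> OO F `<=` OO K.
Proof. by move=> FK x [/FK Kx Ax]; split. Qed.

Lemma iuS F K u : F `<=` K -> integral_unit F u -> integral_unit K u.
Proof. by move=> FK [u0 Ou OuV]; split=> //; apply: OOS FK _ _. Qed.

Lemma iu_morph (f : {rmorphism algC -> algC}) F K u :
  (forall x, F x -> K (f x)) -> integral_unit F u -> integral_unit K (f u).
Proof.
move=> FK [u0 [Fu Au] [FuV AuV]]; split; first by rewrite fmorph_eq0.
  by split; [apply: FK | rewrite Aint_aut].
by rewrite -fmorphV; split; [apply: FK | rewrite Aint_aut].
Qed.

(** * Products of sets of algebraic numbers and scaling *)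

Section IdealMul.
Implicit Types I J : set algC.

Lemma ideal_mul_ind I J (P : algC -> Prop) :
  P 0 -> (forall x y, P x -> P y -> P (x + y)) ->
  (forall a b, I a -> J b -> P (a * b)) -> forall x, ideal_mul I J x -> P x.
Proof.
move=> P0 PD PM x [n [a [b [Ia Jb ->]]]].
by elim/big_ind: _ => // i _; apply: PM.
Qed.

Lemma ideal_mul_mem I J a b : I a -> J b -> ideal_mul I J (a * b).
Proof. by move=> Ia Jb; exists 1%N, (fun=> a), (fun=> b); split=> //; rewrite big_ord1. Qed.

Lemma ideal_mul0 I J : ideal_mul I J 0.
Proof. by exists 0%N, (fun=> 0), (fun=> 0); split; [case|case|rewrite big_ord0]. Qed.

Lemma ideal_mulD I J x y : ideal_mul I J x -> ideal_mul I J y -> ideal_mul I J (x + y).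
Proof.
move=> [n [a [b [Ia Jb ->]]]] [m [c [e [Ic Je ->]]]].
pose glue (u : 'I_n -> algC) (v : 'I_m -> algC) i :=
  match split i with inl j => u j | inr j => v j end.
exists (n + m)%N, (glue a c), (glue b e).
split; try by move=> i; rewrite /glue; case: (split i).
rewrite big_split_ord /=; congr (_ + _); apply: eq_bigr => i _; rewrite /glue.
  by rewrite -[lshift m i]/(unsplit (inl i)) unsplitK.
by rewrite -[rshift n i]/(unsplit (inr i)) unsplitK.
Qed.

Lemma ideal_mul_sub I J (X : set algC) :
  X 0 -> (forall x y, X x -> X y -> X (x + y)) ->
  (forall a b, I a -> J b -> X (a * b)) -> ideal_mul I J `<=` X.
Proof. by move=> X0 XD XM x; apply: ideal_mul_ind. Qed.

Lemma ideal_mulC I J : ideal_mul I J = ideal_mul J I.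
Proof.
suff sub X Y : ideal_mul X Y `<=` ideal_mul Y X by apply/seteqP; split; apply: sub.
apply: ideal_mul_sub; [exact: ideal_mul0 | exact: ideal_mulD |].
by move=> a b Xa Yb; rewrite mulrC; apply: ideal_mul_mem.
Qed.

Lemma ideal_mulA I J M : ideal_mul I (ideal_mul J M) = ideal_mul (ideal_mul I J) M.
Proof.
have sub X Y Z : ideal_mul X (ideal_mul Y Z) `<=` ideal_mul (ideal_mul X Y) Z.
  apply: ideal_mul_sub; [exact: ideal_mul0 | exact: ideal_mulD |].
  move=> a b Xa YZb; elim/ideal_mul_ind: YZb.
  - by rewrite mulr0; apply: ideal_mul0.
  - by move=> x y; rewrite mulrDr; apply: ideal_mulD.
  - move=> y z Yy Zz; rewrite mulrA; apply: ideal_mul_mem => //.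
    exact: ideal_mul_mem.
apply/seteqP; split; first exact: sub.
by rewrite ideal_mulC (ideal_mulC I J) ideal_mulC; rewrite ideal_mulC (ideal_mulC I)
  (ideal_mulC J M); apply: sub.
Qed.

Lemma ideal_mulACA I J M N :
  ideal_mul (ideal_mul I J) (ideal_mul M N) = ideal_mul (ideal_mul I M) (ideal_mul J N).
Proof. by rewrite -!ideal_mulA (ideal_mulA J) (ideal_mulC J) -(ideal_mulA M). Qed.

Lemma scale_setM a b I : scale_set a (scale_set b I) = scale_set (a * b) I.
Proof.
apply/seteqP; split=> x.
  by move=> [_ [y Iy <-] <-]; exists y; rewrite // mulrA.
by move=> [y Iy <-]; exists (b * y); [exists y | rewrite mulrA].
Qed.

Lemma scale_set1 I : scale_set 1 I = I.
Proof.
apply/seteqP; split=> x; first by move=> [y Iy <-]; rewrite mul1r.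
by move=> Ix; exists x; rewrite ?mul1r.
Qed.

Lemma ideal_mul_scalel a I J : ideal_mul (scale_set a I) J = scale_set a (ideal_mul I J).
Proof.
apply/seteqP; split.
  apply: ideal_mul_sub; first by exists 0; [apply: ideal_mul0 | rewrite mulr0].
    move=> _ _ [x IJx <-] [y IJy <-]; exists (x + y); last by rewrite mulrDr.
    exact: ideal_mulD.
  move=> _ y [x Ix <-] Jy; exists (x * y); last by rewrite mulrA.
  exact: ideal_mul_mem.
move=> _ [x IJx <-]; elim/ideal_mul_ind: IJx.
- by rewrite mulr0; apply: ideal_mul0.
- by move=> y z; rewrite mulrDr; apply: ideal_mulD.
- by move=> y z Iy Jz; rewrite mulrA; apply: ideal_mul_mem => //; exists y.
Qed.

Lemma ideal_mul_scaler a I J : ideal_mul I (scale_set a J) = scale_set a (ideal_mul I J).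
Proof. by rewrite ideal_mulC ideal_mul_scalel ideal_mulC. Qed.

Lemma scale_set_eq a I J : a != 0 -> scale_set a I = scale_set a J -> I = J.
Proof.
move=> a0 /(congr1 (scale_set a^-1)).
by rewrite !scale_setM mulVf // !scale_set1.
Qed.
End IdealMul.

Section Modules.
Variables (K : set algC) (hK : subfield K).
Implicit Types I J : set algC.

Lemma OO_submodule : submodule K (OO K).
Proof. by split; [apply: OO0 | apply: OOD | apply: OOM]. Qed.

Lemma submodule_scale a I : submodule K I -> submodule K (scale_set a I).
Proof.
case=> I0 ID IM; split; first by exists 0; rewrite ?mulr0.
  by move=> _ _ [x Ix <-] [y Iy <-]; exists (x + y); rewrite ?mulrDr //; apply: ID.
by move=> b _ Ob [x Ix <-]; exists (b * x); [apply: IM | rewrite mulrCA].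
Qed.

Lemma submodule_mul I J : submodule K I -> submodule K (ideal_mul I J).
Proof.
case=> I0 ID IM; split; [exact: ideal_mul0 | exact: ideal_mulD |].
move=> a x Oa; elim/ideal_mul_ind.
- by rewrite mulr0; apply: ideal_mul0.
- by move=> y z; rewrite mulrDr; apply: ideal_mulD.
- by move=> y z Iy Jz; rewrite mulrA; apply: ideal_mul_mem => //; apply: IM.
Qed.

Lemma ideal_mulO I : submodule K I -> ideal_mul I (OO K) = I.
Proof.
case=> I0 ID IM; apply/seteqP; split.
  by apply: ideal_mul_sub => // a b Ia Ob; rewrite mulrC; apply: IM.
by move=> x Ix; rewrite -(mulr1 x); apply: ideal_mul_mem => //; apply: OO1.
Qed.

Lemma ideal_mulOl I : submodule K I -> ideal_mul (OO K) I = I.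
Proof. by move=> hI; rewrite ideal_mulC ideal_mulO. Qed.

Lemma principal_mul a b :
  ideal_mul (principal_ideal K a) (principal_ideal K b) = principal_ideal K (a * b).
Proof.
rewrite /principal_ideal ideal_mul_scalel ideal_mul_scaler scale_setM ideal_mulO //.
exact: OO_submodule.
Qed.

Lemma principal_unit a u : integral_unit K u -> principal_ideal K (a * u) = principal_ideal K a.
Proof.
move=> [u0 Ou OuV]; apply/seteqP; split=> _ [x Ox <-].
  by exists (u * x); [apply: OOM | rewrite mulrA].
by exists (u^-1 * x); [apply: OOM | rewrite mulrA mulfK].
Qed.

(* O_K is integrally closed, so x^2 in eta^2 O_K forces x in eta O_K. *)
Lemma sqr_principal J b eta u : J `<=` K -> submodule K J ->
  ideal_mul J J = principal_ideal K b -> K eta -> eta != 0 ->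
  integral_unit K u -> b = eta ^+ 2 * u -> J = principal_ideal K eta.
Proof.
move=> JK hJ JJ Keta eta0 hu Db; move: JJ; rewrite Db principal_unit // => JJ.
have sub : J `<=` principal_ideal K eta.
  move=> x Jx; exists (x / eta); last by rewrite mulrC divfK.
  have [y Oy Dy] : principal_ideal K (eta ^+ 2) (x * x) by rewrite -JJ; apply: ideal_mul_mem.
  apply: OO_sqr => //; first by have Kx := JK x Jx; fld.
  by rewrite exprMn exprVn [x ^+ 2]expr2 -Dy mulrAC mulfV ?mul1r // expf_neq0.
apply/seteqP; split=> // _ [y Oy <-].
have [J0 JD JM] := hJ; rewrite mulrC; apply: (JM) => //.
(* [eta ^+ 2] lies in J J, and J J is contained in eta J because J is contained in eta O_K;
   cancelling [eta] puts [eta] in J. *)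
have : ideal_mul J J (eta ^+ 2) by rewrite JJ; exists 1; rewrite ?mulr1 //; apply: OO1.
suff sub2 : ideal_mul J J `<=` scale_set eta J.
  by case/sub2 => z Jz /eqP; rewrite expr2 (inj_eq (mulfI eta0)) => /eqP <-.
have [S0 SD SM] := submodule_scale eta hJ.
apply: ideal_mul_sub => // a c Ja /sub [z Oz <-].
by exists (z * a); [apply: JM | ring].
Qed.
End Modules.

(** Such an ideal has the explicit inverse b^-1 I. Every class in the kernel is represented by one,
    so inverses and equalities of classes are only ever computed for these ideals. *)
Definition sqr_ideal (K : set algC) (b : algC) (I : set algC) : Prop :=
  [/\ fractional_ideal K I, K b, b != 0 & ideal_mul I I = principal_ideal K b].

(** * Classes of ideals with principal square *)

Section Classes.
Variables (k : set algC) (hk : subfield k).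
Implicit Types I J : set algC.

Lemma fractional_mul I J : fractional_ideal k I -> fractional_ideal k J ->
  fractional_ideal k (ideal_mul I J).
Proof.
move=> [Ik hI [x Ix x0] [d [Od d0 dI]]] [Jk hJ [y Jy y0] [e [Oe e0 eJ]]]; split.
- apply: ideal_mul_sub; first by fld.
    by move=> *; fld.
  by move=> a b /Ik ka /Jk kb; fld.
- exact: submodule_mul.
- by exists (x * y); [apply: ideal_mul_mem | rewrite mulf_neq0].
exists (d * e); split; [exact: OOM | exact: mulf_neq0 |].
move=> _ [z IJz <-]; elim/ideal_mul_ind: IJz.
- by rewrite mulr0; apply: OO0.
- by move=> a b; rewrite mulrDr; apply: OOD.
- move=> a b Ia Jb; rewrite mulrACA; apply: OOM => //.
    by apply: dI; exists a.
  by apply: eJ; exists b.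
Qed.

Lemma fractional_OO : fractional_ideal k (OO k).
Proof.
split; [by move=> x [] | exact: OO_submodule | by exists 1; [apply: OO1 | apply: oner_neq0] |].
by exists 1; split; rewrite ?oner_neq0 ?scale_set1 //; apply: OO1.
Qed.

Lemma sqr_ideal_mul b c I J : sqr_ideal k b I -> sqr_ideal k c J ->
  sqr_ideal k (b * c) (ideal_mul I J).
Proof.
move=> [fI kb b0 II] [fJ kc c0 JJ]; split; [exact: fractional_mul | by fld | exact: mulf_neq0 |].
by rewrite ideal_mulACA II JJ principal_mul.
Qed.

Lemma sqr_ideal_OO : sqr_ideal k 1 (OO k).
Proof.
split; [exact: fractional_OO | by fld | exact: oner_neq0 |].
by rewrite ideal_mulO ?/principal_ideal ?scale_set1 //; apply: OO_submodule.
Qed.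

Lemma ideal_class_scale a I : k a -> a != 0 -> ideal_class k (scale_set a I) = ideal_class k I.
Proof.
move=> ka a0; apply/seteqP; split=> _ [b [kb b0] <-].
  by exists (b * a); rewrite ?scale_setM //=; split; [fld | apply: mulf_neq0].
exists (b / a); first by split; [fld | rewrite mulf_neq0 ?invr_eq0].
by rewrite scale_setM divfK.
Qed.

Lemma ideal_class_id I : ideal_class k I I.
Proof. by exists 1; [split; [fld | apply: oner_neq0] | rewrite scale_set1]. Qed.

Lemma Cl_mul_class I J :
  Cl_mul (ideal_class k I) (ideal_class k J) = ideal_class k (ideal_mul I J).
Proof.
apply/seteqP; split=> X.
  move=> [_ [a [ka a0] <-] [_ [b [kb b0] <-] <-]].
  exists (a * b); first by split; [fld | apply: mulf_neq0].
  by rewrite ideal_mul_scalel ideal_mul_scaler scale_setM.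
move=> [a [ka a0] <-]; exists (scale_set a I); first by exists a.
by exists J; [apply: ideal_class_id | rewrite ideal_mul_scalel].
Qed.

(** If x I is integral then b x lies in x I I, hence in I, because b lies in I I. *)
Lemma sqr_ideal_inv b I : sqr_ideal k b I -> ideal_inv k I = scale_set b^-1 I.
Proof.
move=> [[Ik hI _ _] kb b0 II]; apply/seteqP; split=> x.
  move=> [kx xI]; exists (b * x); last by rewrite mulKf.
  have : ideal_mul I I b by rewrite II; exists 1; rewrite ?mulr1 //; apply: OO1.
  have [I0 ID IM] := hI.
  elim/ideal_mul_ind; first by rewrite mul0r.
    by move=> y z; rewrite mulrDl; apply: ID.
  move=> y z Iy Iz; rewrite (_ : y * z * x = x * y * z); last by ring.
  by apply: IM => //; apply: xI.
move=> [y Iy <-]; have ky := Ik y Iy; split; first by fld.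
move=> z Iz; have [w Ow Dw] : principal_ideal k b (y * z) by rewrite -II; apply: ideal_mul_mem.
by rewrite -mulrA -Dw mulKf.
Qed.

Lemma Cl_inv_class b I : sqr_ideal k b I -> Cl_inv k (ideal_class k I) = ideal_class k I.
Proof.
move=> hI; have [[Ik hIm _ _] kb b0 _] := hI.
have inv_scale a : k a -> a != 0 -> ideal_inv k (scale_set a I) = scale_set (a^-1 / b) I.
  move=> ka a0; rewrite -scale_setM -(sqr_ideal_inv hI); apply/seteqP; split=> x.
    move=> [kx xI]; exists (a * x); last by rewrite mulKf.
    split; first by fld.
    by move=> y Iy; rewrite (mulrC a) -mulrA; apply: xI; exists y.
  move=> [y [ky yI] <-]; split; first by fld.
  move=> _ [z Iz <-]; rewrite mulrACA mulVf // mul1r; exact: yI.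
apply/seteqP; split=> X.
  move=> [_ [a [ka a0] <-] <-]; rewrite inv_scale //.
  by exists (a^-1 / b) => //; split; [fld | rewrite mulf_neq0 ?invr_eq0].
move=> [a [ka a0] <-]; exists (scale_set (a^-1 / b) I).
  by exists (a^-1 / b) => //; split; [fld | rewrite mulf_neq0 ?invr_eq0].
rewrite inv_scale; [|by fld|by rewrite mulf_neq0 ?invr_eq0].
by congr (scale_set _ I); field; rewrite b0 a0.
Qed.

(** The square of I J is generated by [b * c], which is [(c * delta) ^+ 2] times a unit, so I J is
    generated by [c * delta]. Multiplying by J gives c I = c delta J. *)
Lemma sqr_ideal_class b c delta u I J : sqr_ideal k b I -> sqr_ideal k c J ->
  k delta -> integral_unit k u -> b = c * delta ^+ 2 * u ->
  ideal_class k I = ideal_class k J.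
Proof.
move=> hI hJ kd hu Db; have hIJ := sqr_ideal_mul hI hJ.
have [fI kb b0 II] := hI; have [fJ kc c0 JJ] := hJ; have [fIJ _ _ IJIJ] := hIJ.
have d0 : delta != 0 by apply: contraNneq b0 => d0; rewrite Db d0 expr0n mulr0 mul0r.
have PIJ : ideal_mul I J = principal_ideal k (c * delta).
  case: fIJ => IJk IJm _ _; apply: (sqr_principal hk IJk IJm IJIJ _ _ hu).
  - by fld.
  - exact: mulf_neq0.
  - by rewrite Db; ring.
have [_ hIm _ _] := fI; have [_ hJm _ _] := fJ.
have : scale_set c I = scale_set (c * delta) J.
  rewrite -[X in scale_set c X](ideal_mulO hk hIm) -ideal_mul_scaler.
  rewrite -/(principal_ideal k c) -JJ ideal_mulA PIJ /principal_ideal ideal_mul_scalel.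
  by rewrite ideal_mulOl.
rewrite -scale_setM => /(scale_set_eq c0) ->.
by rewrite ideal_class_scale.
Qed.

Lemma Cl_gen_sub (S G : set (set (set algC))) : Cl_subgroup k G -> S `<=` G -> Cl_gen k S `<=` G.
Proof. by move=> hG SG c; apply. Qed.

End Classes.

(** * Capitulation in a quadratic extension with automorphism sigma *)

Section Capitulation.
Variables (k L : set algC) (hk : subfield k) (hL : subfield L) (kL : k `<=` L).
Variable sigma : {rmorphism algC -> algC}.
Hypothesis sigma_k : forall x, k x -> sigma x = x.
Hypothesis sigma_L : forall x, L x -> L (sigma x).
Hypothesis sigma_fix : forall x, L x -> sigma x = x -> k x.
Hypothesis sigma_invol : forall x, L x -> sigma (sigma x) = x.
Implicit Types I J : set algC.

Lemma norm_k x : L x -> k (x * sigma x).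
Proof.
by move=> Lx; have Lsx := sigma_L Lx; apply: sigma_fix; [fld | rewrite rmorphM /= sigma_invol // mulrC].
Qed.

Lemma trace_k x : L x -> k (x + sigma x).
Proof.
by move=> Lx; have Lsx := sigma_L Lx; apply: sigma_fix; [fld | rewrite rmorphD /= sigma_invol // addrC].
Qed.

Lemma OO_sigma x : OO L x -> OO L (sigma x).
Proof. by case=> Lx Ax; split; [apply: sigma_L | rewrite Aint_aut]. Qed.

Lemma OO_norm x : OO L x -> OO k (x * sigma x).
Proof.
move=> Ox; have Osx := OO_sigma Ox; have [Lx _] := Ox.
by split; [apply: norm_k | have [] := OOM hL Ox Osx].
Qed.

Lemma OO_trace x : OO L x -> OO k (x + sigma x).
Proof.
move=> Ox; have Osx := OO_sigma Ox; have [Lx _] := Ox.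
by split; [apply: trace_k | have [] := OOD hL Ox Osx].
Qed.

Lemma ideal_ext_scale a I : ideal_ext L (scale_set a I) = scale_set a (ideal_ext L I).
Proof. exact: ideal_mul_scalel. Qed.

Lemma ideal_ext_submodule I : submodule L (ideal_ext L I).
Proof. by rewrite /ideal_ext ideal_mulC; apply: submodule_mul; apply: OO_submodule. Qed.

Lemma Cl_ext_class I : Cl_ext L (ideal_class k I) = ideal_class L (ideal_ext L I).
Proof.
apply/seteqP; split=> X.
  by move=> [_ [a [ka a0] <-]]; rewrite ideal_ext_scale ideal_class_scale //; apply: kL.
by move=> hX; exists I => //; apply: ideal_class_id.
Qed.

Lemma ideal_class_one I : submodule L I -> ideal_class L I = Cl_one L <->
  exists a, [/\ L a, a != 0 & I = principal_ideal L a].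
Proof.
move=> hI; split=> [h|[a [La a0 ->]]]; last exact: ideal_class_scale.
have : Cl_one L I by rewrite -h; apply: ideal_class_id.
by case=> a [La a0] <-; exists a.
Qed.

(* If alpha is the sum of the x_i s_i with x_i in I and s_i in O_L, then
   alpha sigma(alpha) is a combination of the products x_i x_j whose
   coefficients are norms or traces. *)
Lemma capitulation_sqr I alpha : fractional_ideal k I -> L alpha -> alpha != 0 ->
  ideal_ext L I = principal_ideal L alpha -> sqr_ideal k (alpha * sigma alpha) I.
Proof.
move=> fI La a0 IL; have [Ik hI _ _] := fI; have [I0 ID IM] := hI.
have sa0 : sigma alpha != 0 by rewrite fmorph_eq0.
split=> //; [exact: norm_k | exact: mulf_neq0 |]; apply/seteqP; split.
  have [P0 PD _] := submodule_scale (alpha * sigma alpha) (OO_submodule hk).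
  apply: ideal_mul_sub => // x y Ix Iy.
  have mem z : I z -> exists2 s, OO L s & alpha * s = z.
    move=> Iz; have : ideal_ext L I z by rewrite -(mulr1 z); apply: ideal_mul_mem => //; apply: OO1.
    by rewrite IL => -[s Os <-]; exists s.
  have [s Os Ds] := mem x Ix; have [t Ot Dt] := mem y Iy.
  have kx := Ik x Ix; have ky := Ik y Iy; have kn := norm_k La.
  have Dst : x * y / (alpha * sigma alpha) = s * sigma t.
    have -> : y = sigma alpha * sigma t by rewrite -rmorphM Dt sigma_k.
    by rewrite -Ds; field; rewrite a0 sa0.
  exists (x * y / (alpha * sigma alpha)); last by field; rewrite a0 sa0.
  split; first by fld.
  by rewrite Dst; have [_ ->] := OOM hL Os (OO_sigma Ot).
have [M0 MD MM] := submodule_mul I hI.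
suff h : ideal_mul I I (alpha * sigma alpha).
  by move=> _ [s Os <-]; rewrite mulrC; apply: MM.
have : ideal_ext L I alpha by rewrite IL; exists 1; rewrite ?mulr1 //; apply: OO1.
(* the polarised claim, which is additive in x *)
have aux (x : algC) : ideal_ext L I x -> forall y, ideal_ext L I y ->
    ideal_mul I I (x * sigma y + y * sigma x).
  have sL z : ideal_ext L I z -> L z.
    rewrite IL => -[s [Ls _] <-]; fld.
  elim/ideal_mul_ind.
  - by move=> y _; rewrite rmorph0 mul0r mulr0 addr0.
  - move=> a b ha hb y hy.
    have -> : (a + b) * sigma y + y * sigma (a + b) =
      (a * sigma y + y * sigma a) + (b * sigma y + y * sigma b) by rewrite rmorphD; ring.
    by apply: MD; [apply: ha | apply: hb].
  - move=> a s Ia Os y; elim/ideal_mul_ind.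
    + by rewrite rmorph0 mulr0 mul0r addr0.
    + move=> b c hb hc.
      have -> : a * s * sigma (b + c) + (b + c) * sigma (a * s) =
        (a * s * sigma b + b * sigma (a * s)) + (a * s * sigma c + c * sigma (a * s)).
        by rewrite rmorphD; ring.
      exact: MD.
    + move=> b t Ib Ot.
      have -> : a * s * sigma (b * t) + b * t * sigma (a * s) =
        (s * sigma t + sigma (s * sigma t)) * (a * b).
        rewrite !rmorphM (sigma_k (Ik _ Ia)) (sigma_k (Ik _ Ib)) /= sigma_invol; first by ring.
        by have [] := Ot.
      apply: MM; first by apply: OO_trace; apply: OOM => //; apply: OO_sigma.
      exact: ideal_mul_mem.
suff aux2 x : ideal_ext L I x -> ideal_ext L I x /\ ideal_mul I I (x * sigma x).
  by move=> /aux2 [].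
elim/ideal_mul_ind.
- by split; [apply: ideal_mul0 | rewrite mul0r].
- move=> a b [ha ha'] [hb hb']; split; first exact: ideal_mulD.
  have -> : (a + b) * sigma (a + b) = a * sigma a + b * sigma b + (a * sigma b + b * sigma a).
    by rewrite rmorphD; ring.
  by apply: (MD); [apply: MD | apply: aux].
- move=> a s Ia Os; split; first exact: ideal_mul_mem.
  have -> : a * s * sigma (a * s) = (s * sigma s) * (a * a).
    by rewrite rmorphM (sigma_k (Ik _ Ia)) /=; ring.
  by apply: MM; [apply: OO_norm | apply: ideal_mul_mem].
Qed.

(** The extended ideal is stable under [sigma], so it contains [sigma alpha]; thus
    [sigma alpha / alpha] is integral, and so is its conjugate, which is also its inverse. *)
Lemma capitulation_unit I alpha : fractional_ideal k I -> L alpha -> alpha != 0 ->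
  ideal_ext L I = principal_ideal L alpha ->
  integral_unit L (alpha / sigma alpha).
Proof.
move=> fI La a0 IL; have Lsa := sigma_L La; have [Ik _ _ _] := fI.
have sa0 : sigma alpha != 0 by rewrite fmorph_eq0.
have sI x : ideal_ext L I x -> ideal_ext L I (sigma x).
  elim/ideal_mul_ind.
  - by rewrite rmorph0; apply: ideal_mul0.
  - by move=> y z; rewrite rmorphD; apply: ideal_mulD.
  - move=> y z Iy Oz; rewrite rmorphM (sigma_k (Ik _ Iy)).
    by apply: ideal_mul_mem => //; apply: OO_sigma.
have : ideal_ext L I (sigma alpha).
  by apply: sI; rewrite IL; exists 1; rewrite ?mulr1 //; apply: OO1.
rewrite IL => -[s Os Ds].
have Ds' : alpha / sigma alpha = sigma s.
  by have {1}-> : alpha = sigma alpha * sigma s; [rewrite -rmorphM Ds sigma_invol | rewrite mulrC mulKf].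
split; first by rewrite mulf_neq0 ?invr_eq0.
  by rewrite Ds'; apply: OO_sigma.
by rewrite invf_div -Ds mulrC mulKf.
Qed.

Lemma capitulation_kernel_sqr c : capitulation_kernel k L c ->
  exists I b eta, [/\ c = ideal_class k I, sqr_ideal k b I, L eta, eta != 0 &
    integral_unit L (eta ^+ 2 / b) /\ (eta ^+ 2 / b) * sigma (eta ^+ 2 / b) = 1].
Proof.
move=> [[I fI <-]]; rewrite Cl_ext_class => /(ideal_class_one (ideal_ext_submodule I)).
move=> [a [La a0 IL]]; exists I, (a * sigma a), a.
have sa0 : sigma a != 0 by rewrite fmorph_eq0.
have -> : a ^+ 2 / (a * sigma a) = a / sigma a by field; rewrite sa0 a0.
split=> //; first exact: capitulation_sqr.
split; first exact: capitulation_unit IL.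
by rewrite fmorph_div /= sigma_invol //; field; rewrite sa0 a0.
Qed.

Lemma sqr_capitulation_kernel I b eta : sqr_ideal k b I -> L eta ->
  integral_unit L (eta ^+ 2 / b) -> capitulation_kernel k L (ideal_class k I).
Proof.
move=> [fI kb b0 II] Le hu; split; first by exists I.
have e0 : eta != 0.
  by case: hu => + _ _; apply: contraNneq => ->; rewrite expr0n mul0r.
rewrite Cl_ext_class; apply/(ideal_class_one (ideal_ext_submodule I)).
exists eta; split=> //; have [Ik hI _ _] := fI.
apply: (sqr_principal hL _ (ideal_ext_submodule I) _ Le e0 (iuV hu)).
- apply: ideal_mul_sub; first by fld.
    by move=> *; fld.
  by move=> x y /Ik/kL Lx [Ly _]; fld.
- rewrite /ideal_ext ideal_mulACA II (ideal_mulO hL (OO_submodule hL)) ideal_mul_scalel.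
  congr scale_set; apply/seteqP; split.
    by apply: ideal_mul_sub => [||x y Ox Oy]; [apply: OO0 | apply: OOD | apply: OOM => //; apply: OOS kL _ Ox].
  by move=> x Ox; rewrite -(mul1r x); apply: ideal_mul_mem => //; apply: OO1.
- by rewrite invf_div mulrC divfK // expf_neq0.
Qed.

Lemma capitulation_kernel_subgroup : Cl_subgroup k (capitulation_kernel k L).
Proof.
split.
- by move=> c [].
- apply: (@sqr_capitulation_kernel _ 1 1); [exact: sqr_ideal_OO | by fld |].
  by rewrite expr1n divr1; apply: iu1.
- move=> c d /capitulation_kernel_sqr[I [b [e [-> hI Le e0 [hu _]]]]].
  move=> /capitulation_kernel_sqr[J [b' [e' [-> hJ Le' e0' [hu' _]]]]].
  rewrite Cl_mul_class //; apply: (sqr_capitulation_kernel (sqr_ideal_mul hk hI hJ) (eta := e * e')).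
    by fld.
  have -> : (e * e') ^+ 2 / (b * b') = e ^+ 2 / b * (e' ^+ 2 / b').
    by case: hI hJ => _ _ b0 _ [_ _ b0' _]; field; rewrite b0 b0'.
  exact: iuM.
(* Every class in the kernel is its own inverse, because it contains an ideal with principal
   square. *)
- move=> c hc; have := hc => /capitulation_kernel_sqr[I [b [e [Dc hI _ _ _]]]].
  by rewrite Dc (Cl_inv_class hk hI) -Dc.
Qed.
End Capitulation.

(** For x in H the trace and the norm to F lie in H and in F, hence in pi O_F, so x^2 = (trace) x -
    (norm) is divisible by pi. Products x y follow by integral closure, since (x y / pi)^2 is
    integral. Conversely pi = a pi^2 + b s^2, with both pi and s in H. *)
Lemma sqr_ideal_ramified (F : set algC) (s m pi a b : algC) (H : set algC)
    (tau : {rmorphism algC -> algC}) :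
  let k := quad F s in
  subfield F -> (forall x, F x -> tau x = x) -> tau s = - s ->
  OO F pi -> OO F m -> OO F a -> OO F b -> pi != 0 ->
  s ^+ 2 = pi * m -> 1 = a * pi + b * m ->
  prime_ideal_above F k pi H -> sqr_ideal k pi H.
Proof.
move=> k hF tauF taus Opi Om Oa Ob pi0 s2 bez [[HO hH nH1 Hprime] Hpi].
have Fs2 : F (s ^+ 2) by rewrite s2; case: Opi Om => ? _ [? _]; fld.
have hk : subfield k by apply: quad_subfield.
have Fk : F `<=` k by apply: quad_base.
have ks : k s by apply: quad_gen.
have OFk := OOS Fk.
have Os : OO k s.
  by apply: OO_sqr => //; rewrite s2; apply: OOM => //; apply: OFk.
have [H0 HD HM] := hH.
have Hpi' : H pi.
  suff : (H `&` OO F) pi by case.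
  by rewrite Hpi; exists 1; rewrite ?mulr1 //; apply: OO1.
have HF x : H x -> OO F x -> exists2 y, OO F y & pi * y = x.
  move=> Hx Ox; have : (H `&` OO F) x by [].
  by rewrite Hpi => -[y Oy <-]; exists y.
have nHm : ~ H m.
  move=> Hm; apply: nH1; rewrite bez; apply: HD; apply: HM => //; exact: OFk.
have Hs : H s.
  have : H (s * s) by rewrite -expr2 s2 mulrC; apply: HM => //; apply: OFk.
  by case/Hprime.
have HN x : H x -> H (- x).
  by move=> Hx; rewrite -mulN1r; apply: HM => //; apply: OON => //; apply: OO1.
have sqrH x : H x -> exists2 y, OO k y & pi * y = x * x.
  move=> Hx; have Ox := HO x Hx; have [kx Ax] := Ox.
  have Ox' : OO k (tau x).
    split; last by rewrite Aint_aut.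
    case: kx => c [e [Fc Fe ->]]; have kc := Fk _ Fc; have ke := Fk _ Fe.
    by rewrite rmorphD rmorphM (tauF c) ?(tauF e) // taus; fld.
  have FT : F (x + tau x) /\ (F (x * tau x) /\ F ((x - tau x) * s)).
    case: kx => c [e [Fc Fe ->]].
    rewrite rmorphD rmorphM (tauF c) ?(tauF e) // taus.
    have -> : c + e * s + (c + e * - s) = 2 * c by ring.
    have -> : (c + e * s) * (c + e * - s) = c ^+ 2 - e ^+ 2 * s ^+ 2 by ring.
    have -> : (c + e * s - (c + e * - s)) * s = 2 * e * s ^+ 2 by ring.
    by split; [|split]; fld.
  case: FT => FT [FN Fz].
  (* This shows that [tau x] is in H. The number [z] lies in F and z^2 = (x - tau x)^2 m pi, so z is
     in H and divisible by pi in O_F. Cancelling one factor pi leaves (x - tau x)^2 m in H, and m is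
     not in H. *)
  set z := (x - tau x) * s in Fz.
  have Oz : OO F z by split=> //; case: (OOM hk (OOB hk Ox Ox') Os).
  have Fm2 : F ((x - tau x) ^+ 2).
    have -> : (x - tau x) ^+ 2 = (x + tau x) ^+ 2 - 4%:R * (x * tau x) by ring.
    by fld.
  have Om2 : OO F ((x - tau x) ^+ 2).
    by split=> //; case: (OOX hk 2 (OOB hk Ox Ox')).
  have Dz2 : z * z = (x - tau x) ^+ 2 * m * pi.
    have -> : z * z = (x - tau x) ^+ 2 * s ^+ 2 by rewrite /z; ring.
    by rewrite s2; ring.
  have Hz : H z.
    have : H (z * z) by rewrite Dz2; apply: HM => //; apply: OFk; apply: OOM.
    by case/(Hprime _ _ (OFk _ Oz) (OFk _ Oz)).
  have [z1 Oz1 Dz1] := HF z Hz Oz.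
  have Hm2 : H ((x - tau x) ^+ 2).
    have : H ((x - tau x) ^+ 2 * m).
      have -> : (x - tau x) ^+ 2 * m = z1 ^+ 2 * pi.
        by apply: (mulIf pi0); rewrite -Dz2 -Dz1; ring.
      by apply: HM => //; apply: OFk; apply: OOX.
    by case/(Hprime _ _ (OFk _ Om2) (OFk _ Om)).
  have Hd : H (x - tau x).
    by move: Hm2; rewrite expr2 => /(Hprime _ _ (OOB hk Ox Ox') (OOB hk Ox Ox')) [].
  have Hx' : H (tau x).
    have -> : tau x = x + - (x - tau x) by ring.
    by apply: HD => //; apply: HN.
  have [t Ot Dt] : exists2 y, OO F y & pi * y = x + tau x.
    by apply: HF; [apply: HD | split=> //; case: (OOD hk Ox Ox')].
  have [n On Dn] : exists2 y, OO F y & pi * y = x * tau x.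
    by apply: HF; [apply: HM | split=> //; case: (OOM hk Ox Ox')].
  exists (t * x - n).
    by apply: OOB => //; [apply: OOM => // |]; apply: OFk.
  by rewrite mulrBr mulrA Dt Dn; ring.
have kpi : k pi by apply: Fk; case: Opi.
split=> //.
  split=> //; [by move=> x /HO [] | by exists pi |].
  exists 1; split; [exact: OO1 | exact: oner_neq0 | by rewrite scale_set1].
apply/seteqP; split.
  have [P0 PD _] := submodule_scale pi (OO_submodule hk).
  apply: ideal_mul_sub => // x y Hx Hy.
  have [u Ou Du] := sqrH x Hx; have [v Ov Dv] := sqrH y Hy.
  exists (x * y / pi); last by rewrite mulrC divfK.
  have [kx _] := HO x Hx; have [ky _] := HO y Hy.
  apply: OO_sqr; first by fld.
  have -> : (x * y / pi) ^+ 2 = u * v.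
    have -> : (x * y / pi) ^+ 2 = (x * x) * (y * y) / pi ^+ 2 by field.
    by rewrite -Du -Dv; field.
  exact: OOM.
have [M0 MD MM] := submodule_mul H hH.
move=> _ [w Ow <-]; rewrite mulrC; apply: (MM) => //.
have -> : pi = a * (pi * pi) + b * (s * s) by rewrite -[s * s]expr2 s2 -{1}[pi]mul1r bez; ring.
by apply: MD; apply: MM; first [exact: OFk | exact: ideal_mul_mem].
Qed.

(** * Square classes of integers and the Pell equation *)

Lemma odd_logn_nonsquare (r n m : nat) : odd (logn r n) -> n <> (m ^ 2)%N.
Proof. by move=> h e; move: h; rewrite e lognX oddM. Qed.

Lemma square_of_even_logn (n : nat) : (0 < n)%N ->
  (forall r, prime r -> ~~ odd (logn r n)) -> exists m, n = (m ^ 2)%N.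
Proof.
elim/ltn_ind: n => n IHn n0 even; have [n1|n1] := leqP n 1.
  by exists 1%N; apply/eqP; rewrite eqn_leq n1.
have pr := pdiv_prime n1; set p := pdiv n in pr.
have lp : (1 < logn p n)%N.
  have : (0 < logn p n)%N by rewrite logn_gt0 mem_primes pr n0 pdiv_dvd.
  by have := even p pr; case: (logn p n) => [|[|]].
have /dvdnP[n' Dn] : (p ^ 2 %| n)%N by rewrite pfactor_dvdn.
have n'0 : (0 < n')%N by move: n0; rewrite Dn muln_gt0 => /andP[].
have p2 : (1 < p)%N := prime_gt1 pr.
have [m Dm] : exists m, n' = (m ^ 2)%N.
  apply: IHn => // [|r pr_r]; first by rewrite Dn -mulnn; nia.
  have := even r pr_r; rewrite Dn lognM ?expn_gt0 ?(ltnW p2) // lognX oddD.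
  by rewrite oddM addbF.
by exists (m * p)%N; rewrite Dn Dm expnMn.
Qed.

Lemma square_class (ps : seq nat) (n : nat) : uniq ps -> all prime ps -> (0 < n)%N ->
  (forall r, prime r -> r \notin ps -> ~~ odd (logn r n)) ->
  exists m, (\prod_(r <- ps | odd (logn r n)) r * n = m ^ 2)%N.
Proof.
move=> Ups pr_ps n0 even.
have P0 (s : seq nat) : all prime s -> (0 < \prod_(r <- s | odd (logn r n)) r)%N.
  by move/allP => h; rewrite big_seq_cond prodn_cond_gt0 // => r /andP[/h/prime_gt0].
apply: square_of_even_logn => [|r pr_r]; first by rewrite muln_gt0 P0.
rewrite lognM ?P0 // oddD.
suff -> : logn r (\prod_(i <- ps | odd (logn i n)) i) = (r \in ps) && odd (logn r n) :> nat.
  by case: (boolP (r \in ps)) => [_|/(even _ pr_r)]; case: (odd (logn r n)).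
elim: ps Ups pr_ps {even} => [|p ps IHp] /=; first by rewrite big_nil logn1.
case/andP=> np Ups /andP[pr_p pr_ps]; rewrite big_cons in_cons.
have [e|rp] := eqVneq r p; first subst p; case: ifP => op /=.
- rewrite lognM ?P0 ?prime_gt0 // logn_prime // eqxx IHp //.
  by rewrite (negPf np).
- by rewrite IHp // (negPf np).
- by rewrite lognM ?P0 ?prime_gt0 // logn_prime // (negPf rp) IHp.
- by rewrite IHp.
Qed.

(* Two bases (x1 + y1 sqrt D, x2 + y2 sqrt D) of Z[sqrt D] with the same Gram
   data differ by a unit of norm 1. *)
Lemma pell_of_bases (D x1 y1 x2 y2 X1 Y1 X2 Y2 : int) :
  0 <= x1 -> 0 <= X1 -> 0 < D ->
  x1 * y2 - x2 * y1 = 1 -> X1 * Y2 - X2 * Y1 = 1 ->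
  0 < x1 ^+ 2 - D * y1 ^+ 2 ->
  x1 ^+ 2 - D * y1 ^+ 2 = X1 ^+ 2 - D * Y1 ^+ 2 ->
  x1 * x2 - D * y1 * y2 = X1 * X2 - D * Y1 * Y2 ->
  x2 ^+ 2 - D * y2 ^+ 2 = X2 ^+ 2 - D * Y2 ^+ 2 ->
  x1 + y1 + x2 + y2 <> X1 + Y1 + X2 + Y2 ->
  exists X Y : int, Y != 0 /\ X ^+ 2 - D * Y ^+ 2 = 1.
Proof.
move=> x10 X10 D0 det Det a0 Ea Eb Ec ne.
(* By the determinant condition 1 = y2 v1 - y1 v2, so the witness is the image of 1 under the linear
   map taking the first basis to the second. Equal Gram data make this map preserve the norm. *)
exists (y2 * X1 - y1 * X2), (y2 * Y1 - y1 * Y2); split; last first.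
  transitivity (y2 ^+ 2 * (X1 ^+ 2 - D * Y1 ^+ 2) + y1 ^+ 2 * (X2 ^+ 2 - D * Y2 ^+ 2)
    - 2 * y1 * y2 * (X1 * X2 - D * Y1 * Y2)); first by ring.
  rewrite -Ea -Eb -Ec; transitivity ((x1 * y2 - x2 * y1) ^+ 2); first by ring.
  by rewrite det expr1n.
(* If Y = 0 the first vectors of the two bases are proportional; having the same positive norm and
   nonnegative first coordinates, they coincide. The second vector is determined by the first and
   the Gram data ([e1], [e2]). *)
apply/eqP => Y0; apply: ne.
set a := x1 ^+ 2 - _ in a0 Ea; set b := x1 * x2 - _ in Eb.
have an0 : a != 0 by rewrite gt_eqF.
have e1 : a * y2 = b * y1 + x1.
  by rewrite -{1}[x1]mulr1 -det /a /b; ring.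
have e2 : a * x2 = b * x1 + D * y1.
  by rewrite -{1}[y1]mulr1 -det /a /b; ring.
have E1 : a * Y2 = b * Y1 + X1.
  by rewrite -{1}[X1]mulr1 -Det Ea Eb; ring.
have E2 : a * X2 = b * X1 + D * Y1.
  by rewrite -{1}[Y1]mulr1 -Det Ea Eb; ring.
have c1 : x1 * Y1 = X1 * y1.
  apply/eqP; rewrite -subr_eq0; apply/eqP.
  transitivity (a * (y2 * Y1 - y1 * Y2)); last by rewrite Y0 mulr0.
  transitivity ((a * y2 - b * y1) * Y1 - (a * Y2 - b * Y1) * y1); last by ring.
  by rewrite e1 E1; ring.
have c2 : x1 ^+ 2 = X1 ^+ 2.
  apply: (mulIf an0); rewrite {1}Ea /a !mulrBr.
  have -> : x1 ^+ 2 * (D * Y1 ^+ 2) = D * (x1 * Y1) ^+ 2 by ring.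
  by rewrite c1; ring.
have c3 : x1 = X1 by apply/eqP; rewrite -(eqrXn2 (n := 2)) // c2.
have x1n0 : x1 != 0.
  apply: contraTneq a0 => x0; rewrite /a x0 expr0n /= sub0r oppr_gt0 -leNgt.
  by rewrite mulr_ge0 ?sqr_ge0 // ltW.
have c4 : y1 = Y1 by apply: (mulfI x1n0); rewrite c1 c3.
have c5 : y2 = Y2 by apply: (mulfI an0); rewrite e1 E1 c3 c4.
have c6 : x2 = X2 by apply: (mulfI an0); rewrite e2 E2 c3 c4.
by rewrite c3 c4 c5 c6.
Qed.

(* Conway's river: a basis of Z[sqrt D] whose first vector has positive norm and
   whose second vector has negative norm is refined by inserting the sum. *)
Section River.
Variables (D : nat) (D0 : (0 < D)%N) (nsq : forall n, D <> (n ^ 2)%N).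

Definition river_norm (v : int * int) : int := v.1 ^+ 2 - D%:Z * v.2 ^+ 2.

Definition river_step (s : (int * int) * (int * int)) :=
  let v := (s.1.1 + s.2.1, s.1.2 + s.2.2) in
  if 0 < river_norm v then (v, s.2) else (s.1, v).

Definition river_ok (s : (int * int) * (int * int)) :=
  [/\ 0 <= s.1.1, 0 <= s.1.2, 0 <= s.2.1, 0 <= s.2.2 &
  [/\ s.1.1 * s.2.2 - s.2.1 * s.1.2 = 1, 0 < river_norm s.1 & river_norm s.2 < 0]].

Definition river_sum (s : (int * int) * (int * int)) := s.1.1 + s.1.2 + s.2.1 + s.2.2.

Lemma river_norm_neq0 x y : 0 < y -> river_norm (x, y) != 0.
Proof.
move=> y0; apply/eqP; rewrite /river_norm /= => /eqP; rewrite subr_eq0 => /eqP h.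
have := congr1 absz h; rewrite abszX abszM abszX /= => {}h.
have y0' : (0 < `|y|)%N by lia.
have x0' : (0 < `|x|)%N by rewrite -(ltn_exp2r _ _ (isT : (0 < 2)%N)) h exp0n // muln_gt0 D0 expn_gt0 y0'.
have [m] : exists m, D = (m ^ 2)%N; last exact: nsq.
apply: square_of_even_logn => // r pr.
have := congr1 (fun n => odd (logn r n)) h.
by rewrite lognM ?expn_gt0 ?y0' // !lognX oddD !oddM addbF => /esym/negbT.
Qed.

(** The strictly growing coordinate sum is what later tells apart two states with the same Gram
    data. *)
Lemma river_step_ok s : river_ok s -> river_ok (river_step s) /\ river_sum s < river_sum (river_step s).
Proof.
case: s => [[x1 y1] [x2 y2]] [/= x10 y10 x20 y20 [det a0 c0]].
have y2p : 0 < y2.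
  rewrite lt0r y20 andbT; apply/eqP => y2e; move: c0; rewrite /river_norm y2e /=; nia.
have x1p : 0 < x1.
  by rewrite lt0r x10 andbT; apply/eqP => x1e; move: a0; rewrite /river_norm x1e /=; nia.
rewrite /river_step /river_sum /=; case: ifP => /= h.
  split; last lia.
  split=> /=; try lia; split => //; rewrite -det; ring.
split; last lia.
split=> /=; try lia; split => //; first by rewrite -det; ring.
have := @river_norm_neq0 (x1 + x2) (y1 + y2); rewrite neq_lt h orbF; apply; lia.
Qed.

Lemma pell_exists : exists X Y : int, Y != 0 /\ X ^+ 2 - D%:Z * Y ^+ 2 = 1.
Proof.
pose s0 : (int * int) * (int * int) := ((1, 0), (0, 1)).
pose st n := iter n river_step s0.
have ok n : river_ok (st n).
  elim: n => [|n IHn] /=; last by have [] := river_step_ok IHn.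
  split=> //=; split=> //; rewrite /river_norm /=; lia.
have incr i j : (i < j)%N -> river_sum (st i) < river_sum (st j).
  elim: j => // j IHj; have [_ lt] := river_step_ok (ok j).
  rewrite ltnS leq_eqVlt => /predU1P[->//|/IHj lt2]; exact: lt_trans lt2 lt.
(* The off-diagonal Gram entry. Since [gb n ^+ 2 - a * c = D] with a > 0 > c, all three entries are
   bounded by D in absolute value. *)
pose gb n : int := (st n).1.1 * (st n).2.1 - D%:Z * (st n).1.2 * (st n).2.2.
have gram n : gb n ^+ 2 - river_norm (st n).1 * river_norm (st n).2 = D%:Z.
  have [_ _ _ _ [det _ _]] := ok n.
  rewrite -[RHS]mulr1 -(expr1n _ 2) -det /gb /river_norm; ring.
have bnd n : [/\ (`|river_norm (st n).1| < D.+1)%N, (`|river_norm (st n).2| < D.+1)%N &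
    (absz (gb n + D%:Z)%R < (2 * D).+1)%N /\ 0 <= gb n + D%:Z].
  have [_ _ _ _ [_ a0 c0]] := ok n; have := gram n.
  move: (gb n) (river_norm (st n).1) (river_norm (st n).2) a0 c0 => b a c a0 c0 h.
  have h1 : 1 <= - (a * c) by nia.
  have h2 : a <= - (a * c) by nia.
  have h3 : - c <= - (a * c) by nia.
  have h4 : 0 <= b ^+ 2 := sqr_ge0 b.
  have h5 : b <= b ^+ 2 by nia.
  have h6 : - b <= b ^+ 2 by nia.
  by split; [lia | lia | lia].
(* Pigeonhole on Gram data. The signs of the two norms are known, so absolute values suffice there;
   the mixed entry is shifted by D to become nonnegative. *)
pose f (i : 'I_(#|{: 'I_D.+1 * 'I_D.+1 * 'I_(2 * D).+1}|).+1) :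
    'I_D.+1 * 'I_D.+1 * 'I_(2 * D).+1 :=
  (inord (absz (river_norm (st i).1)), inord (absz (river_norm (st i).2)), inord (absz (gb i + D%:Z)%R)).
have : ~~ injectiveb f.
  by apply/negP => /injectiveP /leq_card; rewrite card_ord ltnn.
case/injectivePn => i [j ij] fij.
wlog lt : i j ij fij / (i < j)%N.
  move=> W; have [lt|lt|/val_inj e] := ltngtP (val i) (val j).
  - exact: (W i j).
  - by apply: (W j i) => //; rewrite eq_sym.
  - by rewrite e eqxx in ij.
have [ba bc [bb bb']] := bnd i; have [ba' bc' [bb2 bb2']] := bnd j.
case: fij => /(congr1 val) + /(congr1 val) + /(congr1 val); rewrite /= !inordK //.
have [? ? ? ? [deti ai ci]] := ok i; have [? ? ? ? [detj aj cj]] := ok j.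
move=> Ea Ec Eb; have lts := incr _ _ lt.
apply: (@pell_of_bases D%:Z (st i).1.1 (st i).1.2 (st i).2.1 (st i).2.2
  (st j).1.1 (st j).1.2 (st j).2.1 (st j).2.2) => //.
- rewrite -!/(river_norm _); lia.
- rewrite -/(gb i) -/(gb j); lia.
- rewrite -!/(river_norm _); lia.
- move=> e; move: lts; rewrite /river_sum e ltxx //.
Qed.
End River.

(** * Square classes of the two factors in A B = N y^2 *)

Section ProductParity.
Variables (A B N y : nat).
Hypotheses (A0 : (0 < A)%N) (B0 : (0 < B)%N) (N0 : (0 < N)%N) (y0 : (0 < y)%N).
Hypothesis AB : (A * B = N * y ^ 2)%N.

Lemma odd_logn_prod r : odd (logn r A) (+) odd (logn r B) = odd (logn r N).
Proof.
have := congr1 (fun n => odd (logn r n)) AB.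
rewrite (lognM _ A0 B0) (lognM _ N0) ?expn_gt0 ?y0 // lognX oddD => ->.
by rewrite oddD oddM addbF.
Qed.

Lemma even_logn_prod r : ~~ (r %| N)%N -> ~~ ((r %| A) && (r %| B))%N -> prime r ->
  ~~ odd (logn r A) /\ ~~ odd (logn r B).
Proof.
move=> rN rAB pr; have := odd_logn_prod r.
have z n : (0 < n)%N -> ~~ (r %| n)%N -> logn r n = 0%N.
  by move=> n0 rn; apply/eqP; rewrite -leqn0 leqNgt logn_gt0 mem_primes pr n0.
rewrite (z N) //; move: rAB; rewrite negb_and => /orP[/(z A A0)|/(z B B0)] -> /=.
  by move/negbT.
by rewrite addbF => /negbT.
Qed.
End ProductParity.

Lemma prime_dvd_pm1 (r x : nat) : prime r -> (r %| x.+1)%N -> (r %| x.-1)%N -> (0 < x)%N -> r = 2%N.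
Proof.
move=> pr r1 r2 x0; have : (r %| x.+1 - x.-1)%N by apply: dvdn_sub.
have -> : (x.+1 - x.-1 = 2)%N by lia.
by rewrite dvdn_prime2 // => /eqP.
Qed.

Lemma neq_false (n m : nat) : n != m -> ((n == m) = false) * ((m == n) = false).
Proof. by move=> h; rewrite [m == n]eq_sym (negPf h). Qed.

(** Only 2, p, q can have odd valuation in x + 1 or x - 1. The valuations at 2 have the same parity
    in both factors, while exactly one factor has odd valuation at p, and exactly one at q. So if x
    + 1 has class q or p q (up to 2), then x - 1 has class p or 1. *)
Lemma unit_type2 (p q x y : nat) : prime p -> prime q -> p != 2%N -> q != 2%N -> p != q ->
  (1 < x)%N -> (x ^ 2 = p * q * y ^ 2 + 1)%N ->
  exists c d n, [/\ c \in [:: 1; 2]%N, d \in [:: 1%N; p] &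
    (c * d * x.+1 = n ^ 2)%N \/ (c * d * x.-1 = n ^ 2)%N].
Proof.
move=> pr_p pr_q p2 q2 pq x1 E.
have AB : (x.+1 * x.-1 = p * q * y ^ 2)%N by nia.
have A0 : (0 < x.+1)%N by []. have B0 : (0 < x.-1)%N by lia.
have p0 := prime_gt0 pr_p; have q0 := prime_gt0 pr_q.
have N0 : (0 < p * q)%N by rewrite muln_gt0 p0.
have y0 : (0 < y)%N by case: y E {AB} => [|//]; nia.
have Ups : uniq [:: 2; p; q]%N by rewrite /= !inE negb_or ![2%N == _]eq_sym p2 q2 pq.
have Pps : all prime [:: 2; p; q]%N by rewrite /= pr_p pr_q.
have even r : prime r -> r \notin [:: 2; p; q]%N -> ~~ odd (logn r x.+1) /\ ~~ odd (logn r x.-1).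
  move=> pr; rewrite !inE !negb_or => /and3P[r2 rp rq].
  apply: (even_logn_prod A0 B0 N0 y0 AB) => //.
    by rewrite Euclid_dvdM // !dvdn_prime2 // negb_or rp.
  by apply/negP => /andP[h1 h2]; case/eqP: r2; apply: (prime_dvd_pm1 pr h1 h2); lia.
have [m Dm] := square_class Ups Pps A0 (fun r pr nr => (even r pr nr).1).
have [n Dn] := square_class Ups Pps B0 (fun r pr nr => (even r pr nr).2).
have par := odd_logn_prod A0 B0 N0 y0 AB.
have := par 2%N; have := par p; have := par q.
rewrite !lognM // !(logn_prime _ pr_p) !(logn_prime _ pr_q) !eqxx !(neq_false pq) !(neq_false p2) !(neq_false q2) /=.
move: Dm Dn; rewrite !big_cons !big_nil /=.
case: (odd (logn 2 x.+1)); case: (odd (logn p x.+1)); case: (odd (logn q x.+1));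
case: (odd (logn 2 x.-1)); case: (odd (logn p x.-1)); case: (odd (logn q x.-1)) => //= Dm Dn _ _ _.
all: by once ((exists 1%N + exists 2%N); (exists 1%N + exists p); (exists m + exists n);
  split; [done | by rewrite !inE eqxx ?orbT | (left + right); (rewrite -Dm + rewrite -Dn); ring]).
Qed.

(** Passing to the other factor replaces a class by its complement in p1 p2 q, which leaves four of
    the eight divisors. *)
Lemma unit_type3 (p1 p2 q x y : nat) : prime p1 -> prime p2 -> prime q ->
  p1 != 2%N -> p2 != 2%N -> q != 2%N -> p1 != p2 -> p1 != q -> p2 != q ->
  (1 < x)%N -> (x ^ 2 = p1 * p2 * q * y ^ 2 + 1)%N ->
  exists c d n, [/\ c \in [:: 1; 2]%N, d \in [:: 1%N; p1; p2; q] &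
    (c * d * x.+1 = n ^ 2)%N \/ (c * d * x.-1 = n ^ 2)%N].
Proof.
move=> pr_1 pr_2 pr_q p12 p22 q2 p1p2 p1q p2q x1 E.
have AB : (x.+1 * x.-1 = p1 * p2 * q * y ^ 2)%N by nia.
have A0 : (0 < x.+1)%N by []. have B0 : (0 < x.-1)%N by lia.
have p10 := prime_gt0 pr_1; have p20 := prime_gt0 pr_2; have q0 := prime_gt0 pr_q.
have N0 : (0 < p1 * p2 * q)%N by rewrite !muln_gt0 p10 p20.
have y0 : (0 < y)%N by case: y E {AB} => [|//]; nia.
have Ups : uniq [:: 2; p1; p2; q]%N.
  by rewrite /= !inE !negb_or ![2%N == _]eq_sym p12 p22 q2 p1p2 p1q p2q.
have Pps : all prime [:: 2; p1; p2; q]%N by rewrite /= pr_1 pr_2 pr_q.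
have even r : prime r -> r \notin [:: 2; p1; p2; q]%N ->
    ~~ odd (logn r x.+1) /\ ~~ odd (logn r x.-1).
  move=> pr; rewrite !inE !negb_or => /and4P[r2 rp1 rp2 rq].
  apply: (even_logn_prod A0 B0 N0 y0 AB) => //.
    by rewrite !Euclid_dvdM // !dvdn_prime2 // !negb_or rp1 rp2.
  by apply/negP => /andP[h1 h2]; case/eqP: r2; apply: (prime_dvd_pm1 pr h1 h2); lia.
have [m Dm] := square_class Ups Pps A0 (fun r pr nr => (even r pr nr).1).
have [n Dn] := square_class Ups Pps B0 (fun r pr nr => (even r pr nr).2).
have par := odd_logn_prod A0 B0 N0 y0 AB.
have := par 2%N; have := par p1; have := par p2; have := par q.
rewrite !lognM ?muln_gt0 ?p10 ?p20 //.
rewrite !(logn_prime _ pr_1) !(logn_prime _ pr_2) !(logn_prime _ pr_q) !eqxx !(neq_false p1p2) !(neq_false p1q) !(neq_false p2q) !(neq_false p12) !(neq_false p22) !(neq_false q2) /=.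
move: Dm Dn; rewrite !big_cons !big_nil /=.
case: (odd (logn 2 x.+1)); case: (odd (logn p1 x.+1)); case: (odd (logn p2 x.+1));
case: (odd (logn q x.+1)); case: (odd (logn 2 x.-1)); case: (odd (logn p1 x.-1));
case: (odd (logn p2 x.-1)); case: (odd (logn q x.-1)) => //= Dm Dn _ _ _ _.
all: by once ((exists 1%N + exists 2%N); (exists 1%N + exists p1 + exists p2 + exists q);
  (exists m + exists n); split;
  [done | by rewrite !inE eqxx ?orbT | (left + right); (rewrite -Dm + rewrite -Dn); ring]).
Qed.

Lemma unit_type1 (p A B y : nat) : prime p -> p != 2%N -> (0 < A)%N -> (0 < B)%N ->
  (A * B = p * y ^ 2)%N ->
  (forall r, prime r -> r != 2%N -> r != p -> ~~ ((r %| A) && (r %| B))%N) ->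
  exists c l l' m n, [/\ c \in [:: 1; 2]%N, (l, l') \in [:: (1%N, p); (p, 1%N)],
    (c * l * A = m ^ 2)%N & (c * l' * B = n ^ 2)%N].
Proof.
move=> pr_p p2 A0 B0 AB cop; have p0 := prime_gt0 pr_p.
have y0 : (0 < y)%N by case: y AB => [|//]; nia.
have Ups : uniq [:: 2; p]%N by rewrite /= !inE !(neq_false p2).
have Pps : all prime [:: 2; p]%N by rewrite /= pr_p.
have even r : prime r -> r \notin [:: 2; p]%N -> ~~ odd (logn r A) /\ ~~ odd (logn r B).
  move=> pr; rewrite !inE !negb_or => /andP[r2 rp].
  apply: (even_logn_prod A0 B0 p0 y0 AB) => //; last exact: cop.
  by rewrite !dvdn_prime2.
have [m Dm] := square_class Ups Pps A0 (fun r pr nr => (even r pr nr).1).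
have [n Dn] := square_class Ups Pps B0 (fun r pr nr => (even r pr nr).2).
have par := odd_logn_prod A0 B0 p0 y0 AB.
have := par 2%N; have := par p; rewrite !(logn_prime _ pr_p) !eqxx !(neq_false p2) /=.
move: Dm Dn; rewrite !big_cons !big_nil /=.
case: (odd (logn 2 A)); case: (odd (logn p A)); case: (odd (logn 2 B)); case: (odd (logn p B)) => //= Dm Dn _ _.
- by exists 2%N, p, 1%N, m, n; split; rewrite ?inE ?eqxx ?orbT // -?Dm -?Dn; ring.
- by exists 2%N, 1%N, p, m, n; split; rewrite ?inE ?eqxx ?orbT // -?Dm -?Dn; ring.
- by exists 1%N, p, 1%N, m, n; split; rewrite ?inE ?eqxx ?orbT // -?Dm -?Dn; ring.
- by exists 1%N, 1%N, p, m, n; split; rewrite ?inE ?eqxx ?orbT // -?Dm -?Dn; ring.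
Qed.

(** Here [s] plays the trace of a unit w of norm 1, for which w (s + 2) = (1 + w)^2; the class of s
    + 2 is thus that of w. The residue of p modulo 4 removes the factor 2. *)
Lemma totpos_type (p s t : nat) : prime p -> (p %% 4 = 1)%N -> (2 < s)%N ->
  (s ^ 2 = p * t ^ 2 + 4)%N -> exists l n, l \in [:: 1%N; p] /\ (l * (s + 2) = n ^ 2)%N.
Proof.
move=> pr_p p4 s2 E; have p2 : p != 2%N by apply: contra_eqN p4 => /eqP ->.
have p0 := prime_gt0 pr_p.
have AB : ((s + 2) * (s - 2) = p * t ^ 2)%N by nia.
have [|||c [l [l' [m [n [cin lin Dm Dn]]]]]] := unit_type1 pr_p p2 _ _ AB; try lia.
  move=> r pr r2 rp; apply/negP => /andP[h1 h2].
  have : (r %| (s + 2) - (s - 2))%N by apply: dvdn_sub.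
  have -> : ((s + 2) - (s - 2) = 2 ^ 2)%N by lia.
  by rewrite Euclid_dvdX // andbT dvdn_prime2 // (negPf r2).
have linl : l \in [:: 1%N; p] by move: lin; rewrite !inE => /orP[]/eqP[-> _]; rewrite eqxx ?orbT.
move: cin; rewrite !inE => /orP[]/eqP ce; subst c.
  by exists l, m; split; rewrite // -Dm mul1n.
exfalso.
(* here s + 2 = 2 l u^2 and s - 2 = 2 l' v^2, so l u^2 - l' v^2 = 2, impossible modulo 4 *)
have half (a b w : nat) : a \in [:: 1%N; p] -> (2 * a * b = w ^ 2)%N -> exists u, (b = 2 * a * u ^ 2)%N.
  move=> ain e; have : (2 %| w ^ 2)%N by rewrite -e -mulnA dvdn_mulr.
  rewrite Euclid_dvdX // andbT.
  case/dvdnP => w' Dw; move: ain; rewrite !inE => /orP[]/eqP ae; subst a w.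
    by exists w'; nia.
  have : (p %| (w' * 2) ^ 2)%N by rewrite -e -mulnA mulnCA dvdn_mulr.
  rewrite Euclid_dvdX // andbT Euclid_dvdM // (dvdn_prime2 _ (isT : prime 2)) // (negPf p2) orbF => /dvdnP[w2 Dw2]; subst w'.
  exists w2; apply/eqP; rewrite -(eqn_pmul2l (_ : 0 < 2 * p)%N) ?muln_gt0 //; apply/eqP; rewrite e; ring.
have lin' : l' \in [:: 1%N; p] by move: lin; rewrite !inE => /orP[]/eqP[_ ->]; rewrite eqxx ?orbT.
have [u Du] := half _ _ _ linl Dm; have [v Dv] := half _ _ _ lin' Dn.
have E2 : (l * u ^ 2 = l' * v ^ 2 + 2)%N by nia.
have sq4 (w : nat) : (w ^ 2 %% 4 = 0 \/ w ^ 2 %% 4 = 1)%N.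
  have : (w %% 4 < 4)%N by rewrite ltn_mod.
  rewrite -modnXm; case: (w %% 4)%N => [|[|[|[|//]]]] _; by [left | right].
have := congr1 (modn^~ 4) E2; rewrite -modnDml -(modnMm l) -(modnMm l').
move: lin; rewrite !inE => /orP[]/eqP[-> ->]; rewrite p4;
by case: (sq4 u) => ->; case: (sq4 v) => ->.
Qed.

(** * Units of CM fields *)

Local Notation Qgauss := (quad QQ 'i).

Lemma Qi_subfield : subfield Qgauss.
Proof. by apply: quad_subfield; [apply: QQ_subfield | rewrite sqrCi /QQ /= rpredN rpred1]. Qed.

Lemma Qi_i : Qgauss 'i. Proof. by apply: quad_gen; apply: QQ_subfield. Qed.

Lemma QQ_Aint a : QQ a -> a \in Aint -> exists n : int, a = n%:~R.
Proof. by move=> Qa Aa; apply/intrP; apply: Cint_rat_Aint. Qed.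

Lemma QQ_sqrt_nat a (m : nat) : QQ a -> a ^+ 2 = m%:R -> exists n, m = (n ^ 2)%N.
Proof.
move=> Qa a2; have [|n Dn] := QQ_Aint Qa; first by apply: Aint_sqr; rewrite a2 rpred_nat.
have e : m%:Z = n ^+ 2 by apply/eqP; rewrite -(eqr_int algC) rmorphXn /= -Dn a2.
by exists `|n|%N; rewrite -[LHS]/(absz m) e abszX.
Qed.

Lemma i_neq0 : 'i != 0 :> algC. Proof. exact: neq0Ci. Qed.

Lemma Qi_sqrt_nat z (m : nat) : Qgauss z -> z ^+ 2 = m%:R -> exists n, m = (n ^ 2)%N.
Proof.
have hQ := QQ_subfield; move=> [a [b [Qa Qb ->]]] z2.
have ab0 : a * b = 0.
  have e1 : 2 * (a * b) * 'i = m%:R - a ^+ 2 + b ^+ 2.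
    apply/eqP; rewrite -z2 -subr_eq0; apply/eqP.
    transitivity (b ^+ 2 * (- 1 - 'i ^+ 2)); first by ring.
    by rewrite sqrCi subrr mulr0.
  have := congr1 Num.conj e1.
  rewrite !(rmorphM, rmorphB, rmorphD, rmorphXn) /= (conj_Crat Qa) (conj_Crat Qb) conjCi !rmorph_nat -e1.
  move=> e2; have : 4%:R * 'i * (a * b) = 0 by apply/eqP; rewrite -[0](subrr (2 * (a * b) * 'i)) -{2}e2; apply/eqP; ring.
  by move/eqP; rewrite !mulf_eq0 pnatr_eq0 (negPf i_neq0) /= => /orP[]/eqP ->; rewrite ?mul0r ?mulr0.
move/eqP: ab0; rewrite mulf_eq0 => /orP[]/eqP e0; last first.
  by move: z2; rewrite e0 mul0r addr0; apply: QQ_sqrt_nat.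
move: z2; rewrite e0 add0r exprMn sqrCi mulrN1 => b2.
have : 0 <= b ^+ 2 by rewrite real_exprn_even_ge0 // Creal_Crat.
rewrite -oppr_le0 b2 lern0 => /eqP ->; by exists 0%N.
Qed.

Lemma sqr_1i : (1 + 'i) ^+ 2 = 2 * 'i :> algC.
Proof. by transitivity (1 + 'i ^+ 2 + 2 * 'i : algC); [ring | rewrite sqrCi subrr add0r]. Qed.

(** An even power of i is the square of a power of i. An odd one becomes even after multiplying [z]
    by 1 + i, whose square 2i supplies the factor 2. *)
Lemma kummer_Qi z (N j : nat) : Qgauss z -> z ^+ 2 = 'i ^+ j * N%:R ->
  exists n, ((if odd j then 2 * N else N) = n ^ 2)%N.
Proof.
have hF := Qi_subfield; have Fi := Qi_i.
have even z' N' j' : ~~ odd j' -> Qgauss z' -> z' ^+ 2 = 'i ^+ j' * N'%:R -> exists n, (N' = n ^ 2)%N.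
  move=> oj Fz e; apply: (@Qi_sqrt_nat (z' * 'i ^+ j'./2)); first by fld.
  rewrite exprMn e -exprM muln2; have -> : (j'./2).*2 = j' by rewrite -[RHS]odd_double_half (negPf oj).
  rewrite mulrAC -exprMn mulCii -[j']odd_double_half (negPf oj) add0n -mul2n exprM.
  by rewrite sqrrN expr1n expr1n mul1r.
case: ifP => oj Fz e; last by apply: (even z N j) => //; rewrite oj.
apply: (even ((1 + 'i) * z) _ j.+1); first by rewrite /= oj.
  by fld.
rewrite exprMn e natrM ['i ^+ j.+1]exprS sqr_1i; ring.
Qed.

(** Squaring z = a + b s with a b nonzero puts s in Q(i). If a or b is zero, z s or z lies in Q(i).
    Each time one of n, m n, m is a square. *)
Lemma quad_Qi_nonmem z s (m n : nat) : z ^+ 2 = m%:R -> s ^+ 2 = n%:R ->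
  (forall l, m <> l ^ 2)%N -> (forall l, n <> l ^ 2)%N -> (forall l, m * n <> l ^ 2)%N ->
  ~ quad Qgauss s z.
Proof.
move=> z2 s2 nm nn nmn [a [b [Fa Fb Dz]]]; have hF := Qi_subfield.
have [a0|a0] := eqVneq a 0.
  have Fzs : Qgauss (z * s) by rewrite Dz a0 add0r -mulrA -expr2 s2; fld.
  by have [|l] := @Qi_sqrt_nat (z * s) (m * n) Fzs; [rewrite exprMn z2 s2 natrM | apply: nmn].
have [b0|b0] := eqVneq b 0.
  have Fz : Qgauss z by rewrite Dz b0 mul0r addr0.
  by have [l] := Qi_sqrt_nat Fz z2; apply: nm.
have Ds : s = (m%:R - a ^+ 2 - b ^+ 2 * n%:R) / (2 * (a * b)).
  by rewrite -z2 -s2 Dz; field; rewrite a0 b0.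
have Fs : Qgauss s by rewrite Ds; fld.
by have [l] := Qi_sqrt_nat Fs s2; apply: nn.
Qed.

Lemma fourth_root_1 (z : algC) : z ^+ 4 = 1 -> exists j, z = 'i ^+ j.
Proof.
move=> z4; have : (z ^+ 2 - 1) * (z ^+ 2 + 1) = 0.
  by transitivity (z ^+ 4 - 1); [ring | rewrite z4 subrr].
move/eqP; rewrite mulf_eq0 => /orP[].
  rewrite subr_eq0 sqrf_eq1 => /orP[]/eqP ->; first by exists 0%N.
  by exists 2%N; rewrite sqrCi.
have -> : z ^+ 2 + 1 = (z - 'i) * (z + 'i) by rewrite -subr_sqr sqrCi opprK.
rewrite mulf_eq0 subr_eq0 addr_eq0 => /orP[]/eqP ->; first by exists 1%N.
by exists 3%N; rewrite !exprS expr0 mulr1 mulCii mulrN1.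
Qed.

Lemma i_exp4 j : ('i ^+ j : algC) ^+ 4 = 1.
Proof. by rewrite exprAC -[4%N]/(2 * 2)%N exprM sqrCi sqrrN expr1n expr1n. Qed.

Lemma i_exp_neq0 j : 'i ^+ j != 0 :> algC.
Proof. by rewrite expf_neq0 // i_neq0. Qed.

Lemma QQ_unit K t : integral_unit K t -> QQ t -> t = 1 \/ t = -1.
Proof.
have hQ := QQ_subfield; move=> [t0 [_ At] [_ AtV]] Qt.
have [n Dn] := QQ_Aint Qt At; have [|m Dm] := QQ_Aint _ AtV; first by fld.
have : n * m = 1 by apply/eqP; rewrite -(eqr_int algC) rmorphM /= -Dn -Dm mulfV.
move=> /(congr1 absz)/eqP; rewrite abszM muln_eq1 => /andP[/eqP n1 _].
have : n = 1 \/ n = -1 by lia.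
by rewrite Dn => -[]->; [left | right; rewrite rmorphN].
Qed.

(** The norm is 1 and the trace t = 2a satisfies 4 D b^2 = 4 - t^2, so |t| is at most 2. The values
    2 and 0 give fourth roots of unity; |t| = 1 would make 3 D a square. *)
Lemma imag_unit s (D : nat) w : s ^+ 2 = - D%:R -> s^* = - s -> (0 < D)%N ->
  (forall n, 3 * D <> n ^ 2)%N -> integral_unit (quad QQ s) w -> w ^+ 4 = 1.
Proof.
have hQ := QQ_subfield => s2 sc D0 nsq hw.
have hS : subfield (quad QQ s) by apply: quad_subfield => //; rewrite s2; fld.
have [w0 [[a [b [Qa Qb Dw]]] Aw] _] := hw.
have cQ z : quad QQ s z -> quad QQ s (z^*).
  by move=> [c [d [Qc Qd ->]]]; exists c, (- d); split; fld; rewrite rmorphD rmorphM /= sc (conj_Crat Qc) (conj_Crat Qd); ring.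
have hw' : integral_unit (quad QQ s) (w^*) by apply: iu_morph hw.
have Dw' : w^* = a - b * s by rewrite Dw rmorphD rmorphM /= sc (conj_Crat Qa) (conj_Crat Qb); ring.
have DN : w * w^* = a ^+ 2 + D%:R * b ^+ 2.
  by rewrite Dw' Dw -[D%:R]opprK -s2; ring.
have N1 : w * w^* = 1.
  have [|//|e] := QQ_unit (iuM hS hw hw'); first by rewrite DN; fld.
  have : 0 < w * w^* by rewrite mul_conjC_gt0.
  by rewrite e oppr_gt0 lt_gtF // ltr01.
have [t Dt] : exists n : int, w + w^* = n%:~R.
  apply: QQ_Aint; last by rewrite rpredD // Aint_aut.
  have -> : w + w^* = 2 * a by rewrite Dw' Dw; ring.
  by fld.
have Dt2 : 2 * a = t%:~R by rewrite -Dt Dw' Dw; ring.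
have E : 4%:R * D%:R * b ^+ 2 = (4 - t ^+ 2)%:~R.
  rewrite rmorphB rmorphXn /= -Dt2; have -> : (4 : int)%:~R = 4%:R * (w * w^*) :> algC by rewrite N1 mulr1.
  by rewrite DN; ring.
have b2 : 0 <= b ^+ 2 by rewrite real_exprn_even_ge0 // Creal_Crat.
have t4 : t ^+ 2 <= 4.
  by rewrite -subr_ge0 -(ler0z algC) -E mulr_ge0 // -natrM ler0n.
have t1 : t <= 2 by nia.
have t2 : -2 <= t by nia.
have : (t = 2 \/ t = -2) \/ t = 0 \/ (t = 1 \/ t = -1) by lia.
have n0 (n : nat) : (0 < n)%N -> n%:R != 0 :> algC by move=> ?; rewrite pnatr_eq0 -lt0n.
case=> [ht|[ht|ht]].
- have b0 : b = 0.
    have : 4%:R * D%:R * b ^+ 2 = 0 by rewrite E; case: ht => ->.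
    by move/eqP; rewrite mulf_eq0 -natrM pnatr_eq0 sqrf_eq0 muln_eq0 [D == _]eqn0Ngt D0 => /eqP.
  have : w * w = 1 by rewrite -{2}[w](_ : w^* = w) // Dw' Dw b0 mul0r subr0 addr0.
  by move=> ww; transitivity ((w * w) ^+ 2); [ring | rewrite ww expr1n].
- have a0 : a = 0 by move/eqP: Dt2; rewrite ht mulf_eq0 pnatr_eq0 /= => /eqP.
  have : w * w = -1.
    by rewrite -N1 -mulrN; congr (_ * _); rewrite Dw' Dw a0; ring.
  by move=> ww; transitivity ((w * w) ^+ 2); [ring | rewrite ww sqrrN expr1n].
- have [] := @QQ_sqrt_nat (2 * D%:R * b) (3 * D); first by fld.
    have -> : (2 * D%:R * b) ^+ 2 = (4%:R * D%:R * b ^+ 2) * D%:R by ring.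
    by rewrite E natrM; congr (_ * _); case: ht => ->.
  by move=> n /nsq.
Qed.

(** * Units of Q(i, sqrt D) *)

Section CMUnit.
Variables (D : nat) (phi : {rmorphism algC -> algC}).
Local Notation r := (sqrtC D%:R : algC).
Hypotheses (D0 : (0 < D)%N) (nsq3 : forall n, (3 * D <> n ^ 2)%N).
Hypotheses (phi_i : phi 'i = 'i) (phi_r : phi r = - r).

Lemma quad_real_subfield : subfield (quad QQ r).
Proof. by apply: quad_subfield; [apply: QQ_subfield | rewrite sqrtCK; apply: sf_nat; apply: QQ_subfield]. Qed.

Lemma quad_Qi_subfield : subfield (quad Qgauss r).
Proof. by apply: quad_subfield; [apply: Qi_subfield | rewrite sqrtCK; apply: sf_nat; apply: Qi_subfield]. Qed.

Lemma conj_r : r^* = r.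
Proof. by rewrite geC0_conj // sqrtC_ge0 ler0n. Qed.

Lemma quad_real_conj w : quad QQ r w -> w^* = w.
Proof. by move=> [a [b [Qa Qb ->]]]; rewrite rmorphD rmorphM /= conj_r (conj_Crat Qa) (conj_Crat Qb). Qed.

Lemma quad_real_Qi : quad QQ r `<=` quad Qgauss r.
Proof. by move=> w [a [b [Qa Qb ->]]]; exists a, b; split=> //; apply: quad_base => //; apply: QQ_subfield. Qed.

Lemma quad_real_phi w : quad QQ r w -> quad QQ r (phi w).
Proof.
have hQ := QQ_subfield.
by move=> [a [b [Qa Qb ->]]]; exists a, (- b); split; fld; rewrite rmorphD rmorphM phi_r !(aut_Crat phi) //; ring.
Qed.

Lemma quad_real_norm w : quad QQ r w -> QQ (w * phi w).
Proof.
have hQ := QQ_subfield.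
move=> [a [b [Qa Qb ->]]]; rewrite !(rmorphD, rmorphM, phi_r) /= !(aut_Crat phi) //.
have -> : (a + b * r) * (a + b * - r) = a ^+ 2 - b ^+ 2 * r ^+ 2 by ring.
by rewrite sqrtCK; fld.
Qed.

Lemma quad_real_unit_norm w : integral_unit (quad QQ r) w -> w * phi w = 1 \/ w * phi w = -1.
Proof.
move=> hw; have hS := quad_real_subfield.
apply: (@QQ_unit (quad QQ r)).
  by apply: iuM => //; apply: iu_morph hw; apply: quad_real_phi.
by apply: quad_real_norm; have [_ []] := hw.
Qed.

(** The products [v * phi v] and [v^* * phi v] are units of the imaginary quadratic fields Q(i) and
    Q(i sqrt D), hence fourth roots of unity. Their quotient is [v / v^*]. Total positivity holds
    because [phi] commutes with conjugation on v. *)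
Lemma cm_unit v : integral_unit (quad Qgauss r) v ->
  [/\ exists j, v ^+ 2 = 'i ^+ j * (v * v^*),
      integral_unit (quad QQ r) (v * v^*), 0 < v * v^* & 0 < phi (v * v^*)].
Proof.
move=> hv; have hQ := QQ_subfield; have hF := Qi_subfield; have hS := quad_Qi_subfield.
have hR := quad_real_subfield.
have [v0 [[A [B [[a [b [Qa Qb DA]]] [c [d [Qc Qd DB]]] Dv]]] Av] [_ AvV]] := hv.
have i2 := sqrCi algC; have r2 : r ^+ 2 = D%:R := sqrtCK _.
have Dvc : v^* = a - b * 'i + (c - d * 'i) * r.
  rewrite Dv DA DB !(rmorphD, rmorphM) /= conj_r conjCi.
  by rewrite (conj_Crat Qa) (conj_Crat Qb) (conj_Crat Qc) (conj_Crat Qd); ring.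
have Dvp : phi v = a + b * 'i - (c + d * 'i) * r.
  by rewrite Dv DA DB !(rmorphD, rmorphM) /= phi_r phi_i !(aut_Crat phi) //; ring.
have Dvcp : phi (v^*) = a - b * 'i - (c - d * 'i) * r.
  rewrite Dvc !(rmorphB, rmorphD, rmorphM) /= phi_r phi_i !(aut_Crat phi) //; ring.
have Dvpc : (phi v)^* = phi (v^*).
  rewrite Dvp Dvcp !(rmorphB, rmorphD, rmorphM) /= conj_r conjCi.
  by rewrite (conj_Crat Qa) (conj_Crat Qb) (conj_Crat Qc) (conj_Crat Qd); ring.
have pv0 : phi v != 0 by rewrite fmorph_eq0.
have vc0 : v^* != 0 by rewrite fmorph_eq0.
have mk K x : K x -> K x^-1 -> x \in Aint -> x^-1 \in Aint -> x != 0 -> integral_unit K x by split.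
have Apv : phi v \in Aint /\ (phi v)^-1 \in Aint by rewrite -fmorphV !Aint_aut.
have Avc : v^* \in Aint /\ (v^*)^-1 \in Aint by rewrite -fmorphV !Aint_aut.
have unit_prod K x y : subfield K -> K (x * y) -> x != 0 -> y != 0 ->
    x \in Aint /\ x^-1 \in Aint -> y \in Aint /\ y^-1 \in Aint -> integral_unit K (x * y).
  move=> hK Kxy x0 y0 [Ax AxV] [Ay AyV]; apply: mk => //; first by fld.
  - exact: rpredM.
  - by rewrite invfM rpredM.
  - exact: mulf_neq0.
split.
- have [j1 D1] : exists j, v * phi v = 'i ^+ j.
    apply: fourth_root_1; apply: (@imag_unit 'i 1); [by rewrite sqrCi | exact: conjCi | by [] | |].
      by case=> [|[|n]] //; rewrite -mulnn; lia.
    apply: unit_prod => //; rewrite Dvp Dv DA DB.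
    have -> : (a + b * 'i + (c + d * 'i) * r) * (a + b * 'i - (c + d * 'i) * r)
      = (a + b * 'i) ^+ 2 - (c + d * 'i) ^+ 2 * r ^+ 2 by ring.
    by rewrite r2; have Fi := Qi_i; have FQ := quad_base 'i hQ; move: (FQ a Qa) (FQ b Qb) (FQ c Qc) (FQ d Qd) => *; fld.
  have [j2 D2] : exists j, v^* * phi v = 'i ^+ j.
    apply: fourth_root_1; apply: (@imag_unit ('i * r) D) => //.
    - by rewrite exprMn i2 r2 mulN1r.
    - by rewrite rmorphM /= conjCi conj_r mulNr.
    apply: unit_prod => //.
      by apply: quad_subfield => //; rewrite exprMn i2 r2; fld.
    rewrite Dvp Dvc.
    exists (a ^+ 2 + b ^+ 2 - (c ^+ 2 + d ^+ 2) * D%:R), (2 * (b * c - a * d)); split; fld.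
    move: (r) r2 => R <-; apply/eqP; rewrite -subr_eq0; apply/eqP.
    transitivity ((b ^+ 2 - d ^+ 2 * R ^+ 2) * (- 1 - 'i ^+ 2)); first by ring.
    by rewrite i2 subrr mulr0.
  (* The cube of a fourth root of unity is its inverse. *)
  exists (j1 + j2 * 3)%N; rewrite exprD exprM -D1 -D2.
  have e4 : (v^* * phi v) ^+ 4 = 1 by rewrite D2 i_exp4.
  by transitivity (v ^+ 2 * (v^* * phi v) ^+ 4); [rewrite e4 mulr1 | ring].
- apply: unit_prod => //.
  exists (a ^+ 2 + b ^+ 2 + (c ^+ 2 + d ^+ 2) * D%:R), (2 * (a * c + b * d)); split; fld.
  rewrite Dvc Dv DA DB; move: (r) r2 => R <-; apply/eqP; rewrite -subr_eq0; apply/eqP.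
  transitivity ((b + d * R) ^+ 2 * (- 1 - 'i ^+ 2)); first by ring.
  by rewrite i2 subrr mulr0.
- by rewrite mul_conjC_gt0.
- by rewrite rmorphM /= -Dvpc mul_conjC_gt0.
Qed.
End CMUnit.

(** * Units of real quadratic fields of prime discriminant *)

Lemma add1i_neq0 : 1 + 'i != 0 :> algC.
Proof.
apply/eqP => e; have := sqr_1i; rewrite e expr0n => /esym/eqP.
by rewrite mulf_eq0 pnatr_eq0 (negPf i_neq0).
Qed.

Lemma prime_nonsquare p n : prime p -> p <> (n ^ 2)%N.
Proof. by move=> pr; apply: (@odd_logn_nonsquare p); rewrite logn_prime // eqxx. Qed.

Section PrimeQuad.
Variables (p : nat) (phi : {rmorphism algC -> algC}).
Local Notation r := (sqrtC p%:R : algC).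
Local Notation Qr := (quad QQ r).
Hypotheses (pr_p : prime p) (p4 : (p %% 4 = 1)%N) (phi_r : phi r = - r).

Let hR : subfield Qr := quad_real_subfield p.
Let r2 : r ^+ 2 = p%:R := sqrtCK _.

(** The integer z = (w - phi w) r has square p (n^2 - 4 N), so p divides z, and z / p is twice the
    coefficient of r. *)
Lemma half_int w : Qr w -> w \in Aint -> exists n m : int,
  [/\ 2 * w = n%:~R + m%:~R * r, 2 * phi w = n%:~R - m%:~R * r & w + phi w = n%:~R].
Proof.
have hQ := QQ_subfield; move=> Qw Aw; have [a [b [Qa Qb Dw]]] := Qw.
have Dp : phi w = a - b * r by rewrite Dw rmorphD rmorphM phi_r !(aut_Crat phi) //; ring.
have Ap : phi w \in Aint by rewrite Aint_aut.
have [n Dn] : exists n : int, w + phi w = n%:~R.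
  apply: QQ_Aint; last exact: rpredD.
  have -> : w + phi w = 2 * a by rewrite Dp Dw; ring.
  by fld.
have [N DN] : exists n : int, w * phi w = n%:~R.
  by apply: QQ_Aint; [exact: (quad_real_norm phi_r Qw) | exact: rpredM].
have [z Dz] : exists n : int, (w - phi w) * r = n%:~R.
  apply: QQ_Aint; last by rewrite rpredM ?rpredB // sqrtC_Aint.
  have -> : (w - phi w) * r = 2 * b * r ^+ 2 by rewrite Dp Dw; ring.
  by rewrite r2; fld.
have Ez : z ^+ 2 = p%:Z * (n ^+ 2 - 4 * N).
  apply/eqP; rewrite -(eqr_int algC) rmorphXn rmorphM rmorphB rmorphXn rmorphM /= -Dz -Dn -DN.
  have -> : (p%:Z)%:~R = r ^+ 2 :> algC by rewrite r2.
  by apply/eqP; ring.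
have : (p %| `|z| ^ 2)%N by rewrite -abszX Ez abszM dvdn_mulr.
rewrite Euclid_dvdX // andbT => pz.
have /dvdzP[m Dm] : (p%:Z %| z)%Z by rewrite dvdzE.
have r0 : r != 0 by rewrite sqrtC_eq0 pnatr_eq0 -lt0n prime_gt0.
have Db : 2 * b = m%:~R.
  apply: (mulIf (_ : r ^+ 2 != 0)); first by rewrite expf_neq0.
  have -> : 2 * b * r ^+ 2 = (w - phi w) * r by rewrite Dp Dw; ring.
  by rewrite Dz Dm rmorphM /= r2.
have Da : 2 * a = n%:~R by rewrite -Dn Dp Dw; ring.
by exists n, m; rewrite -Db -Da Dp Dw; split; ring.
Qed.

(** With trace n and norm 1, w (n + 2) = (1 + w)^2. By [totpos_type] n + 2 is a square or p times a
    square, and p is itself the square of r. *)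
Lemma totpos_sqr w : integral_unit Qr w -> 0 < w -> 0 < phi w ->
  exists2 w0, Qr w0 & w = w0 ^+ 2.
Proof.
move=> hw w0 pw0; have [_ [Qw Aw] _] := hw.
have N1 : w * phi w = 1.
  have [//|e] := quad_real_unit_norm phi_r hw.
  by have := mulr_gt0 w0 pw0; rewrite e oppr_gt0 lt_gtF // ltr01.
have [n [m [D1 D2 Dn]]] := half_int Qw Aw.
have E : n ^+ 2 - p%:Z * m ^+ 2 = 4.
  apply/eqP; rewrite -(eqr_int algC) rmorphB rmorphXn rmorphM rmorphXn /=; apply/eqP.
  have -> : (p%:Z)%:~R = r ^+ 2 :> algC by rewrite r2.
  transitivity ((n%:~R + m%:~R * r) * (n%:~R - m%:~R * r)); first by ring.
  by rewrite -D1 -D2; transitivity (4%:R * (w * phi w)); [ring | rewrite N1 mulr1].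
have n0 : 0 < n by rewrite -(ltr0z algC) -Dn addr_gt0.
have [n2|n2] := leP n 2.
  have m0 : m = 0.
    apply/eqP; rewrite -sqrf_eq0; have p0 := prime_gt0 pr_p.
    have : m ^+ 2 <= 0 by nia.
    by rewrite le_eqVlt ltNge sqr_ge0 orbF.
  have n2' : n = 2 by move: E; rewrite m0; nia.
  exists 1; first exact: sf1.
  rewrite expr1n; apply: (mulfI (_ : 2 != 0)); first by rewrite pnatr_eq0.
  by rewrite D1 m0 n2' mul0r addr0 mulr1.
have [||l [k [lin Dk]]] := @totpos_type p `|n|%N `|m|%N pr_p p4; [lia | nia |].
have Dk' : l%:R * (n%:~R + 2) = k%:R ^+ 2 :> algC.
  rewrite -natrX -Dk natrM natrD natr_absz gtr0_norm //.
have k0 : k%:R != 0 :> algC.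
  rewrite pnatr_eq0; apply/eqP => k0; move: Dk; rewrite k0.
  by move: lin; rewrite !inE => /orP[]/eqP->; have := prime_gt0 pr_p; nia.
have Ew : w * (n%:~R + 2) = (1 + w) ^+ 2.
  by rewrite -Dn; transitivity (w ^+ 2 + w * phi w + 2 * w); [ring | rewrite N1; ring].
have n2n0 : n%:~R + 2 != 0 :> algC.
  by apply/eqP => e; move/eqP: Dk'; rewrite e mulr0 eq_sym expf_eq0 (negPf k0).
have [lam Qlam Dlam] : exists2 lam, Qr lam & l%:R = lam ^+ 2.
  move: lin; rewrite !inE => /orP[]/eqP->; first by exists 1; rewrite ?expr1n //; apply: sf1.
  by exists r; [apply: quad_gen; apply: QQ_subfield | rewrite r2].
exists (lam * (1 + w) / k%:R); first by fld.
rewrite exprMn exprMn exprVn -Dlam -Dk' -Ew; field; rewrite n2n0 /=.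
by apply/eqP => e; move/eqP: Dk'; rewrite e mul0r eq_sym expf_eq0 (negPf k0).
Qed.

Lemma norm1_sign w : integral_unit Qr w -> w * phi w = 1 ->
  exists2 s, s = w \/ s = - w & [/\ integral_unit Qr s, 0 < s & 0 < phi s].
Proof.
move=> hw N1; have [w0 [Qw Aw] _] := hw.
have : w \is Num.real by apply/CrealP; apply: quad_real_conj Qw.
have main s : integral_unit Qr s -> s * phi s = 1 -> 0 <= s -> 0 < s /\ 0 < phi s.
  move=> [s0 _ _] Ns s1; have sp : 0 < s by rewrite lt0r s0.
  by split=> //; rewrite -(pmulr_rgt0 _ sp) Ns ltr01.
rewrite realE => /orP[w1|w1].
  by exists w; [left | split=> //; have [] := main w hw N1 w1].
exists (- w); first by right.
have [||] := main (- w) (iuN hR hw); first by rewrite rmorphN mulrNN.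
  by rewrite oppr_ge0.
by split=> //; apply: iuN.
Qed.

(** Descent on the trace, starting from a Pell solution. A totally positive unit is v^2; if v has
    norm 1, then v or -v is again totally positive and its trace n satisfies n^2 = s + 2, where n is
    not 2 as v^2 is not 1. Hence n < s. *)
Lemma neg_unit_exists : exists2 w, integral_unit Qr w & w * phi w = -1.
Proof.
have descent (s : nat) : forall w, integral_unit Qr w -> 0 < w -> 0 < phi w -> w != 1 ->
    w + phi w = s%:R -> exists2 w, integral_unit Qr w & w * phi w = -1.
  elim/ltn_ind: s => s IHs w hw w0 pw0 w1 Ds.
  have [v Qv Dw] := totpos_sqr hw w0 pw0.
  have hv : integral_unit Qr v by apply: iu_sqr => //; rewrite -Dw.
  have [Nv|Nv] := quad_real_unit_norm phi_r hv; last by exists v.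
  have [v1 sv [hv1 v10 pv10]] := norm1_sign hv Nv.
  have Dw1 : w = v1 ^+ 2 by case: sv => ->; rewrite ?sqrrN.
  have Nv1 : v1 * phi v1 = 1 by case: sv => ->; rewrite // rmorphN mulrNN.
  have v11 : v1 != 1 by apply: contraNneq w1; rewrite Dw1 => ->; rewrite expr1n.
  have [_ [Qv1 Av1] _] := hv1; have [n [m [_ _ Dn]]] := half_int Qv1 Av1.
  have n0 : 0 < n by rewrite -(ltr0z algC) -Dn addr_gt0.
  have Ens : n ^+ 2 = s%:Z + 2.
    apply/eqP; rewrite -(eqr_int algC) rmorphXn rmorphD /= -Dn -[_%:~R]/(s%:R) -Ds Dw1.
    by apply/eqP; rewrite rmorphXn; transitivity (v1 ^+ 2 + phi v1 ^+ 2 + 2 * (v1 * phi v1)); [ring | rewrite Nv1 mulr1].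
  have n2 : n <> 2.
    move=> n2; have : (v1 - 1) ^+ 2 = 0.
      transitivity (v1 * (v1 + phi v1 - 2) + 1 - v1 * phi v1); first by ring.
      by rewrite Nv1 Dn n2 subrr mulr0 add0r subrr.
    by move/eqP; rewrite sqrf_eq0 subr_eq0 (negPf v11).
  apply: (IHs `|n|%N _ v1) => //; first by nia.
  by rewrite Dn natr_absz gtr0_norm.
have nsq n : p <> (n ^ 2)%N by apply: prime_nonsquare.
have [X [Y [Y0 E]]] := pell_exists (prime_gt0 pr_p) nsq.
pose w : algC := X%:~R + Y%:~R * r.
have hQ := QQ_subfield.
have Qw : Qr w by exists X%:~R, Y%:~R; split; fld.
have Aw : w \in Aint by rewrite rpredD ?rpredM ?Aint_int ?sqrtC_Aint.
have Dp : phi w = X%:~R - Y%:~R * r by rewrite rmorphD rmorphM phi_r !rmorph_int mulrN.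
have N1 : w * phi w = 1.
  rewrite Dp; transitivity (X%:~R ^+ 2 - r ^+ 2 * Y%:~R ^+ 2); first by rewrite /w; ring.
  rewrite r2 -[p%:R]/(p%:Z%:~R) -!rmorphXn -rmorphM -rmorphB /= E //.
have w0 : w != 0 by apply/eqP => e; move/eqP: N1; rewrite e mul0r eq_sym oner_eq0.
have Dwi : w^-1 = phi w by apply: (mulfI w0); rewrite N1 mulfV.
have hw : integral_unit Qr w.
  by split=> //; split; rewrite ?Dwi ?Aint_aut //; apply: quad_real_phi.
have [s sw [hs s0 ps0]] := norm1_sign hw N1.
have Y0' : Y%:~R != 0 :> algC by rewrite intr_eq0.
have nQr : ~ QQ r by move=> /(QQ_sqrt_nat)/(_ r2)[n]; apply: nsq.
have s1 : s != 1.
  apply/eqP => s1; apply: nQr.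
  have : w = 1 \/ w = -1 by case: sw => e; [left | right]; rewrite -s1 e ?opprK.
  have -> : r = (w - X%:~R) / Y%:~R by rewrite /w; field.
  by case=> ->; fld.
have [_ [Qs As] _] := hs; have [n [m [_ _ Dn]]] := half_int Qs As.
have n0 : 0 < n by rewrite -(ltr0z algC) -Dn addr_gt0.
by apply: (descent `|n|%N s) => //; rewrite Dn natr_absz gtr0_norm.
Qed.

Lemma norm1_sqr w : integral_unit Qr w -> w * phi w = 1 ->
  exists j w0, [/\ integral_unit Qr w0 & w = 'i ^+ j * w0 ^+ 2].
Proof.
move=> hw N1; have [s sw [hs s0 ps0]] := norm1_sign hw N1.
have [w0 Qw0 Ds] := totpos_sqr hs s0 ps0.
have hw0 : integral_unit Qr w0 by apply: iu_sqr => //; rewrite -Ds.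
case: sw => e; first by exists 0%N, w0; rewrite mul1r -Ds e.
by exists 2%N, w0; rewrite sqrCi mulN1r -Ds e opprK.
Qed.
End PrimeQuad.

Lemma natsqr_mul_eq1 (n : nat) (m : int) : n%:Z ^+ 2 * m ^+ 2 = 1 -> n = 1%N.
Proof.
move=> /(congr1 absz)/eqP; rewrite abszM muln_eq1 abszX => /andP[+ _].
by rewrite -[1%N](exp1n 2) eqn_exp2r // => /eqP.
Qed.

(** * A Gaussian prime times a unit of norm -1 *)

Section GaussPrime.
Variables (p : nat) (phi : {rmorphism algC -> algC}) (e f : nat).
Local Notation r := (sqrtC p%:R : algC).
Local Notation Qr := (quad QQ r).
Hypotheses (pr_p : prime p) (p4 : (p %% 4 = 1)%N) (phi_r : phi r = - r).
Hypothesis pef : p = (e ^ 2 + 4 * f ^ 2)%N.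
Local Notation pi1 := (e%:R + 2 * 'i * f%:R : algC).
Local Notation pi2 := (e%:R - 2 * 'i * f%:R : algC).

Let r2 : r ^+ 2 = p%:R := sqrtCK _.

Lemma pi12 : pi1 * pi2 = p%:R.
Proof.
transitivity (e%:R ^+ 2 - 4%:R * 'i ^+ 2 * f%:R ^+ 2 : algC); first by ring.
by rewrite sqrCi pef natrD natrM !natrX; ring.
Qed.

Lemma pi1_neq0 : pi1 != 0.
Proof.
apply/eqP => h; move/eqP: pi12; rewrite h mul0r eq_sym pnatr_eq0.
by have := prime_gt0 pr_p; lia.
Qed.

(** The norm being the square of 4f, one has 2 (A + 4f)(A + B r) = (A + 4f + B r)^2. The factor A +
    4f divides p B^2 with cofactor A - 4f, so its square class is among 1, 2, p, 2p. *)
Lemma sqrt_norm_sqr (A B : int) : 0 < A -> A ^+ 2 - p%:Z * B ^+ 2 = 16 * f%:Z ^+ 2 -> B != 0 ->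
  (forall t, prime t -> t != 2%N -> ~~ ((t %| `|A|) && (t %| `|B|))%N) ->
  exists j k, [/\ quad Qgauss r k, k != 0 & A%:~R + B%:~R * r = 'i ^+ j * k ^+ 2].
Proof.
move=> A0 E B0 cop; have p0 := prime_gt0 pr_p.
have hS : subfield (quad Qgauss r) := quad_Qi_subfield p.
have kr : quad Qgauss r r by apply: quad_gen; apply: Qi_subfield.
have ki : quad Qgauss r 'i by apply: quad_base; [apply: Qi_subfield | apply: Qi_i].
have p2 : p != 2%N by apply: contra_eqN p4 => /eqP ->.
have Bsq : 0 < B ^+ 2 by rewrite lt0r sqr_ge0 sqrf_eq0 B0.
have EN : (`|A| ^ 2 = p * `|B| ^ 2 + (4 * f) ^ 2)%N.
  have hA : A ^+ 2 = (`|A| ^ 2)%N%:Z by rewrite -abszX gez0_abs ?sqr_ge0.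
  have hB : B ^+ 2 = (`|B| ^ 2)%N%:Z by rewrite -abszX gez0_abs ?sqr_ge0.
  by move: E; rewrite hA hB expnMn; lia.
have A4f : (4 * f < `|A|)%N.
  rewrite -ltn_sqr EN -[X in (X < _)%N]add0n ltn_add2r muln_gt0 p0 expn_gt0.
  by rewrite lt0n absz_eq0 B0.
have AB : ((`|A| + 4 * f) * (`|A| - 4 * f) = p * `|B| ^ 2)%N.
  by rewrite mulnC -subn_sqr EN addnK.
have cop' t : prime t -> t != 2%N -> t != p ->
    ~~ ((t %| `|A| + 4 * f) && (t %| `|A| - 4 * f))%N.
  move=> pt t2 tp; apply/negP => /andP[h1 h2].
  have odd_cancel x : (t %| 2 * x)%N -> (t %| x)%N.
    by rewrite Euclid_dvdM // dvdn_prime2 // (negPf t2).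
  have tA : (t %| `|A|)%N.
    apply: odd_cancel; have := dvdn_add h1 h2.
    by rewrite -addnA subnKC ?(ltnW A4f) // addnn -mul2n.
  have tB : (t %| `|B|)%N.
    have : (t %| p * `|B| ^ 2)%N by rewrite -AB dvdn_mulr.
    by rewrite Euclid_dvdM // dvdn_prime2 // (negPf tp) Euclid_dvdX // andbT.
  by have := cop t pt t2; rewrite tA tB.
have [||c [l [l' [m [n' [cin lin Dm _]]]]]] := unit_type1 pr_p p2 _ _ AB cop'.
- by rewrite ltn_addr // (leq_ltn_trans (leq0n _) A4f).
- by rewrite subn_gt0.
have {}lin : l = 1%N \/ l = p.
  by move: lin; rewrite !inE => /orP[]/eqP[? _]; [left | right].
have Dm' : c%:R * l%:R * (A%:~R + 4%:R * f%:R) = m%:R ^+ 2 :> algC.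
  by rewrite -natrX -Dm !natrM natrD natrM natr_absz gtr0_norm.
have l0 : (0 < l)%N by case: lin => ->.
have c0 : (0 < c)%N by move: cin; rewrite !inE => /orP[]/eqP->.
have m0 : m%:R != 0 :> algC.
  have : (0 < m ^ 2)%N by rewrite -Dm !muln_gt0 c0 l0 ltn_addr // (leq_ltn_trans (leq0n _) A4f).
  by rewrite expn_gt0 orbF pnatr_eq0 -lt0n.
have [lam klam Dlam] : exists2 lam, quad Qgauss r lam & l%:R = lam ^+ 2.
  by case: lin => ->; [exists 1; rewrite ?expr1n //; fld | exists r; rewrite ?r2].
pose Y : algC := A%:~R + 4%:R * f%:R + B%:~R * r.
have EY : 2 * (A%:~R + 4%:R * f%:R) * (A%:~R + B%:~R * r) = Y ^+ 2.
  have E' : A%:~R ^+ 2 - r ^+ 2 * B%:~R ^+ 2 = 16%:R * f%:R ^+ 2 :> algC.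
    have := congr1 (fun n : int => n%:~R : algC) E.
    rewrite rmorphB rmorphXn rmorphM rmorphXn rmorphM rmorphXn /= r2 => <-.
    by rewrite -!pmulrn.
  apply/eqP; rewrite -subr_eq0; apply/eqP.
  transitivity (A%:~R ^+ 2 - r ^+ 2 * B%:~R ^+ 2 - 16%:R * f%:R ^+ 2 : algC); first by rewrite /Y; ring.
  by rewrite E' subrr.
have A4f0 : A%:~R + 4%:R * f%:R != 0 :> algC.
  by apply/eqP => h; move/eqP: Dm'; rewrite h mulr0 eq_sym expf_eq0 (negPf m0).
have kY : quad Qgauss r Y by rewrite /Y; fld.
have ABr0 : A%:~R + B%:~R * r != 0.
  apply/eqP => h.
  have : A%:~R ^+ 2 = (B%:~R * r) ^+ 2 :> algC.
    by move/eqP: h; rewrite addr_eq0 => /eqP ->; rewrite sqrrN.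
  rewrite exprMn r2 -!rmorphXn -[p%:R]/(p%:Z%:~R) -rmorphM /= => /eqP; rewrite eqr_int => /eqP h2.
  have f0 : f = 0%N.
    by move: E; rewrite h2 mulrC subrr => /esym/eqP; rewrite mulf_eq0 sqrf_eq0 /= => /eqP[].
  by move: pr_p; rewrite pef f0 muln0 addn0 => /prime_nonsquare/(_ (erefl (e ^ 2)%N)).
have Y0 : Y != 0.
  by apply/eqP => h; move/eqP: EY; rewrite h expr0n /= !mulf_eq0 pnatr_eq0 (negPf A4f0) (negPf ABr0).
have lam0 : lam != 0 by apply/eqP => h; move/eqP: Dlam; rewrite h expr0n pnatr_eq0 -leqn0 leqNgt l0.
have i1 := add1i_neq0.
have Dval : A%:~R + B%:~R * r = Y ^+ 2 * c%:R * lam ^+ 2 / (2 * m%:R ^+ 2).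
  rewrite -EY -Dm' Dlam; field.
  by rewrite A4f0 lam0 pnatr_eq0 -lt0n c0.
(* For c = 1 a factor 1/2 remains, and 1/2 = i / (1 + i)^2; for c = 2 it cancels. *)
move: cin Dval; rewrite !inE => /orP[]/eqP-> Dval.
  exists 1%N, (Y * lam / (m%:R * (1 + 'i))); split; first by fld.
    by rewrite !mulf_neq0 ?invr_eq0 ?mulf_neq0.
  rewrite Dval expr1 exprMn exprVn exprMn [in RHS]exprMn sqr_1i; field.
  by rewrite m0 i_neq0.
exists 0%N, (Y * lam / m%:R); split; first by fld.
  by rewrite !mulf_neq0 ?invr_eq0.
by rewrite Dval; field.
Qed.

(** Multiplying by the square of 1 + r / pi1 turns pi1 into pi1 + pi2 + 2r = 2 (e + r), which is
    real. The norm of e + r is -4f^2, and 2w has norm -4, so the product has the square norm that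
    [sqrt_norm_sqr] requires. *)
Lemma pi1_neg_unit w : integral_unit Qr w -> w * phi w = -1 ->
  exists j k, [/\ quad Qgauss r k, k != 0 & pi1 * w = 'i ^+ j * k ^+ 2].
Proof.
move=> hw Nw; have [w0 [Qw Aw] _] := hw.
have hS : subfield (quad Qgauss r) := quad_Qi_subfield p.
have kr : quad Qgauss r r by apply: quad_gen; apply: Qi_subfield.
have ki : quad Qgauss r 'i by apply: quad_base; [apply: Qi_subfield | apply: Qi_i].
have [n [m [D1 D2 _]]] := half_int pr_p phi_r Qw Aw.
have E : n ^+ 2 - p%:Z * m ^+ 2 = -4.
  apply/eqP; rewrite -(eqr_int algC) rmorphB rmorphXn rmorphM rmorphXn /=; apply/eqP.
  have -> : (p%:Z)%:~R = r ^+ 2 :> algC by rewrite r2.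
  transitivity ((n%:~R + m%:~R * r) * (n%:~R - m%:~R * r)); first by ring.
  rewrite -D1 -D2; transitivity (4%:R * (w * phi w)); first by ring.
  by rewrite Nw mulrN1 rmorphN.
have pi0 := pi1_neq0.
have f0 : (0 < f)%N.
  rewrite lt0n; apply/eqP => f0; move: pr_p.
  by rewrite pef f0 muln0 addn0 => /prime_nonsquare/(_ (erefl (e ^ 2)%N)).
have pefZ : p%:Z = e%:Z ^+ 2 + 4 * f%:Z ^+ 2 by rewrite pef; lia.
(* The coordinates of (e + r)(n + m r). Since B n - A m = n^2 - p m^2 = -4, no odd prime divides
   both. *)
pose A := e%:Z * n + p%:Z * m; pose B := n + e%:Z * m.
have EAB : A ^+ 2 - p%:Z * B ^+ 2 = 16 * f%:Z ^+ 2.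
  transitivity ((e%:Z ^+ 2 - p%:Z) * (n ^+ 2 - p%:Z * m ^+ 2)); first by rewrite /A /B; ring.
  by rewrite E pefZ; ring.
have DAB : pi1 * w * (1 + r / pi1) ^+ 2 = A%:~R + B%:~R * r.
  transitivity ((pi1 + pi2 + 2 * r) * w).
    transitivity ((pi1 + r ^+ 2 / pi1 + 2 * r) * w); first by field.
    have -> // : r ^+ 2 / pi1 = pi2 by apply: (mulIf pi0); rewrite divfK // r2 mulrC pi12.
  transitivity ((e%:R + r) * (2 * w)); first by ring.
  rewrite D1 /A /B !rmorphD !rmorphM /= -[(p%:Z)%:~R]/(p%:R) -!pmulrn.
  by have := r2; move: (r) => R <-; ring.
have A0 : A != 0.
  apply/eqP => h; have : 0 < 16 * f%:Z ^+ 2 by rewrite mulr_gt0 // exprn_gt0.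
  rewrite -EAB h expr0n sub0r oppr_gt0 ltNge mulr_ge0 ?sqr_ge0 //.
have k0 : 1 + r / pi1 != 0.
  apply/eqP => h; move: DAB; rewrite h expr0n mulr0 => /esym/eqP; rewrite addr_eq0 => /eqP h2.
  have : A%:~R ^+ 2 = (B%:~R * r) ^+ 2 :> algC by rewrite h2 sqrrN.
  rewrite exprMn r2 -!rmorphXn -[p%:R]/(p%:Z%:~R) -rmorphM /= => /eqP; rewrite eqr_int => /eqP h3.
  by move: EAB; rewrite h3 mulrC subrr => /esym/eqP; rewrite mulf_eq0 sqrf_eq0 /= eqz_nat gtn_eqF.
have cop t : prime t -> t != 2%N -> ~~ ((t %| `|A|) && (t %| `|B|))%N.
  move=> pt t2; apply/negP => /andP[tA tB].
  have : (t%:Z %| B * n - A * m)%Z by rewrite rpredB // dvdz_mulr // dvdzE.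
  have -> : B * n - A * m = - 4 by rewrite -E /A /B; ring.
  rewrite dvdzE /= -[4%N]/(2 ^ 2)%N Euclid_dvdX // andbT dvdn_prime2 //.
  exact/negP.
have [j [k [Qk kn0 Dk]]] : exists j k, [/\ quad Qgauss r k, k != 0 & A%:~R + B%:~R * r = 'i ^+ j * k ^+ 2].
  (* If B = 0 then f = 1 and A = 4 or -4, a square up to sign. A negative A is handled by changing
     both signs, which costs i^2. *)
  have [B0|B0] := eqVneq B 0.
    have f1 : f = 1%N.
      have hn : n = - (e%:Z * m) by move/eqP: B0; rewrite addr_eq0 => /eqP.
      apply: (@natsqr_mul_eq1 f m); apply: (mulfI (_ : -4 != 0)) => //.
      by transitivity (n ^+ 2 - p%:Z * m ^+ 2); [rewrite hn pefZ; ring | rewrite E mulr1].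
    move/eqP: EAB; rewrite B0 f1 expr0n mulr0 subr0 expr1n mulr1 -[16%R]/((4 : int) ^+ 2) eqf_sqr.
    case/orP=> /eqP ->; rewrite mul0r addr0.
      by exists 0%N, 2; split; fld; rewrite ?pnatr_eq0 // mul1r -natrX.
    exists 2%N, 2; split; fld; rewrite ?pnatr_eq0 //.
    by rewrite sqrCi mulN1r -natrX rmorphN.
  have [Ap|An] := ltP 0 A; first exact: sqrt_norm_sqr.
  have [||||j [k [Qk kn0 Dk]]] := @sqrt_norm_sqr (- A) (- B).
  - by rewrite oppr_gt0 lt_neqAle A0.
  - by rewrite !sqrrN.
  - by rewrite oppr_eq0.
  - by move=> t; rewrite !abszN; apply: cop.
  exists (j + 2)%N, k; split=> //.
  by rewrite exprD sqrCi mulrN1 mulNr -Dk !rmorphN mulNr -opprD opprK.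
exists j, (k / (1 + r / pi1)); split.
- by fld.
- by rewrite mulf_neq0 ?invr_eq0.
apply: (mulIf (_ : (1 + r / pi1) ^+ 2 != 0)); first by rewrite expf_neq0.
by rewrite DAB Dk; move: (1 + r / pi1) k0 => K0 K0n; field.
Qed.
End GaussPrime.

(** * Square classes of fundamental units of norm 1 *)

Section EpsType.
Variables (D : nat) (x y : int).
Local Notation r := (sqrtC D%:R : algC).
Local Notation eps := (x%:~R + y%:~R * r : algC).
Hypotheses (x1 : 1 < x) (E : x ^+ 2 - D%:Z * y ^+ 2 = 1).

(** The last clause serves to rule out c = 2, d = 1: there [eps] would be a square in its own real
    field, which no fundamental unit is. *)
Lemma eps_type (c d : nat) : c \in [:: 1; 2]%N -> (0 < d)%N -> pm1_square (c%:Z * d%:Z) x ->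
  exists2 z, quad Qgauss r z /\ z != 0 &
    d%:R * eps = (if c == 1%N then 'i else 1) * z ^+ 2 /\ (c = 2%N -> d = 1%N -> quad QQ r z).
Proof.
move=> cin d0 sq; have hS : subfield (quad Qgauss r) := quad_Qi_subfield D.
have hR : subfield (quad QQ r) := quad_real_subfield D.
have kr : quad Qgauss r r by apply: quad_gen; apply: Qi_subfield.
have rr : quad QQ r r by apply: quad_gen; apply: QQ_subfield.
have ki : quad Qgauss r 'i by apply: quad_base; [apply: Qi_subfield | apply: Qi_i].
have r2 : r ^+ 2 = D%:R := sqrtCK _.
have [s [hs1 [n Dn]]] : exists s : int, s ^+ 2 = 1 /\ exists n : nat, c%:Z * d%:Z * (x + s) = (n ^ 2)%N%:Z.
  by case: sq => -[n Dn]; [exists 1 | exists (-1)]; split=> //; exists n.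
have xs : 0 < x + s by nia.
have c0 : (0 < c)%N by move: cin; rewrite !inE => /orP[]/eqP->.
have n0 : n%:R != 0 :> algC.
  by rewrite pnatr_eq0; apply/eqP => n0; move: Dn; rewrite n0; nia.
have Dn' : c%:R * d%:R * (x + s)%:~R = n%:R ^+ 2 :> algC.
  by rewrite -natrX -[(n ^ 2)%:R]/((n ^ 2)%N%:Z%:~R) -Dn !rmorphM.
pose Z : algC := (x + s)%:~R + y%:~R * r.
have EZ : 2 * (x + s)%:~R * eps = Z ^+ 2.
  have E' : x%:~R ^+ 2 - r ^+ 2 * y%:~R ^+ 2 = 1 :> algC.
    have := congr1 (fun n : int => n%:~R : algC) E.
    by rewrite rmorphB rmorphXn rmorphM rmorphXn /= r2.
  have s2 : s%:~R ^+ 2 = 1 :> algC by rewrite -rmorphXn /= hs1.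
  apply/eqP; rewrite -subr_eq0; apply/eqP.
  transitivity (x%:~R ^+ 2 - r ^+ 2 * y%:~R ^+ 2 - s%:~R ^+ 2 : algC).
    by rewrite /Z rmorphD; ring.
  by rewrite E' s2 subrr.
have xs0 : (x + s)%:~R != 0 :> algC by rewrite intr_eq0 gt_eqF.
have eps0 : eps != 0.
  apply/eqP => /eqP; rewrite addr_eq0 => /eqP h.
  have : x%:~R ^+ 2 = D%:R * y%:~R ^+ 2 :> algC by rewrite h sqrrN exprMn r2 mulrC.
  rewrite -!rmorphXn -[D%:R]/(D%:Z%:~R) -rmorphM /= => /eqP; rewrite eqr_int => /eqP h2.
  by move: E; rewrite h2 subrr.
have Z0 : Z != 0.
  by apply/eqP => h; move/eqP: EZ; rewrite h expr0n /= !mulf_eq0 pnatr_eq0 (negPf xs0) (negPf eps0).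
have dn0 : d%:R != 0 :> algC by rewrite pnatr_eq0 -lt0n.
have rZ : quad QQ r Z by rewrite /Z; fld.
have kZ : quad Qgauss r Z by apply: quad_real_Qi.
have Deps : d%:R * eps = c%:R * (d%:R * Z) ^+ 2 / (2 * n%:R ^+ 2).
  have cn0 : c%:R != 0 :> algC by rewrite pnatr_eq0 -lt0n.
  rewrite exprMn -EZ -Dn'; move: ((x + s)%:~R : algC) xs0 => XS XS0.
  by field; rewrite XS0 dn0 cn0.
move: cin Deps; rewrite !inE => /orP[]/eqP-> /= Deps.
  exists (d%:R * Z / (n%:R * (1 + 'i))); last first.
    split=> //; rewrite Deps [in RHS]exprMn exprVn [(n%:R * _) ^+ 2]exprMn sqr_1i; field.
    by rewrite n0 i_neq0.
  have i1 := add1i_neq0.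
  by split; [fld | rewrite !mulf_neq0 ?invr_eq0 ?mulf_neq0].
exists (d%:R * Z / n%:R).
  by split; [fld | rewrite !mulf_neq0 ?invr_eq0].
split; last by move=> _ _; fld.
by rewrite Deps mul1r; field.
Qed.
End EpsType.

Lemma exprz_gt1_eq1 (e : algC) (m : int) : 1 < e -> e ^ m = 1 -> m = 0.
Proof.
move=> e1; have gt1 n : e ^+ n.+1 = 1 -> False.
  by move=> h; have : 1 < e ^+ n.+1; [apply: exprn_egt1 | rewrite h ltxx].
case: m => [[|n]|n] //; first by move/gt1.
by rewrite NegzE -exprnN => /eqP; rewrite invr_eq1 => /eqP/gt1.
Qed.

(** A root z would be a unit, hence a power of e up to sign, so e would be an even power of itself;
    but e > 1 has infinite order. *)
Lemma fundamental_nonsquare K e z : subfield K -> fundamental_unit K e -> K z -> e <> z ^+ 2.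
Proof.
move=> hK [he e1 gen] Kz De.
have hz : integral_unit K z by apply: iu_sqr => //; rewrite -De.
have e0 : e != 0 by case: he.
have [n Dn] := gen z hz.
have De2 : e = e ^ (n + n) by rewrite expfzDr // {1}De; case: Dn => ->; rewrite ?sqrrN expr2.
have : e ^ (n + n - 1) = 1 by rewrite expfzDr // -De2 mulfV.
by move/(exprz_gt1_eq1 e1); lia.
Qed.

Lemma fundamental_pos K e u : subfield K -> fundamental_unit K e -> integral_unit K u -> 0 < u ->
  exists n : int, u = e ^ n.
Proof.
move=> hK [he e1 gen] /gen[n [->|->]]; first by exists n.
by rewrite oppr_gt0 lt_gtF // exprz_gt0 // (lt_trans ltr01 e1).
Qed.

(* Modulo 4 the equation x^2 - D y^2 = -1 has no solution when D = 3 mod 4. *)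
Lemma fundamental_norm (D : nat) (x y : int) (phi : {rmorphism algC -> algC}) :
  (D %% 4 = 3)%N -> phi (sqrtC D%:R) = - sqrtC D%:R ->
  fundamental_unit (quad QQ (sqrtC D%:R)) (x%:~R + y%:~R * sqrtC D%:R) ->
  [/\ x ^+ 2 - D%:Z * y ^+ 2 = 1, 1 < x &
   (x%:~R + y%:~R * sqrtC D%:R) * phi (x%:~R + y%:~R * sqrtC D%:R) = 1].
Proof.
move=> D4 phir; set r := sqrtC D%:R in phir *; have r2 : r ^+ 2 = D%:R := sqrtCK _.
set e := x%:~R + y%:~R * r => -[he e1 _].
have Dp : phi e = x%:~R - y%:~R * r by rewrite rmorphD rmorphM phir !rmorph_int mulrN.
have DN : e * phi e = (x ^+ 2 - D%:Z * y ^+ 2)%:~R.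
  rewrite Dp rmorphB rmorphXn rmorphM rmorphXn /= -[(D%:Z)%:~R]/(D%:R) -r2 /e; ring.
have E : x ^+ 2 - D%:Z * y ^+ 2 = 1.
  have : x ^+ 2 - D%:Z * y ^+ 2 = 1 \/ x ^+ 2 - D%:Z * y ^+ 2 = -1.
    have := quad_real_unit_norm phir he; rewrite DN => -[]h; [left | right]; apply/eqP.
      by rewrite -(eqr_int algC) h.
    by rewrite -(eqr_int algC) h rmorphN.
  case=> // h; exfalso; have DD : D%:Z = (D %/ 4)%N%:Z * 4 + 3 by lia.
  have sq4 (w : int) : exists t : int, w ^+ 2 = 4 * t \/ w ^+ 2 = 4 * t + 1.
    have [t ht] : exists t : int, w = 2 * t \/ w = 2 * t + 1.
      by exists (w %/ 2)%Z; lia.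
    case: ht => ->; [exists (t ^+ 2); left | exists (t ^+ 2 + t); right]; ring.
  have [t ht] := sq4 x; have [s hs] := sq4 y; move: h; rewrite DD.
  case: ht => ->; case: hs => ->; rewrite ?mulrDr ?mulrDl; lia.
have N1 : e * phi e = 1 by rewrite DN E.
split=> //.
have e0 : 0 < e := lt_trans ltr01 e1.
have pe0 : 0 < phi e by rewrite -(pmulr_rgt0 _ e0) N1 ltr01.
have x0 : 0 < x.
  rewrite -(ltr0z algC); have -> : x%:~R = (e + phi e) / 2 by rewrite Dp /e; field.
  by apply: divr_gt0; [apply: addr_gt0 | rewrite ltr0n].
rewrite ltNge; apply/negP => x1; have xe : x = 1 by lia.
have : y ^+ 2 = 0.
  have D0 : (0 < D)%N by lia.
  by move/eqP: E; rewrite xe expr1n -subr_eq0 addrAC subrr add0r oppr_eq0 mulf_eq0 eqz_nat gtn_eqF //= => /eqP.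
move/eqP; rewrite sqrf_eq0 => /eqP y0.
by move: e1; rewrite /e xe y0 mul0r addr0 ltxx.
Qed.

(** * The field K1 and its units *)

Lemma rmorph4 (phi : {rmorphism algC -> algC}) (a b c e s t : algC) :
  phi (a + b * s + c * t + e * (s * t)) =
  phi a + phi b * phi s + phi c * phi t + phi e * (phi s * phi t).
Proof. by rewrite !(rmorphD, rmorphM). Qed.

Section Biquadratic.
Variables (p1 p2 q : nat).
Hypotheses (pr1 : prime p1) (pr2 : prime p2) (prq : prime q).
Hypotheses (p14 : (p1 %% 4 = 1)%N) (p24 : (p2 %% 4 = 1)%N) (q4 : (q %% 4 = 3)%N).
Hypotheses (n12 : p1 != p2) (n1q : p1 != q) (n2q : p2 != q).

Local Notation r1 := (sqrtC p1%:R : algC).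
Local Notation r2 := (sqrtC (p2 * q)%N%:R : algC).
Local Notation rd := (sqrtC (p1 * p2 * q)%N%:R : algC).
Local Notation k := (quad Qgauss rd).
Local Notation L := (quad k r1).

Lemma neq2 : [/\ p1 != 2, p2 != 2 & q != 2]%N.
Proof. by split; apply/eqP => h; [move: p14 | move: p24 | move: q4]; rewrite h. Qed.

Lemma lognE :
  ((logn 2 p1 = 0%N) * (logn 2 p2 = 0%N) * (logn 2 q = 0%N) * (logn 2 2 = 1%N)
  * (logn p1 p1 = 1%N) * (logn p1 p2 = 0%N) * (logn p1 q = 0%N)
  * (logn p2 p1 = 0%N) * (logn p2 p2 = 1%N) * (logn p2 q = 0%N)
  * (logn q p1 = 0%N) * (logn q p2 = 0%N) * (logn q q = 1%N))%type.
Proof.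
have [a b c] := neq2.
by rewrite !(logn_prime _ pr1) !(logn_prime _ pr2) !(logn_prime _ prq) !eqxx
  !(neq_false a) !(neq_false b) !(neq_false c) !(neq_false n12) !(neq_false n1q) !(neq_false n2q).
Qed.

Lemma gt0s : [/\ 0 < p1, 0 < p2 & 0 < q]%N.
Proof. by split; apply: prime_gt0. Qed.

Ltac nsqt s := let a := fresh in let b := fresh in let c := fresh in
  have [a b c] := gt0s; apply: (@odd_logn_nonsquare s);
  rewrite ?lognM ?muln_gt0 ?a ?b ?c // ?lognE ?logn1.

Lemma rdE : rd = r1 * r2.
Proof. by rewrite -mulnA natrM sqrtCM // qualifE /= ler0n. Qed.

Lemma r1K : r1 ^+ 2 = p1%:R. Proof. exact: sqrtCK. Qed.
Lemma r2K : r2 ^+ 2 = (p2 * q)%N%:R. Proof. exact: sqrtCK. Qed.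

Lemma r1_neq0 : r1 != 0. Proof. by rewrite sqrtC_eq0 pnatr_eq0 -lt0n prime_gt0. Qed.

Let hF := Qi_subfield.
Let hk : subfield k := quad_Qi_subfield _.

Lemma k_p1 : k (r1 ^+ 2). Proof. by rewrite r1K; fld. Qed.
Let hL : subfield L := quad_subfield hk k_p1.

Lemma Qi_k : Qgauss `<=` k. Proof. exact: quad_base. Qed.
Lemma k_L : k `<=` L. Proof. exact: quad_base. Qed.
Lemma Qi_L : Qgauss `<=` L. Proof. by move=> x /Qi_k/k_L. Qed.
Lemma L_i : L 'i. Proof. by apply: Qi_L; apply: Qi_i. Qed.
Lemma L_r1 : L r1. Proof. exact: quad_gen. Qed.
Lemma L_rd : L rd. Proof. by apply: k_L; apply: quad_gen. Qed.
Lemma L_r2 : L r2.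
Proof.
have -> : r2 = rd / r1 by rewrite rdE mulrC mulKf // r1_neq0.
by have := L_rd; have := L_r1 => *; fld.
Qed.
Lemma quad1_L : quad Qgauss r1 `<=` L. Proof. by apply: quad_sub; [|apply: Qi_L|apply: L_r1]. Qed.
Lemma quad2_L : quad Qgauss r2 `<=` L. Proof. by apply: quad_sub; [|apply: Qi_L|apply: L_r2]. Qed.

Lemma L4 x : L x -> exists a b c e, [/\ Qgauss a, Qgauss b, Qgauss c, Qgauss e &
  x = a + b * r1 + c * r2 + e * (r1 * r2)].
Proof.
move=> [_ [_ [[a [b [Fa Fb ->]]] [c [e [Fc Fe ->]]] ->]]].
exists a, c, (e * p1%:R), b; split; fld.
by rewrite rdE; have := r1K; move: (r1) (r2) => R1 R2 <-; ring.
Qed.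

(** On [L], [tau] fixes Q(i, sqrt p1) and [sigma] below fixes [k]; together they generate the Galois
    group of L over Q(i). *)
Lemma tau_exists : exists tau : {rmorphism algC -> algC},
  [/\ tau 'i = 'i, tau r1 = r1 & tau r2 = - r2].
Proof.
have hS : subfield (quad Qgauss r1) := quad_Qi_subfield _.
have [|||tau [fix1 fix2]] := @aut_exists (quad Qgauss r1) [:: 'i; r1] r2 hS.
- by move=> t; rewrite !inE => /orP[]/eqP ->; [apply: quad_base => //; apply: Qi_i | apply: quad_gen].
- by apply: (quad_Qi_nonmem r2K r1K) => l; [nsqt q | nsqt p1 | nsqt q].
- by rewrite r2K rpred_nat.
by exists tau; split=> //; apply: fix1; rewrite !inE eqxx ?orbT.
Qed.

Lemma sigma_exists : exists sigma : {rmorphism algC -> algC},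
  [/\ sigma 'i = 'i, sigma r1 = - r1 & sigma r2 = - r2].
Proof.
have [|||sigma [fix1 fix2]] := @aut_exists k [:: 'i; rd] r1 hk.
- by move=> t; rewrite !inE => /orP[]/eqP ->; [apply: quad_base => //; apply: Qi_i | apply: quad_gen].
- by apply: (quad_Qi_nonmem r1K (sqrtCK _)) => l; [nsqt p1 | nsqt p1 | nsqt q].
- by rewrite r1K rpred_nat.
have fixd : sigma rd = rd by rewrite fix1 // !inE eqxx orbT.
exists sigma; split; [by rewrite fix1 ?inE ?eqxx | exact: fix2 |].
have -> : r2 = rd / r1 by rewrite rdE mulrC mulKf // r1_neq0.
by rewrite fmorph_div /= fixd fix2 invrN mulrN.
Qed.

Section WithAutomorphisms.
Variables (sigma tau : {rmorphism algC -> algC}).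
Hypotheses (sigma_i : sigma 'i = 'i) (sigma_r1 : sigma r1 = - r1) (sigma_r2 : sigma r2 = - r2).
Hypotheses (tau_i : tau 'i = 'i) (tau_r1 : tau r1 = r1) (tau_r2 : tau r2 = - r2).

Lemma aut_Qi (phi : {rmorphism algC -> algC}) x : phi 'i = 'i -> Qgauss x -> phi x = x.
Proof. by move=> hi [a [b [Qa Qb ->]]]; rewrite rmorphD rmorphM hi !(aut_Crat phi). Qed.

Let sQ x : Qgauss x -> sigma x = x. Proof. exact: aut_Qi. Qed.
Let tQ x : Qgauss x -> tau x = x. Proof. exact: aut_Qi. Qed.

Lemma sigma4 a b c e : Qgauss a -> Qgauss b -> Qgauss c -> Qgauss e ->
  sigma (a + b * r1 + c * r2 + e * (r1 * r2)) = a - b * r1 - c * r2 + e * (r1 * r2).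
Proof.
move=> Fa Fb Fc Fe; rewrite rmorph4 sigma_r1 sigma_r2.
by rewrite (sQ Fa) (sQ Fb) (sQ Fc) (sQ Fe); ring.
Qed.

Lemma tau4 a b c e : Qgauss a -> Qgauss b -> Qgauss c -> Qgauss e ->
  tau (a + b * r1 + c * r2 + e * (r1 * r2)) = a + b * r1 - c * r2 - e * (r1 * r2).
Proof.
move=> Fa Fb Fc Fe; rewrite rmorph4 tau_r1 tau_r2.
by rewrite (tQ Fa) (tQ Fb) (tQ Fc) (tQ Fe); ring.
Qed.

Lemma L4_mem a b c e : Qgauss a -> Qgauss b -> Qgauss c -> Qgauss e ->
  L (a + b * r1 + c * r2 + e * (r1 * r2)).
Proof.
move=> /Qi_L ? /Qi_L ? /Qi_L ? /Qi_L ?.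
by have ? := L_r1; have ? := L_r2; fld.
Qed.

Lemma sigma_L x : L x -> L (sigma x).
Proof.
move=> /L4[a [b [c [e [Fa Fb Fc Fe ->]]]]]; rewrite sigma4 //.
by have ? := L_r1; have ? := L_r2; move: (Qi_L Fa) (Qi_L Fb) (Qi_L Fc) (Qi_L Fe) => *; fld.
Qed.

Lemma tau_L x : L x -> L (tau x).
Proof.
move=> /L4[a [b [c [e [Fa Fb Fc Fe ->]]]]]; rewrite tau4 //.
by have ? := L_r1; have ? := L_r2; move: (Qi_L Fa) (Qi_L Fb) (Qi_L Fc) (Qi_L Fe) => *; fld.
Qed.

Lemma sigma_k x : k x -> sigma x = x.
Proof.
move=> [a [b [Fa Fb ->]]]; rewrite rdE rmorphD (rmorphM _ b) (rmorphM _ r1) sigma_r1 sigma_r2.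
by rewrite (sQ Fa) (sQ Fb) mulrNN.
Qed.

Lemma tau_rd : tau rd = - rd.
Proof. by rewrite rdE (rmorphM _ r1) tau_r1 tau_r2 mulrN. Qed.

Lemma sigma_invol x : L x -> sigma (sigma x) = x.
Proof.
move=> /L4[a [b [c [e [Fa Fb Fc Fe ->]]]]]; rewrite !rmorph4 !(sQ Fa, sQ Fb, sQ Fc, sQ Fe).
by rewrite sigma_r1 sigma_r2 !rmorphN /= sigma_r1 sigma_r2 !opprK.
Qed.

Lemma tau_invol x : L x -> tau (tau x) = x.
Proof.
move=> /L4[a [b [c [e [Fa Fb Fc Fe ->]]]]]; rewrite !rmorph4 !(tQ Fa, tQ Fb, tQ Fc, tQ Fe).
by rewrite tau_r1 tau_r2 rmorphN /= tau_r1 tau_r2 !opprK.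
Qed.

Lemma sigma_tau x : L x -> sigma (tau x) = tau (sigma x).
Proof.
move=> /L4[a [b [c [e [Fa Fb Fc Fe ->]]]]].
rewrite !rmorph4 !(sQ Fa, sQ Fb, sQ Fc, sQ Fe, tQ Fa, tQ Fb, tQ Fc, tQ Fe).
by rewrite sigma_r1 sigma_r2 tau_r1 tau_r2 !rmorphN /= sigma_r1 sigma_r2 tau_r1 tau_r2.
Qed.

(** Applied to x and its image: in the mean the coordinates with changed sign cancel, so no linear
    independence of the basis is needed. *)
Lemma half2 (x y : algC) : x = y -> x = (x + y) / 2.
Proof. by move=> ->; field. Qed.

Lemma sigma_fix x : L x -> sigma x = x -> k x.
Proof.
move=> /L4[a [b [c [e [Fa Fb Fc Fe ->]]]]] /esym/half2 ->; rewrite sigma4 //.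
by exists a, e; split=> //; rewrite rdE; field.
Qed.

Lemma tau_fix x : L x -> tau x = x -> quad Qgauss r1 x.
Proof.
move=> /L4[a [b [c [e [Fa Fb Fc Fe ->]]]]] /esym/half2 ->; rewrite tau4 //.
by exists a, b; split=> //; field.
Qed.

Lemma sigma_tau_fix x : L x -> sigma (tau x) = x -> quad Qgauss r2 x.
Proof.
move=> /L4[a [b [c [e [Fa Fb Fc Fe ->]]]]] /esym/half2 ->.
exists a, c; split=> //; rewrite sigma_tau; last exact: L4_mem.
rewrite sigma4 // !(rmorphB, rmorphD) (rmorphM _ b) (rmorphM _ c) (rmorphM _ e) (rmorphM _ r1) tau_r1 tau_r2.
by rewrite (tQ Fa) (tQ Fb) (tQ Fc) (tQ Fe); field.
Qed.

Lemma both_fix x : L x -> sigma x = x -> tau x = x -> Qgauss x.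
Proof.
move=> Lx sx /(tau_fix Lx) [a [b [Fa Fb Dx]]].
have := half2 (esym sx); rewrite Dx rmorphD (rmorphM _ b) sigma_r1 (sQ Fa) (sQ Fb) => ->.
by have -> : (a + b * r1 + (a + b * - r1)) / 2 = a by field.
Qed.

Lemma conj_Qi x : Qgauss x -> Qgauss (x^*).
Proof.
move=> [a [b [Qa Qb ->]]]; exists a, (- b); split; [by [] | by apply: (sfN QQ_subfield) |].
by rewrite rmorphD rmorphM /= conjCi (conj_Crat Qa) (conj_Crat Qb); ring.
Qed.

Lemma conj_r1 : r1^* = r1. Proof. exact: conj_r. Qed.
Lemma conj_r2 : r2^* = r2. Proof. exact: conj_r. Qed.

Lemma conj4 a b c e : (a + b * r1 + c * r2 + e * (r1 * r2))^* =
  a^* + b^* * r1 + c^* * r2 + e^* * (r1 * r2).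
Proof. by rewrite rmorph4 /= conj_r1 conj_r2. Qed.

Lemma conj_L x : L x -> L (x^*).
Proof.
move=> /L4[a [b [c [e [Fa Fb Fc Fe ->]]]]]; rewrite conj4.
by apply: L4_mem; apply: conj_Qi.
Qed.

Lemma sigma_conj x : L x -> sigma (x^*) = (sigma x)^*.
Proof.
move=> /L4[a [b [c [e [Fa Fb Fc Fe ->]]]]].
rewrite conj4 !sigma4; try by [|apply: conj_Qi].
by rewrite !(rmorphB, rmorphD) (rmorphM _ b) (rmorphM _ c) (rmorphM _ e) (rmorphM _ r1) /= conj_r1 conj_r2.
Qed.

Lemma sqr_sign (phi : {rmorphism algC -> algC}) z : phi (z ^+ 2) = z ^+ 2 -> phi z = z \/ phi z = - z.
Proof. by move/eqP; rewrite rmorphXn eqf_sqr => /orP[]/eqP; [left | right]. Qed.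

(* Kummer theory: an element of Q(i) that is a square in L becomes a square in
   Q(i) after multiplication by 1, p1, p2 q or p1 p2 q. *)
Lemma kummer_L z (N j : nat) : L z -> z ^+ 2 = 'i ^+ j * N%:R ->
  exists t n, t \in [:: 1; p1; p2 * q; p1 * (p2 * q)]%N /\
    ((if odd j then 2 * (N * t) else N * t) = n ^ 2)%N.
Proof.
move=> Lz z2; have ? := L_r1; have ? := L_r2.
have Fz2 : Qgauss (z ^+ 2) by rewrite z2; have ? := Qi_i; fld.
(* The signs of z under [sigma] and [tau] are those of one of 1, r1, r2, r1 r2; its product with z
   is fixed by both. *)
have main s t : L s -> s ^+ 2 = t%:R -> sigma (z * s) = z * s -> tau (z * s) = z * s ->
    t \in [:: 1; p1; p2 * q; p1 * (p2 * q)]%N -> 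
    exists t n, t \in [:: 1; p1; p2 * q; p1 * (p2 * q)]%N /\
    ((if odd j then 2 * (N * t) else N * t) = n ^ 2)%N.
  move=> Ls s2 sz tz tin; have Fzs : Qgauss (z * s) by apply: both_fix => //; fld.
  have [|n Dn] := @kummer_Qi (z * s) (N * t) j Fzs; last by exists t, n.
  by rewrite exprMn z2 s2 natrM mulrA.
have [sz|sz] := sqr_sign (sQ Fz2); have [tz|tz] := sqr_sign (tQ Fz2).
- by apply: (main 1 1%N); rewrite ?mulr1 ?expr1n ?inE //; fld.
- apply: (main (r1 * r2) (p1 * (p2 * q))%N); rewrite ?inE ?eqxx ?orbT //; first by fld.
  + by rewrite exprMn r1K r2K -natrM.
  + by rewrite (rmorphM _ z) (rmorphM _ r1) sz sigma_r1 sigma_r2 mulrNN.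
  + by rewrite (rmorphM _ z) (rmorphM _ r1) tz tau_r1 tau_r2 mulrN mulrNN.
- apply: (main r1 p1); rewrite ?inE ?eqxx ?orbT //; first by rewrite r1K.
  + by rewrite rmorphM sz sigma_r1 mulrNN.
  + by rewrite rmorphM tz tau_r1.
- apply: (main r2 (p2 * q)%N); rewrite ?inE ?eqxx ?orbT //; first by rewrite r2K.
  + by rewrite rmorphM sz sigma_r2 mulrNN.
  + by rewrite rmorphM tz tau_r2 mulrNN.
Qed.

(** [L] has no primitive eighth root of unity: twice an odd number is not a square, so an odd power
    of i has no root in [L]. *)
Lemma sqrt_i_L z j : L z -> z ^+ 2 = 'i ^+ j -> exists l, z = 'i ^+ l.
Proof.
move=> Lz z2; apply: fourth_root_1; have [|t [n [tin Dn]]] := @kummer_L z 1 j Lz.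
  by rewrite mulr1.
have oj : ~~ odd j.
  apply/negP => oj; rewrite oj mul1n in Dn; move: Dn.
  by move: tin; rewrite !inE => /or4P[]/eqP ->; nsqt 2%N.
rewrite -[4%N]/(2 * 2)%N exprM z2 -[j]odd_double_half (negPf oj) add0n -mul2n exprM sqrCi.
by rewrite -exprM mulnC exprM sqrrN !expr1n.
Qed.

Lemma sqrt_i_odd z j : L z -> odd j -> z ^+ 2 <> 'i ^+ j.
Proof.
move=> Lz oj z2; have [|t [n [tin Dn]]] := @kummer_L z 1 j Lz; first by rewrite mulr1.
rewrite oj mul1n in Dn; move: Dn.
by move: tin; rewrite !inE => /or4P[]/eqP ->; nsqt 2%N.
Qed.

Lemma sqrt_ip2 z j : L z -> z ^+ 2 <> 'i ^+ j * p2%:R.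
Proof.
move=> Lz z2; have [t [n [tin Dn]]] := kummer_L Lz z2; move: Dn; case: ifP => oj.
  by move: tin; rewrite !inE => /or4P[]/eqP ->; nsqt 2%N.
by move: tin; rewrite !inE => /or4P[]/eqP ->; [nsqt p2 | nsqt p2 | nsqt q | nsqt q].
Qed.

(** * Units of L of relative norm 1 *)

Section Units.
Variables (a b : int) (e f : nat).
Local Notation eps := (a%:~R + b%:~R * r2 : algC).
Local Notation pi1 := (e%:R + 2 * 'i * f%:R : algC).
Hypothesis feps : fundamental_unit (quad QQ r2) eps.
Hypothesis p1ef : p1 = (e ^ 2 + 4 * f ^ 2)%N.

Lemma p2q_mod4 : (p2 * q %% 4 = 3)%N.
Proof. by rewrite -modnMm p24 q4. Qed.

Lemma eps_facts : [/\ a ^+ 2 - (p2 * q)%N%:Z * b ^+ 2 = 1, 1 < a,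
  eps * sigma eps = 1 & eps * tau eps = 1].
Proof.
have [E a1 s1] := fundamental_norm p2q_mod4 sigma_r2 feps.
by have [_ _ t1] := fundamental_norm p2q_mod4 tau_r2 feps.
Qed.

Lemma eps_neq0 : eps != 0. Proof. by case: feps => -[]. Qed.
Lemma eps_L : L eps.
Proof. by have ? := L_r2; fld. Qed.
Lemma eps_conj : eps^* = eps.
Proof. by have [[_ [Qe _] _] _ _] := feps; apply: quad_real_conj Qe. Qed.

Lemma r1_real_L : quad QQ r1 `<=` L.
Proof. by move=> x /quad_real_Qi/quad1_L. Qed.

Lemma tau_real1 x : quad QQ r1 x -> tau x = x.
Proof. by move=> [c [d [Qc Qd ->]]]; rewrite rmorphD (rmorphM _ d) tau_r1 !(aut_Crat tau). Qed.

(** By [cm_unit] the square of each of the two norms is a power of i times a totally positive real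
    unit: a square in Q(r1), a power of [eps] in Q(r2). *)
Lemma unit_pow4 u : integral_unit L u -> u * sigma u = 1 ->
  exists j w n, integral_unit (quad QQ r1) w /\ u ^+ 4 = 'i ^+ j * w ^+ 2 * eps ^ n.
Proof.
move=> hu Nu; have [u0 [Lu Au] [_ AuV]] := hu.
have hs : integral_unit L (sigma u) by apply: iu_morph hu; apply: sigma_L.
have ht : integral_unit L (tau u) by apply: iu_morph hu; apply: tau_L.
have restrict F v : subfield F -> F v -> integral_unit L v -> integral_unit F v.
  by move=> hF' Fv [v0 [_ Av] [_ AvV]]; split=> //; split=> //; fld.
have Lsu := sigma_L Lu; have Ltu := tau_L Lu.
have hv1 : integral_unit (quad Qgauss r1) (u * tau u).
  apply: restrict; [exact: quad_Qi_subfield | | exact: iuM].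
  by apply: tau_fix; [fld | rewrite rmorphM /= tau_invol // mulrC].
have hv2 : integral_unit (quad Qgauss r2) (sigma u * tau u).
  apply: restrict; [exact: quad_Qi_subfield | | exact: iuM].
  apply: sigma_tau_fix; first by fld.
  rewrite (rmorphM tau) (rmorphM sigma) /= tau_invol // -sigma_tau // sigma_invol; last exact: tau_L.
  by rewrite mulrC.
have nsq1 n : (3 * p1 <> n ^ 2)%N.
  have [g1 _ _] := gt0s; apply: (@odd_logn_nonsquare p1); rewrite lognM // lognE.
  rewrite logn_prime // (_ : (p1 == 3) = false) //; apply/eqP => h; by move: p14; rewrite h.
have nsq2 n : (3 * (p2 * q) <> n ^ 2)%N.
  have [_ g1 g2] := gt0s; apply: (@odd_logn_nonsquare p2); rewrite !lognM ?muln_gt0 ?g1 // !lognE.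
  rewrite logn_prime // (_ : (p2 == 3) = false) //; apply/eqP => h; by move: p24; rewrite h.
have [g1 g2 g3] := gt0s; have g23 : (0 < p2 * q)%N by rewrite muln_gt0 g2.
have [[j1 D1] hw1 w10 w11] := cm_unit g1 nsq1 sigma_i sigma_r1 hv1.
have [[j2 D2] hw2 w20 w21] := cm_unit g23 nsq2 sigma_i sigma_r2 hv2.
have [w Qw Dw] := totpos_sqr pr1 p14 sigma_r1 hw1 w10 w11.
have [n Dn] := fundamental_pos (quad_real_subfield _) feps hw2 w20.
exists (j1 + j2 * 3)%N, w, (- n); split.
  by apply: (iu_sqr (quad_real_subfield _)) => //; rewrite -Dw.
have v20 : sigma u * tau u != 0 by case: hv2.
have e4 := i_exp4 j2; have ij2 := i_exp_neq0 j2.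
(* Multiplying numerator and denominator by [tau u] and using u sigma u = 1 makes u^2 a quotient of
   a unit of Q(i, r1) by one of Q(i, r2). *)
have Du : u ^+ 2 = (u * tau u) / (sigma u * tau u).
  apply: (mulIf v20); rewrite divfK //.
  by transitivity (u * sigma u * (u * tau u)); [ring | rewrite Nu mul1r].
rewrite -[4%N]/(2 * 2)%N exprM Du exprMn exprVn D1 D2 Dw Dn -invr_expz exprD exprM.
have en0 : eps ^ n != 0 by apply: expfz_neq0; apply: eps_neq0.
move: ('i ^+ j2 : algC) e4 ij2 (eps ^ n) en0 => I I4 I0 X X0.
have -> : I ^+ 3 = I^-1 by apply: (mulIf I0); rewrite mulVf // -exprSr.
by field; rewrite I0 X0.
Qed.

(** The boolean [t] says which of the two possible square classes [eps] has in Q(i, r2), and [z] is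
    the corresponding root. *)
Variables (t : bool) (z : algC) (lz : nat).
Hypotheses (Qz : quad Qgauss r2 z) (z0 : z != 0).
Hypothesis eps_t : if t then eps = 'i * z ^+ 2 else p2%:R * eps = 'i ^+ lz * z ^+ 2.

Lemma int_half (n : int) : exists m : int, n = m + m \/ n = m + m + 1.
Proof. by exists (n %/ 2)%Z; lia. Qed.

(** For even n the quotient u / (w eps^m) is a root of a power of i. For odd n the remaining [eps]
    contributes [z] when [t] holds; otherwise a power of i times p2 would be a square in [L]. *)
Lemma root_step u w j (n : int) : L u -> L w -> w != 0 ->
  u ^+ 2 = 'i ^+ j * w ^+ 2 * eps ^ n ->
  exists l (m : int), u = 'i ^+ l * w * eps ^ m \/ t /\ u = 'i ^+ l * w * eps ^ m * z.
Proof.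
move=> Lu Lw w0 Eu; have e0 := eps_neq0; have Le := eps_L; have Lz := quad2_L Qz.
have [m hm] := int_half n; have em0 := expfz_neq0 m e0.
have p20 : p2%:R != 0 :> algC by rewrite pnatr_eq0 -lt0n; have [] := gt0s.
case: hm => hm; rewrite hm in Eu.
  have [||l Dl] := @sqrt_i_L (u / (w * eps ^ m)) j => //; first by fld.
    by rewrite exprMn exprVn Eu expfzDr //; field; rewrite em0 w0.
  by exists l, m; left; rewrite -mulrA -Dl divfK // mulf_neq0.
rewrite !expfzDr // expr1z in Eu.
case: (t) eps_t => De.
  have [||l Dl] := @sqrt_i_L (u / (w * eps ^ m * z)) j.+1 => //; first by fld.
    rewrite exprMn exprVn Eu; have -> : eps ^ m * eps ^ m * eps = eps ^ m * eps ^ m * ('i * z ^+ 2).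
      by rewrite -De.
    by rewrite ['i ^+ j.+1]exprS; field; rewrite em0 w0 z0.
  by exists l, m; right; split=> //; rewrite -!mulrA [w * _]mulrA -Dl divfK // !mulf_neq0.
exfalso; apply: (@sqrt_ip2 (u * p2%:R / (w * eps ^ m * z)) (j + lz)) => //.
  by fld.
rewrite exprMn exprVn exprMn Eu exprD.
have -> : eps ^ m * eps ^ m * eps = eps ^ m * eps ^ m * ('i ^+ lz * z ^+ 2 / p2%:R).
  by congr (_ * _); rewrite -De [RHS]mulrC mulKf.
by field; rewrite em0 w0 z0 p20.
Qed.

Lemma z_norm (phi : {rmorphism algC -> algC}) : phi 'i = 'i -> eps * phi eps = 1 -> t ->
  (z * phi z) ^+ 2 = -1.
Proof.
move=> pi_i pe tt; have De : eps = 'i * z ^+ 2 by move: eps_t; rewrite tt.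
have Dp : phi eps = 'i * (phi z) ^+ 2 by rewrite De rmorphM rmorphXn pi_i.
have h : 'i ^+ 2 * (z * phi z) ^+ 2 = 1 by rewrite -pe Dp De; ring.
by rewrite -h sqrCi mulN1r opprK.
Qed.

(** [root_step] is applied to u^2 and then to u. In between, w must be a square up to a power of i,
    which requires it to have norm 1. *)
Lemma unit_shape u : integral_unit L u -> u * sigma u = 1 ->
  exists j w (m : int), integral_unit (quad QQ r1) w /\ u = 'i ^+ j * w * eps ^ m.
Proof.
move=> hu Nu; have [u0 [Lu _] _] := hu; have [_ _ Ns Nt] := eps_facts.
have e0 := eps_neq0; have Le := eps_L; have Li := L_i; have Lz := quad2_L Qz.
have Lsu := sigma_L Lu; have Ltu := tau_L Lu.
have N1 (phi : {rmorphism algC -> algC}) (m : int) : eps * phi eps = 1 -> eps ^ m * phi (eps ^ m) = 1.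
  by move=> h; rewrite fmorphXz -expfzMl h exp1rz.
have [j [w [n [hw E4]]]] := unit_pow4 hu Nu.
have [w0 [Qw _] _] := hw; have Lw := r1_real_L Qw.
have wn0 : w ^+ 2 != 0 by rewrite expf_neq0.
have [||l [m [D2|[tt D2]]]] := @root_step (u ^+ 2) w j n _ Lw w0; first by fld.
- by rewrite -exprM.
- (* comparing absolute values shows that w has norm 1 *)
  have Lw' : L (u * u^*) by have := conj_L Lu => ?; fld.
  have i1 : 'i ^+ l * ('i ^+ l)^* = 1 :> algC.
    by rewrite rmorphXn /= conjCi -exprMn mulrN mulCii opprK expr1n.
  have D1 : (u * u^*) ^+ 2 = (w * eps ^ m) ^+ 2.
    transitivity (u ^+ 2 * (u ^+ 2)^*); first by rewrite rmorphXn; ring.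
    rewrite D2 (rmorphM _ ('i ^+ l * w)) (rmorphM _ ('i ^+ l)) /= (quad_real_conj Qw) fmorphXz /= eps_conj.
    move: ('i ^+ l) (('i ^+ l)^*) i1 => I I' i1; move: (eps ^ m) => X.
    by transitivity (I * I' * (w * X) ^+ 2); [ring | rewrite i1 mul1r].
  have NN : (u * u^*) * sigma (u * u^*) = 1.
    transitivity ((u * sigma u) * (u * sigma u)^*); last by rewrite Nu rmorph1 mulr1.
    by rewrite !rmorphM /= sigma_conj //; ring.
  have Nw : w * sigma w = 1.
    have : (w * eps ^ m) * sigma (w * eps ^ m) = 1.
      move/eqP: D1; rewrite eqf_sqr -[RHS]NN => /orP[]/eqP -> //.
      by rewrite rmorphN mulrNN.
    by rewrite (rmorphM _ w) mulrACA N1 // mulr1.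
  have [j' [w1 [hw1 Dw1]]] := norm1_sqr pr1 p14 sigma_r1 hw Nw.
  have [w10 [Qw1 _] _] := hw1.
  have [|l' [m' [Du|[tt Du]]]] := @root_step u w1 (l + j') m Lu (r1_real_L Qw1) w10.
  + by rewrite D2 Dw1 exprD; ring.
  + by exists l', w1, m'.
  (* Every factor of u other than [z] has a relative norm of square 1, while that of [z] has square
     -1. *)
  + exfalso; have := congr1 (fun v => v ^+ 2) Nu.
    have Nz := z_norm sigma_i Ns tt.
    have Nw1 : (w1 * sigma w1) ^+ 2 = 1.
      by have [->|->] := quad_real_unit_norm sigma_r1 hw1; rewrite ?sqrrN expr1n.
    have i4 := i_exp4 l'.
    have em := N1 sigma m' Ns.
    move: (eps ^ m') em Du => X em ->; rewrite !rmorphM /= rmorphXn /= sigma_i.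
    move: (sigma X) em => X' em.
    move: ('i ^+ l') i4 => I i4.
    have -> : (I * w1 * X * z * (I * sigma w1 * X' * sigma z)) ^+ 2 =
      I ^+ 4 * (w1 * sigma w1) ^+ 2 * (X * X') ^+ 2 * (z * sigma z) ^+ 2 by ring.
    rewrite i4 Nw1 em Nz expr1n !mul1r => /eqP.
    by rewrite eq_sym -addr_eq0 -[1 + 1]/(2%:R) pnatr_eq0.
- (* the factor z is excluded by taking norms to Q(i, r1) *)
  exfalso; have Nz := z_norm tau_i Nt tt; have em := N1 tau m Nt.
  have [l' ol' Dz] : exists2 l', odd l' & z * tau z = 'i ^+ l'.
    move/eqP: Nz; rewrite -(sqrCi algC) eqf_sqr => /orP[]/eqP ->; first by exists 1%N.
    by exists 3%N; rewrite // !exprS expr0 mulr1 mulCii mulrN1.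
  apply: (@sqrt_i_odd (u * tau u / w) (l * 2 + l')); first by fld.
    by rewrite oddD oddM andbF.
  have -> : (u * tau u / w) ^+ 2 = u ^+ 2 * tau (u ^+ 2) / w ^+ 2 by rewrite rmorphXn; field.
  move: (eps ^ m) em D2 => X em ->.
  rewrite !rmorphM /= rmorphXn /= tau_i (tau_real1 Qw) exprD exprM -Dz.
  move: (tau X) em => X' em.
  transitivity (('i ^+ l) ^+ 2 * (X * X') * (z * tau z)); first by field.
  by rewrite em mulr1.
Qed.

Lemma unit_class u : integral_unit L u -> u * sigma u = 1 ->
  exists j m n kappa, [/\ L kappa, kappa != 0, t -> n = 0%N &
    u = 'i ^+ j * pi1 ^+ m * p2%:R ^+ n * kappa ^+ 2].
Proof.
move=> hu Nu; have [j [w [m [hw Du]]]] := unit_shape hu Nu.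
have e0 := eps_neq0; have Le := eps_L; have Li := L_i; have Lz := quad2_L Qz.
have pi0 : pi1 != 0 by apply: (@pi1_neq0 p1).
have Lpi : L pi1 by fld.
have p20 : p2%:R != 0 :> algC by rewrite pnatr_eq0 -lt0n; have [] := gt0s.
have [w0 [Qw _] _] := hw.
have [j1 [m1 [k1 [Lk1 k10 Dw]]]] : exists j m k, [/\ L k, k != 0 & w = 'i ^+ j * pi1 ^+ m * k ^+ 2].
  have [Nw|Nw] := quad_real_unit_norm sigma_r1 hw.
    have [j1 [k [[k0 [Qk _] _] ->]]] := norm1_sqr pr1 p14 sigma_r1 hw Nw.
    by exists j1, 0%N, k; rewrite mulr1; split=> //; apply: r1_real_L.
  have [j1 [k [Qk k0 Dk]]] := pi1_neg_unit pr1 p14 sigma_r1 p1ef hw Nw.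
  have Lk := quad1_L Qk; exists j1, 1%N, (k / pi1); split; first by fld.
    by rewrite mulf_neq0 ?invr_eq0.
  apply: (mulfI pi0); rewrite Dk; move: (pi1) pi0 => P P0; by field.
have [j2 [n [k2 [Lk2 k20 tn De]]]] : exists j n k, [/\ L k, k != 0, t -> n = 0%N &
    eps ^ m = 'i ^+ j * p2%:R ^+ n * k ^+ 2].
  have [h hm] := int_half m; have eh0 := expfz_neq0 h e0; case: hm => hm; rewrite hm.
    exists 0%N, 0%N, (eps ^ h); split=> //; first by fld.
    by rewrite expfzDr // !mul1r.
  rewrite !expfzDr // expr1z; case: (t) eps_t => Dt.
    exists 1%N, 0%N, (eps ^ h * z); split=> //; first by fld.
      by rewrite mulf_neq0.
    rewrite [X in _ * X = _]Dt; ring.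
  exists lz, 1%N, (eps ^ h * z / p2%:R); split=> //; first by fld.
    by rewrite !mulf_neq0 ?invr_eq0.
  have -> : eps ^ h * eps ^ h * eps = eps ^ h * eps ^ h * ('i ^+ lz * z ^+ 2 / p2%:R).
    by congr (_ * _); rewrite -Dt [RHS]mulrC mulKf.
  by field.
exists (j + j1 + j2)%N, m1, n, (k1 * k2); split=> //; first by fld.
  exact: mulf_neq0.
by rewrite Du Dw De !exprD; ring.
Qed.
End Units.

(** Expand the product of the Bezout identities for (p, 2e) and (p, N) with p = P P' and 2e = P +
    P': every term except v v' P' N is a multiple of P. *)
Lemma gauss_bezout (p e N : nat) (P P' : algC) : OO Qgauss P -> OO Qgauss P' ->
  P + P' = (2 * e)%:R -> P * P' = p%:R -> coprime p (2 * e) -> coprime p N ->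
  exists a b, [/\ OO Qgauss a, OO Qgauss b & 1 = a * P + b * (P' * N%:R)].
Proof.
move=> OP OP' trP nP cop1 cop2.
have bez n : coprime p n -> exists u v : int, u%:~R * p%:R + v%:~R * n%:R = 1 :> algC.
  move=> cop; have : coprimez p n by [].
  by case/coprimezP=> -[u v] /= E; exists u, v; rewrite -[p%:R]/(p%:Z%:~R) -[n%:R]/(n%:Z%:~R) -!rmorphM -rmorphD /= E.
have [u [v E1]] := bez _ cop1; have [u' [v' E2]] := bez _ cop2.
have Ou (n : int) : OO Qgauss n%:~R by apply: OO_int.
have ON : OO Qgauss N%:R by apply: OO_nat.
exists ((v%:~R + u%:~R * P') * (u'%:~R * p%:R + v'%:~R * N%:R) + v%:~R * u'%:~R * P' ^+ 2), (v%:~R * v'%:~R).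
split; last first.
- rewrite -[LHS]mulr1 -[X in X * _]E1 -[X in _ * X]E2 -trP -nP; ring.
- exact: OOM.
- by rewrite E2 mulr1; apply: OOD => //; [apply: OOD => //; apply: OOM | apply: OOM => //; [apply: OOM | apply: OOX]].
Qed.

Lemma gauss_coprime (p e f : nat) : prime p -> p = (e ^ 2 + 4 * f ^ 2)%N -> coprime p (2 * e).
Proof.
move=> pr D; rewrite prime_coprime //; apply/negP; rewrite Euclid_dvdM //.
have e0 : (0 < e)%N.
  rewrite lt0n; apply/eqP => e0; move: pr; rewrite D e0 add0n -(expnMn 2 f 2).
  by move=> /prime_nonsquare/(_ (erefl _)).
have f0 : (0 < f)%N.
  rewrite lt0n; apply/eqP => f0; move: pr; rewrite D f0 muln0 addn0.
  by move=> /prime_nonsquare/(_ (erefl _)).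
have p5 : (4 < p)%N by rewrite D; nia.
case/orP=> /dvdn_leq; first by move/(_ isT); lia.
by move/(_ e0); rewrite D; nia.
Qed.

(** * The four ramified primes and the kernel *)

Section Kernel.
Variables (a b x y : int) (e f g h : nat) (H1 H2 H3 H4 : set algC).
Local Notation eps := (a%:~R + b%:~R * r2 : algC).
Local Notation epsd := (x%:~R + y%:~R * rd : algC).
Local Notation pi1 := (e%:R + 2 * 'i * f%:R : algC).
Local Notation pi2 := (e%:R - 2 * 'i * f%:R : algC).
Local Notation pi3 := (g%:R + 2 * 'i * h%:R : algC).
Local Notation pi4 := (g%:R - 2 * 'i * h%:R : algC).
Local Notation cl := (ideal_class k).
Local Notation kappa := (capitulation_kernel k L).
Hypothesis feps : fundamental_unit (quad QQ r2) eps.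
Hypothesis fepsd : fundamental_unit (quad QQ rd) epsd.
Hypotheses (p1ef : p1 = (e ^ 2 + 4 * f ^ 2)%N) (p2gh : p2 = (g ^ 2 + 4 * h ^ 2)%N).
Hypotheses (hH1 : prime_ideal_above Qgauss k pi1 H1) (hH2 : prime_ideal_above Qgauss k pi2 H2).
Hypotheses (hH3 : prime_ideal_above Qgauss k pi3 H3) (hH4 : prime_ideal_above Qgauss k pi4 H4).

Lemma gauss_OO (n : nat) (m : int) : OO Qgauss (n%:R + 2 * 'i * m%:~R).
Proof.
have Oi : OO Qgauss 'i by split; [apply: Qi_i | apply: Aint_i].
have O2 : OO Qgauss 2 by apply: OO_nat.
by apply: OOD; [|apply: OO_nat|apply: OOM => //; [apply: OOM | apply: OO_int]].
Qed.

Lemma gauss_OO2 (n m : nat) : OO Qgauss (n%:R + 2 * 'i * m%:R) /\ OO Qgauss (n%:R - 2 * 'i * m%:R).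
Proof.
split; first exact: (gauss_OO n m).
by have := gauss_OO n (- m%:Z); rewrite rmorphN mulrN.
Qed.

(** Since rd^2 = P (P' N), this is the ramified case with m = P' N. *)
Lemma ramified (p N e' f' : nat) (P P' : algC) H : prime p -> p = (e' ^ 2 + 4 * f' ^ 2)%N ->
  (p * N = p1 * p2 * q)%N -> coprime p N -> OO Qgauss P -> OO Qgauss P' ->
  P + P' = (2 * e')%:R -> P * P' = p%:R ->
  prime_ideal_above Qgauss k P H -> sqr_ideal k P H.
Proof.
move=> pr D pN cop OP OP' trP nP hH.
have [u [v [Ou Ov E]]] := gauss_bezout OP OP' trP nP (gauss_coprime pr D) cop.
have P0 : P != 0.
  apply/eqP => P0; move/eqP: nP; rewrite P0 mul0r eq_sym pnatr_eq0.
  by have := prime_gt0 pr; case: (p).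
apply: (sqr_ideal_ramified (tau := tau) hF _ tau_rd OP _ Ou Ov P0 _ E hH).
- by move=> z; apply: aut_Qi.
- by apply: OOM => //; apply: OO_nat.
- by rewrite sqrtCK mulrA nP -natrM pN.
Qed.

Lemma sqr_H1 : sqr_ideal k pi1 H1.
Proof.
have [O1 O2] := gauss_OO2 e f; apply: (ramified pr1 p1ef _ _ O1 O2 _ _ hH1).
- exact: mulnA.
- by rewrite coprimeMr !prime_coprime // !dvdn_prime2 // n12.
- by rewrite natrM; ring.
- exact: pi12.
Qed.

Lemma sqr_H2 : sqr_ideal k pi2 H2.
Proof.
have [O1 O2] := gauss_OO2 e f; apply: (ramified pr1 p1ef _ _ O2 O1 _ _ hH2).
- exact: mulnA.
- by rewrite coprimeMr !prime_coprime // !dvdn_prime2 // n12.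
- by rewrite natrM; ring.
- by rewrite mulrC; apply: pi12.
Qed.

Lemma sqr_H3 : sqr_ideal k pi3 H3.
Proof.
have [O1 O2] := gauss_OO2 g h; apply: (@ramified p2 (p1 * q) g h _ _ _ pr2 p2gh _ _ O1 O2 _ _ hH3).
- by rewrite mulnCA mulnA.
- by rewrite coprimeMr !prime_coprime // !dvdn_prime2 // eq_sym n12.
- by rewrite natrM; ring.
- exact: pi12.
Qed.

Lemma sqr_H4 : sqr_ideal k pi4 H4.
Proof.
have [O1 O2] := gauss_OO2 g h; apply: (@ramified p2 (p1 * q) g h _ _ _ pr2 p2gh _ _ O2 O1 _ _ hH4).
- by rewrite mulnCA mulnA.
- by rewrite coprimeMr !prime_coprime // !dvdn_prime2 // eq_sym n12.
- by rewrite natrM; ring.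
- by rewrite mulrC; apply: pi12.
Qed.

Lemma sqr_H12 : sqr_ideal k p1%:R (ideal_mul H1 H2).
Proof. by rewrite -(pi12 p1ef); apply: sqr_ideal_mul sqr_H1 sqr_H2. Qed.

Lemma sqr_H34 : sqr_ideal k p2%:R (ideal_mul H3 H4).
Proof. by rewrite -(pi12 p2gh); apply: sqr_ideal_mul sqr_H3 sqr_H4. Qed.

Let ker_sub : Cl_subgroup k kappa :=
  capitulation_kernel_subgroup hk hL k_L sigma_k sigma_L sigma_fix sigma_invol.

Lemma i_unit_k j : integral_unit k ('i ^+ j).
Proof. by apply: iuX => //; apply: iu_i => //; apply: Qi_k; apply: Qi_i. Qed.

Lemma i_unit_L j : integral_unit L ('i ^+ j).
Proof. exact: iuS k_L (i_unit_k j). Qed.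

Lemma kernel_H1_H2 : kappa (cl H1) /\ kappa (cl H2).
Proof.
have [w hw Nw] := neg_unit_exists pr1 p14 sigma_r1.
have [j [c [Qc c0 Dc]]] := pi1_neg_unit pr1 p14 sigma_r1 p1ef hw Nw.
have hwL : integral_unit L w := iuS r1_real_L hw.
have Lc := quad1_L Qc; have w0 : w != 0 by case: hw.
have P0 : pi1 != 0 by apply: (@pi1_neq0 p1).
have i0 := i_exp_neq0 j; have Lr1 := L_r1; have r10 := r1_neq0.
split.
  apply: (sqr_capitulation_kernel hk hL k_L sqr_H1 Lc).
  have -> : c ^+ 2 / pi1 = w * ('i ^+ j)^-1.
    by apply: (mulIf P0); rewrite divfK // [RHS]mulrAC [w * _]mulrC Dc mulrAC mulfV // mul1r.
  by apply: iuM => //; apply: iuV; apply: i_unit_L.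
(* As r1^2 = pi1 pi2, dividing r1 by the root [c] attached to pi1 gives an element whose square is
   pi2 times a unit. *)
have Lrc : L (r1 / c) by fld.
apply: (sqr_capitulation_kernel hk hL k_L sqr_H2 Lrc).
have P20 : pi2 != 0.
  by apply/eqP => h0; have := pi12 p1ef; rewrite h0 mulr0 => /esym/eqP; rewrite pnatr_eq0; have := prime_gt0 pr1; case: (p1).
have -> : (r1 / c) ^+ 2 / pi2 = 'i ^+ j * w^-1.
  rewrite exprMn exprVn r1K -(pi12 p1ef); apply: (mulIf w0); rewrite mulfVK //.
  transitivity (pi1 * w / c ^+ 2); first by move: (pi1) (pi2) P0 P20 => P P' *; field; rewrite c0.
  by rewrite Dc mulfK // expf_neq0.
by apply: iuM; [|apply: i_unit_L|apply: iuV].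
Qed.

Section EpsType.
Variables (t : bool) (z : algC) (lz : nat).
Hypotheses (Qz : quad Qgauss r2 z) (z0 : z != 0).
Hypothesis eps_t : if t then eps = 'i * z ^+ 2 else p2%:R * eps = 'i ^+ lz * z ^+ 2.

Lemma kernel_H34 : ~~ t -> kappa (cl (ideal_mul H3 H4)).
Proof.
move=> nt; have De : p2%:R * eps = 'i ^+ lz * z ^+ 2 by move: eps_t; rewrite (negPf nt).
apply: (sqr_capitulation_kernel hk hL k_L sqr_H34 (quad2_L Qz)).
have p20 : p2%:R != 0 :> algC by rewrite pnatr_eq0 -lt0n; have [] := gt0s.
have i0 := i_exp_neq0 lz.
have -> : z ^+ 2 / p2%:R = eps * ('i ^+ lz)^-1.
  by apply: (mulIf p20); rewrite divfK // [RHS]mulrAC [eps * _]mulrC De mulrAC mulfV // mul1r.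
apply: iuM => //; last by apply: iuV; apply: i_unit_L.
have [he _ _] := feps; apply: iuS he => v /quad_real_Qi; exact: quad2_L.
Qed.

(** With an arbitrary subgroup G, each case of the theorem reduces to the membership of at most
    three classes. *)
Lemma kernel_sub G : Cl_subgroup k G -> G (cl H1) -> G (cl (ideal_mul H1 H2)) ->
  (~~ t -> G (cl (ideal_mul H3 H4))) -> kappa `<=` G.
Proof.
move=> [_ G1 GM _] GH1 GH12 GH34 c.
move=> /(capitulation_kernel_sqr hk hL k_L sigma_k sigma_L sigma_fix sigma_invol).
move=> [I [be [eta [-> hI Leta eta0 [hu Nu]]]]].
have [j [m [n [ka [Lka ka0 tn Du]]]]] := unit_class feps p1ef Qz z0 eps_t hu Nu.
have [_ kbe be0 _] := hI; have P0 : pi1 != 0 by apply: (@pi1_neq0 p1).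
have p20 : p2%:R != 0 :> algC by rewrite pnatr_eq0 -lt0n; have [] := gt0s.
have p10 : p1%:R != 0 :> algC by rewrite pnatr_eq0 -lt0n; have [] := gt0s.
have ki : k 'i by apply: Qi_k; apply: Qi_i.
have kpi : k pi1 by fld.
have Lr1 := L_r1; have r10 := r1_neq0; have i0 := i_exp_neq0 j.
pose ga := eta / ka.
have Lga : L ga by rewrite /ga; fld.
have ga2 : ga ^+ 2 = be * 'i ^+ j * pi1 ^+ m * p2%:R ^+ n.
  have -> : ga ^+ 2 = (eta ^+ 2 / be) * be / ka ^+ 2 by rewrite /ga; field; rewrite be0 ka0.
  by rewrite Du; field.
(* Since ga^2 lies in [k], [sigma] sends ga to ga or -ga, so ga or ga r1 lies in [k]. The second
   alternative multiplies the square class by p1 and accounts for the class of H1 H2. *)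
have [l [de [kde Dde]]] : exists (l : bool) de, k de /\ de = ga * r1 ^+ l.
  have kga2 : k (ga ^+ 2) by rewrite ga2; fld.
  have [sg|sg] := sqr_sign (sigma_k kga2).
    by exists false, ga; rewrite mulr1; split=> //; apply: sigma_fix.
  exists true, (ga * r1); split=> //; apply: sigma_fix; first by fld.
  by rewrite (rmorphM _ ga) sg sigma_r1 mulrNN.
have Dbe : be * 'i ^+ j * pi1 ^+ m * p2%:R ^+ n * p1%:R ^+ l = de ^+ 2.
  by rewrite Dde exprMn ga2 -exprM mulnC exprM r1K.
(* Only the parities of the exponents matter; [pick] and [pickI] select in parallel a generator and
   the ideal whose square it generates. *)
pose pick (b : bool) (P : algC) : algC := if b then P else 1.
pose pickI (b : bool) (J : set algC) : set algC := if b then J else OO k.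
have sqr_pick (bb : bool) P J : sqr_ideal k P J -> sqr_ideal k (pick bb P) (pickI bb J).
  by case: bb => // _; apply: sqr_ideal_OO.
have G_pick (bb : bool) (J : set algC) : (bb -> G (cl J)) -> G (cl (pickI bb J)).
  by case: bb => [/(_ isT)|_].
have hJ := sqr_ideal_mul hk (sqr_pick (odd m) _ _ sqr_H1)
  (sqr_ideal_mul hk (sqr_pick (odd n) _ _ sqr_H34) (sqr_pick l _ _ sqr_H12)).
have powE (P : algC) r : P != 0 -> P ^+ r = pick (odd r) P * (P ^+ r./2) ^+ 2.
  by move=> Pn0; rewrite -{1}[r]odd_double_half exprD -mul2n mulnC exprM; case: (odd r).
have lE : p1%:R ^+ l = pick l p1%:R by case: (l).
pose D0 := pick (odd m) pi1 * (pick (odd n) p2%:R * pick l p1%:R).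
have D00 : D0 != 0 by case: hJ.
have kD0 : k D0 by case: hJ.
pose A0 := pi1 ^+ m./2; pose B0 := p2%:R ^+ n./2 : algC.
have A00 : A0 != 0 by rewrite expf_neq0.
have B00 : B0 != 0 by rewrite expf_neq0.
have -> : cl I = cl (ideal_mul (pickI (odd m) H1)
    (ideal_mul (pickI (odd n) (ideal_mul H3 H4)) (pickI l (ideal_mul H1 H2)))).
  apply: (sqr_ideal_class hk hI hJ (delta := de / (D0 * A0 * B0)) (u := ('i ^+ j)^-1)).
  - by rewrite /A0 /B0; fld.
  - by apply: iuV; apply: i_unit_k.
  - rewrite exprMn exprVn -Dbe (powE pi1) // (powE p2%:R) // lE -/A0 -/B0.
    have -> : be * 'i ^+ j * (pick (odd m) pi1 * A0 ^+ 2) * (pick (odd n) p2%:R * B0 ^+ 2) * pick l p1%:R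
      = be * 'i ^+ j * D0 * A0 ^+ 2 * B0 ^+ 2 by rewrite /D0; ring.
    rewrite -/D0; move: (D0) D00 (A0) A00 (B0) B00 => D D_0 A A_0 B B_0.
    by move: ('i ^+ j) i0 => II II0; field; rewrite II0 D_0 A_0 B_0.
rewrite -!Cl_mul_class //; apply: (GM); first exact: G_pick.
apply: GM; apply: G_pick => // on; apply: GH34; apply/negP => tt.
by move: on; rewrite tn.
Qed.
End EpsType.

Lemma pm1_square_nat (c d n : nat) (v : int) : 1 < v ->
  (c * d * `|v|.+1 = n ^ 2)%N \/ (c * d * `|v|.-1 = n ^ 2)%N -> pm1_square (c%:Z * d%:Z) v.
Proof.
move=> v1 [] E; [left | right]; exists n; rewrite -E PoszM PoszM; congr (_ * _); lia.
Qed.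

Lemma abs_pell (D : nat) (u v : int) : 1 < u -> u ^+ 2 - D%:Z * v ^+ 2 = 1 ->
  (`|u| ^ 2 = D * `|v| ^ 2 + 1)%N.
Proof.
move=> u1 E.
have hu : u ^+ 2 = (`|u| ^ 2)%N%:Z by rewrite -abszX gez0_abs ?sqr_ge0.
have hv : v ^+ 2 = (`|v| ^ 2)%N%:Z by rewrite -abszX gez0_abs ?sqr_ge0.
by move: E; rewrite hu hv => E; apply/eqP; rewrite -eqz_nat PoszD PoszM -[1%:Z]E addrC subrK.
Qed.

(** When neither a + 1 nor a - 1 is a square, [unit_type2] leaves d = p2 or else c = 2, d = 1, and
    the latter would make [eps] a square in Q(r2). *)
Lemma eps_cases :
  (pm1_square 1 a /\ exists2 z, quad Qgauss r2 z /\ z != 0 & eps = 'i * z ^+ 2) \/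
  (~ pm1_square 1 a /\ exists lz, exists2 z, quad Qgauss r2 z /\ z != 0 & p2%:R * eps = 'i ^+ lz * z ^+ 2).
Proof.
have [E a1 _ _] := eps_facts feps; have [_ n22 nq2] := neq2; have [_ g2 _] := gt0s.
have [sq|nsq] := pselect (pm1_square 1 a); [left | right]; split=> //.
  have [|z hz [Dz _]] := @eps_type (p2 * q) a b a1 E 1 1 isT isT; first by rewrite mulr1.
  by exists z => //; rewrite -[LHS]mul1r Dz.
have a1' : (1 < `|a|)%N by clear -a1; lia.
have [c [d [n [cin din Dn]]]] := unit_type2 pr2 prq n22 nq2 n2q a1' (abs_pell a1 E).
have sq := pm1_square_nat a1 Dn.
have d0 : (0 < d)%N by move: din; rewrite !inE => /orP[]/eqP ->.
have [z hz [Dz Qz]] := eps_type a1 E cin d0 sq.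
move: din; rewrite !inE => /orP[]/eqP de; last first.
  by rewrite de in Dz; exists (c == 1%N : nat), z => //; rewrite Dz; case: (c == 1%N).
exfalso; subst d; move: cin; rewrite !inE => /orP[]/eqP ce; subst c.
  by apply: nsq; rewrite mulr1 in sq.
apply: (fundamental_nonsquare (quad_real_subfield _) feps (Qz erefl erefl)).
by rewrite -[LHS]mul1r Dz mul1r.
Qed.

Lemma d_mod4 : (p1 * p2 * q %% 4 = 3)%N.
Proof. by rewrite -modnMm -[in X in (X * _)%N]modnMm p14 p24 q4. Qed.

(** As [epsd] and i are units of [k], the number d is a square up to a unit, which makes an ideal
    with square generated by d principal. *)
Lemma epsd_sqr (c d : nat) : c \in [:: 1; 2]%N -> (0 < d)%N -> pm1_square (c%:Z * d%:Z) x ->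
  exists z u, [/\ k z, z != 0, integral_unit k u & d%:R = z ^+ 2 * u].
Proof.
move=> cin d0 sq; have [E x1 _] := fundamental_norm d_mod4 tau_rd fepsd.
have [z [kz z0] [Dz _]] := eps_type x1 E cin d0 sq.
have [he _ _] := fepsd; have e0 : epsd != 0 by case: he.
have hek : integral_unit k epsd by apply: iuS he; apply: quad_real_Qi.
exists z, ('i ^+ (c == 1%N) / epsd); split=> //.
  by apply: iuM; [|apply: i_unit_k|apply: iuV].
apply: (mulIf e0); rewrite Dz -[RHS]mulrA divfK // [RHS]mulrC.
by case: (c == 1%N).
Qed.

Lemma epsd_cases : ~ pm1_square 1 x -> ~ (pm1_square p1%:Z x \/ pm1_square (2 * p1%:Z) x) ->
  exists c d, [/\ c \in [:: 1; 2]%N, d = p2 \/ d = q & pm1_square (c%:Z * d%:Z) x].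
Proof.
move=> n1 np1; have [E x1 _] := fundamental_norm d_mod4 tau_rd fepsd.
have [n12' n22 nq2] := neq2; have [g1 g2 g3] := gt0s.
have x1' : (1 < `|x|)%N by clear -x1; lia.
have [c [d [n [cin din Dn]]]] := unit_type3 pr1 pr2 prq n12' n22 nq2 n12 n1q n2q x1' (abs_pell x1 E).
have sq := pm1_square_nat x1 Dn.
move: din; rewrite !inE => /or4P[]/eqP de; subst d.
- exfalso; move: (cin); rewrite !inE => /orP[]/eqP ce; subst c.
    by apply: n1; rewrite mulr1 in sq.
  have [z hz [Dz Qz]] := eps_type x1 E cin (isT : (0 < 1)%N) sq.
  apply: (fundamental_nonsquare (quad_real_subfield _) fepsd (Qz erefl erefl)).
  by rewrite -[LHS]mul1r Dz mul1r.
- exfalso; apply: np1; move: cin; rewrite !inE => /orP[]/eqP ce; subst c; [left | right] => //.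
  by rewrite mul1r in sq.
- by exists c, p2; split=> //; left.
- by exists c, q; split=> //; right.
Qed.

Lemma H12_trivial : pm1_square p1%:Z x \/ pm1_square (2 * p1%:Z) x ->
  cl (ideal_mul H1 H2) = Cl_one k.
Proof.
have [g1 _ _] := gt0s; move=> sq.
have [z [u [kz z0 hu Du]]] : exists z u, [/\ k z, z != 0, integral_unit k u & p1%:R = z ^+ 2 * u].
  case: sq => sq; first by apply: (@epsd_sqr 1 p1) => //; rewrite mul1r.
  exact: (@epsd_sqr 2 p1).
by apply: (sqr_ideal_class hk sqr_H12 (sqr_ideal_OO hk) kz hu); rewrite mul1r.
Qed.

(** If d = p2, then p2 is trivial up to units and squares. If d = q, then p1 p2 q = rd^2 puts p2 in
    the class of p1. *)
Lemma H34_in_H12 c d : c \in [:: 1; 2]%N -> d = p2 \/ d = q -> pm1_square (c%:Z * d%:Z) x ->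
  cl (ideal_mul H3 H4) = Cl_one k \/ cl (ideal_mul H3 H4) = cl (ideal_mul H1 H2).
Proof.
have [g1 g2 g3] := gt0s; move=> cin dE sq.
have d0 : (0 < d)%N by case: dE => ->.
have [z [u [kz z0 hu Du]]] := epsd_sqr cin d0 sq.
case: dE => de; subst d; [left | right].
  by apply: (sqr_ideal_class hk sqr_H34 (sqr_ideal_OO hk) kz hu); rewrite mul1r.
have krd : k rd by apply: quad_gen.
have u0 : u != 0 by case: hu.
have p10 : p1%:R != 0 :> algC by rewrite pnatr_eq0 -lt0n.
apply: (sqr_ideal_class hk sqr_H34 sqr_H12 (delta := rd / (p1%:R * z)) _ (iuV hu)); first by fld.
have -> : (rd / (p1%:R * z)) ^+ 2 = rd ^+ 2 / (p1%:R * z) ^+ 2 by rewrite exprMn exprVn.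
by rewrite sqrtCK !natrM Du; field; rewrite u0 z0 p10.
Qed.

Lemma kappa_gen (S : set (set (set algC))) : S `<=` kappa ->
  (forall G, Cl_subgroup k G -> S `<=` G -> kappa `<=` G) -> kappa = Cl_gen k S.
Proof.
move=> Sk hS; apply/seteqP; split; last exact: Cl_gen_sub ker_sub Sk.
by move=> c hc G [hG SG]; apply: (hS G hG SG).
Qed.

Lemma kernel_cases :
  let a_sq := pm1_square 1 a in
  let x_sq := pm1_square 1 x in
  let p1x_sq := pm1_square p1%:Z x \/ pm1_square (2 * p1%:Z) x in
  let case1 := x_sq /\ ~ a_sq in
  let case2 := a_sq /\ p1x_sq in
  let case3 := ~ a_sq /\ p1x_sq in
  [/\ case1 -> kappa = Cl_gen k [set cl H1; cl H2; cl (ideal_mul H3 H4)],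
      case2 -> kappa = Cl_gen k [set cl H1],
      case3 -> kappa = Cl_gen k [set cl H1; cl (ideal_mul H3 H4)] &
      ~ case1 -> ~ case2 -> ~ case3 -> kappa = Cl_gen k [set cl H1; cl H2]].
Proof.
move=> a_sq x_sq p1x_sq; have [kH1 kH2] := kernel_H1_H2.
have G12 G : Cl_subgroup k G -> G (cl H1) -> G (cl H2) -> G (cl (ideal_mul H1 H2)).
  by move=> [_ _ GM _] h1 h2; rewrite -Cl_mul_class //; apply: GM.
have [[asq [z [Qz z0] De]]|[nasq [lz [z [Qz z0] De]]]] := eps_cases.
  have sub G := @kernel_sub true z 0 Qz z0 De G.
  split=> [[_ /(_ asq)]//|[_ p1x]|[/(_ asq)]//|_ n2 _].
  - apply: kappa_gen => [_ ->//|G hG SG]; apply: sub => //; first exact: SG.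
    by rewrite H12_trivial //; case: hG.
  - apply: kappa_gen => [_ [->|->]//|G hG SG].
    by apply: sub => //; [|apply: G12 => //]; apply: SG; [left|left|right].
have kH34 := @kernel_H34 false z lz Qz De isT.
have sub G := @kernel_sub false z lz Qz z0 De G.
split=> [_|[/nasq]//|[_ p1x]|n1 _ n3].
- apply: kappa_gen => [_ [[->|->]|->]//|G hG SG].
  apply: sub => // [||_]; [|apply: G12 => //|]; apply: SG;
    by [left; left | left; right | right].
- apply: kappa_gen => [_ [->|->]//|G hG SG].
  apply: sub => // [||_]; [by apply: SG; left | | by apply: SG; right].
  by rewrite H12_trivial //; case: hG.
- apply: kappa_gen => [_ [->|->]//|G hG SG].
  have g1 : G (cl H1) by apply: SG; left.
  have g2 : G (cl H2) by apply: SG; right.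
  apply: sub => // [|_]; first exact: G12.
  have [||c [d [cin dE sq]]] := epsd_cases.
  + by move=> xs; apply: n1.
  + by move=> p1x; apply: n3.
  have [->|->] := H34_in_H12 cin dE sq; first by case: hG.
  exact: G12.
Qed.
End Kernel.
End WithAutomorphisms.
End Biquadratic.

(** * From adjunctions to towers of quadratic extensions *)

Theorem theorem5p4 (p1 p2 q : nat) (a b x y : int) (e f g h : nat)
    (H1 H2 H3 H4 : set algC) :
  let Qi := Qadjoin [set 'i] in
  let k := Qadjoin [set sqrtC (p1 * p2 * q)%N%:R; 'i] in
  let K1 := Qadjoin (k `|` [set sqrtC p1%:R]) in
  prime p1 -> prime p2 -> prime q ->
  p1 <> p2 -> p1 <> q -> p2 <> q ->
  (p1%:Z = 1 %[mod 4])%Z -> (p2%:Z = 1 %[mod 4])%Z -> (- q%:Z = 1 %[mod 4])%Z ->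
  fundamental_unit (Qadjoin [set sqrtC (p2 * q)%N%:R])
    (a%:~R + b%:~R * sqrtC (p2 * q)%N%:R) ->
  fundamental_unit (Qadjoin [set sqrtC (p1 * p2 * q)%N%:R])
    (x%:~R + y%:~R * sqrtC (p1 * p2 * q)%N%:R) ->
  p1 = (e ^ 2 + 4 * f ^ 2)%N -> p2 = (g ^ 2 + 4 * h ^ 2)%N ->
  prime_ideal_above Qi k (e%:R + 2 * 'i * f%:R) H1 ->
  prime_ideal_above Qi k (e%:R - 2 * 'i * f%:R) H2 ->
  prime_ideal_above Qi k (g%:R + 2 * 'i * h%:R) H3 ->
  prime_ideal_above Qi k (g%:R - 2 * 'i * h%:R) H4 ->
  let a_sq := pm1_square 1 a in
  let x_sq := pm1_square 1 x in
  let p1x_sq := pm1_square p1%:Z x \/ pm1_square (2 * p1%:Z) x in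
  let case1 := x_sq /\ ~ a_sq in
  let case2 := a_sq /\ p1x_sq in
  let case3 := ~ a_sq /\ p1x_sq in
  let cl := ideal_class k in
  let kappa := capitulation_kernel k K1 in
  [/\ case1 -> kappa = Cl_gen k [set cl H1; cl H2; cl (ideal_mul H3 H4)],
      case2 -> kappa = Cl_gen k [set cl H1],
      case3 -> kappa = Cl_gen k [set cl H1; cl (ideal_mul H3 H4)] &
      ~ case1 -> ~ case2 -> ~ case3 -> kappa = Cl_gen k [set cl H1; cl H2]].
Proof.
have sq_nat (D : nat) : (sqrtC D%:R : algC) ^+ 2 \in Crat by rewrite sqrtCK rpred_nat.
have Qi_def : Qadjoin [set 'i] = quad QQ 'i by rewrite Qadjoin1 // sqrCi rpredN rpred1.
have hF := Qi_subfield.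
have k_def : Qadjoin [set sqrtC (p1 * p2 * q)%N%:R; 'i] = quad (quad QQ 'i) (sqrtC (p1 * p2 * q)%N%:R).
  by rewrite setUC Qadjoin_setU Qi_def //; apply: sf_rat.
have hk : subfield (quad (quad QQ 'i) (sqrtC (p1 * p2 * q)%N%:R)) by apply: quad_Qi_subfield.
have K_def : Qadjoin (quad (quad QQ 'i) (sqrtC (p1 * p2 * q)%N%:R) `|` [set sqrtC p1%:R]) =
    quad (quad (quad QQ 'i) (sqrtC (p1 * p2 * q)%N%:R)) (sqrtC p1%:R).
  by rewrite Qadjoin_setU Qadjoin_id //; apply: sf_rat.
rewrite /= k_def K_def Qi_def !Qadjoin1 //.
move=> pr1 pr2 prq /eqP n12 /eqP n1q /eqP n2q p14 p24 q4 fe fd p1ef p2gh hH1 hH2 hH3 hH4.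
have {}p14 : (p1 %% 4 = 1)%N by lia.
have {}p24 : (p2 %% 4 = 1)%N by lia.
have {}q4 : (q %% 4 = 3)%N by lia.
have [sigma [s1 s2 s3]] := sigma_exists pr1 pr2 prq p14 p24 q4 n12 n1q n2q.
have [tau [t1 t2 t3]] := tau_exists pr1 pr2 prq p14 p24 q4 n12 n1q n2q.
exact: (kernel_cases pr1 pr2 prq p14 p24 q4 n12 n1q n2q s1 s2 s3 t1 t2 t3
  fe fd p1ef p2gh hH1 hH2 hH3 hH4).
Qed.
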